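(* Let $p$ be a prime number and $q=p^m$ with $m>1$. Let $G$ be one of the following finite quasisimple groups: $\mathrm{SL}_2(q)$, $\mathrm{PSL}_2(q)$, $\mathrm{SL}_3(p)$, or the Suzuki group ${}^2\!B_2(q)$ (in the latter case, $p=2$ and $m$ is odd). Let $M$ be any non-trivial abelian $p$-subgroup of $G$ of central type. Let $K\subset\mathbb C$ be a number field large enough so that $KM\cong K^{|M|}$ as algebras, and let $\omega:\widehat{M}\times\widehat{M}\to K^{\times}\subset\mathbb C^\times$ be any normalized non-degenerate $2$-cocycle. Then the complex semisimple Hopf algebra $(\mathbb{C}G)_{\Omega_{M,\omega}}$ does not admit a Hopf order over any number ring.
   Context: Central type: a finite abelian group $M$ is of central type if $M\cong E\times E$ for some group $E$ (equivalently, $\widehat M$ admits a non-degenerate $2$-cocycle). Twists: let $M$ be an abelian subgroup of a finite group $G$. Let $\widehat M$ be the group of characters $M\to \mathbb C^\times$ (which take values in $K^\times$ when $KM\cong K^{|M|}$), and for $\phi\in\widehat M$ put $e_\phi=\frac{1}{|M|}\sum_{v\in M}\phi(v^{-1})v$. A $2$-cocycle $\omega$ on $\widehat M$ (trivial action) is normalized if $\omega(\phi,\varepsilon)=\omega(\varepsilon,\phi)=1$ for the trivial character $\varepsilon$ and all $\phi$; it is non-degenerate if the skew-symmetric pairing $(\phi,\psi)\mapsto\omega(\phi,\psi)/\omega(\psi,\phi)$ on $\widehat M$ is non-degenerate. Put $\Omega=\Omega_{M,\omega}=\sum_{\phi,\psi\in\widehat M}\omega(\phi,\psi)\,e_\phi\otimes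 e_\psi\in \mathbb CG\otimes \mathbb CG$. The Hopf algebra $(\mathbb CG)_{\Omega}$ has the algebra structure and counit of $\mathbb CG$, coproduct $\Delta_\Omega(g)=\Omega(g\otimes g)\Omega^{-1}$ and antipode $S_\Omega(g)=Q\,g^{-1}Q^{-1}$ for $g\in G$, where $Q=\sum\Omega^{(1)}S(\Omega^{(2)})$, $\Omega=\sum\Omega^{(1)}\otimes\Omega^{(2)}$ and $S$ is the antipode of $\mathbb CG$. Hopf orders: let $H$ be a finite-dimensional Hopf algebra over a field $F$ and $R$ a subring of $F$. A Hopf order of $H$ over $R$ is a finitely generated projective $R$-submodule $X\subseteq H$ such that the natural map $X\otimes_R F\to H$ is an isomorphism and $1_H\in X$, $XX\subseteq X$, $\Delta(X)\subseteq X\otimes_R X$, $\varepsilon(X)\subseteq R$, $S(X)\subseteq X$. Here $F=\mathbb C$. A number ring is the ring of algebraic integers $\mathcal O_L$ of a number field $L\subset\mathbb C$. Suzuki group: for $q=2^{2n+1}$, $n\ge 1$, let $\theta$ be the automorphism $x\mapsto x^{2^{n+1}}$ of $\mathbb F_q$. Then ${}^2\!B_2(q)$ is the subgroup of $\mathrm{SL}_4(\mathbb F_q)$ generated by the matrices $u(a,b)=\begin{pmatrix}1&0&0&0\\ a&1&0&0\\ a\theta(a)+b&\theta(a)&1&0\\ a^2\theta(a)+ab+\theta(b)&b&a&1\end{pmatrix}$ ($a,b\in\mathbb F_q$), the matrices $\mathrm{diag}(a_1,a_2,a_2^{-1},a_1^{-1})$ with $\theta(a_1)=\kappa\theta(\kappa)$,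 $\theta(a_2)=\kappa$ ($\kappa\in\mathbb F_q^\times$), and the permutation matrix with $1$'s on the antidiagonal. Its order is $q^2(q-1)(q^2+1)$. *)

(* Defs.v *)
From HB Require Import structures.
From mathcomp Require Import all_boot all_order all_algebra all_fingroup.
From mathcomp Require Import all_solvable all_field.
From mathcomp Require Import complex reals.

Set Implicit Arguments.
Unset Strict Implicit.
Unset Printing Implicit Defensive.

Import GRing.Theory.
Local Open Scope ring_scope.

(* [galg F gT] is F[gT]: the functions gT -> F under convolution.  It is an   *)
(* alias because {ffun gT -> F} itself carries the pointwise product.         *)
Definition galg (F : fieldType) (gT : finGroupType) := {ffun gT -> F^o}.

Section GroupAlgebra.
Variables (F : fieldType) (gT : finGroupType).
Local Notation A := (galg F gT).
Implicit Types (x y z : A) (g h k : gT).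

HB.instance Definition _ := Vector.copy A {ffun gT -> F^o}.

Definition gelt g : A := [ffun h => (h == g)%:R].

Definition galg_mul x y : A := [ffun g => \sum_h x h * y (h^-1 * g)%g].

Fact galg_mulA : associative galg_mul.
Proof.
move=> x y z; apply/ffunP=> g; rewrite !ffunE.
transitivity (\sum_h \sum_k x h * y (h^-1 * k)%g * z (k^-1 * g)%g).
  apply: eq_bigr => h _; rewrite ffunE mulr_sumr.
  rewrite (reindex_inj (mulgI h^-1%g)) /=; apply: eq_bigr => k _.
  by rewrite mulrA invMg invgK -mulgA mulKVg.
rewrite exchange_big /=; apply: eq_bigr => k _.
by rewrite ffunE mulr_suml.
Qed.

Fact galg_mul1l : left_id (gelt 1) galg_mul.
Proof.
move=> x; apply/ffunP=> g; rewrite !ffunE (bigD1 1%g) //= ffunE eqxx mul1r.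
rewrite invg1 mul1g big1 ?addr0 // => h /negPf h1.
by rewrite ffunE h1 mul0r.
Qed.

Fact galg_mul1r : right_id (gelt 1) galg_mul.
Proof.
move=> x; apply/ffunP=> g; rewrite !ffunE (bigD1 g) //= ffunE mulVg eqxx mulr1.
rewrite big1 ?addr0 // => h /negPf hg.
by rewrite ffunE -eq_invg_mul invgK hg mulr0.
Qed.

Fact galg_mulDl : left_distributive galg_mul +%R.
Proof.
move=> x y z; apply/ffunP=> g; rewrite !ffunE -big_split /=.
by apply: eq_bigr => h _; rewrite ffunE mulrDl.
Qed.

Fact galg_mulDr : right_distributive galg_mul +%R.
Proof.
move=> x y z; apply/ffunP=> g; rewrite !ffunE -big_split /=.
by apply: eq_bigr => h _; rewrite ffunE mulrDr.
Qed.

Fact galg_1neq0 : gelt 1 != 0.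
Proof. by apply/eqP => /ffunP/(_ 1%g)/eqP; rewrite !ffunE eqxx oner_eq0. Qed.

HB.instance Definition _ := GRing.Zmodule_isNzRing.Build A
  galg_mulA galg_mul1l galg_mul1r galg_mulDl galg_mulDr galg_1neq0.

Fact galg_scaleAl (a : F) x y : a *: (x * y) = (a *: x) * y.
Proof.
apply/ffunP=> g; rewrite !ffunE scaler_sumr.
by apply: eq_bigr => h _; rewrite ffunE scalerAl.
Qed.

HB.instance Definition _ := GRing.Lmodule_isLalgebra.Build F A galg_scaleAl.

Fact galg_scaleAr (a : F) x y : a *: (x * y) = x * (a *: y).
Proof.
apply/ffunP=> g; rewrite !ffunE scaler_sumr.
by apply: eq_bigr => h _; rewrite ffunE scalerAr.
Qed.

HB.instance Definition _ := GRing.Lalgebra_isAlgebra.Build F A galg_scaleAr.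
HB.instance Definition _ := Algebra_isFalgebra.Build F A.

(* The linear extension to F[gT] of a map given on the basis gT. *)
Definition glin (V : lmodType F) (f : gT -> V) (x : A) : V :=
  \sum_g x g *: f g.

(* F[gT] (x) F[gT] is identified with F[gT * gT] by g (x) h <-> (g, h), which *)
(* is an isomorphism of algebras.                                             *)
Definition gtensor x y : galg F (gT * gT)%type := [ffun u => x u.1 * y u.2].

End GroupAlgebra.

Arguments gelt F {gT} g.
Arguments glin {F gT V} f x.

(* The operations of a finite-dimensional Hopf algebra; [hopf_square] is a    *)
(* model of the tensor square of the carrier.  The Hopf algebra axioms are    *)
(* not part of the record, as the definition of an order only uses the data.  *)
Record hopf_data (F : fieldType) := HopfData {
  hopf_sort :> falgType F;
  hopf_square : falgType F;
  hopf_tensor : hopf_sort -> hopf_sort -> hopf_square;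
  hopf_comul : hopf_sort -> hopf_square;
  hopf_counit : hopf_sort -> F;
  hopf_antipode : hopf_sort -> hopf_sort
}.

(* A subring R of F is given as a ring with an injective morphism to F. *)
Section HopfOrder.
Variables (F : fieldType) (R : comNzRingType) (i : {rmorphism R -> F}).

Section Submodule.
Variables (H : lmodType F) (X : H -> Prop).

Definition is_submodule :=
  [/\ X 0, forall x y, X x -> X y -> X (x + y)
    & forall r x, X x -> X (i r *: x)].

Definition finitely_generated :=
  exists (n : nat) (e : 'I_n -> H), (forall k, X (e k)) /\
    forall x, X x -> exists c : 'I_n -> R, x = \sum_(k < n) i (c k) *: e k.

Definition linear_on (V : lmodType R) (f : H -> V) :=
  (forall x y, X x -> X y -> f (x + y) = f x + f y) /\
  (forall r x, X x -> f (i r *: x) = r *: f x).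

Definition projective :=
  forall (V W : lmodType R) (g : {linear V -> W}) (f : H -> W),
    (forall w, exists v, g v = w) -> linear_on f ->
    exists2 h : H -> V, linear_on h & forall x, X x -> g (h x) = f x.

(* R-balanced biadditive maps X x F -> V *)
Definition balanced_on (V : zmodType) (b : H -> F -> V) :=
  [/\ forall x y c, X x -> X y -> b (x + y) c = b x c + b y c,
      forall x c d, X x -> b x (c + d) = b x c + b x d
    & forall r x c, X x -> b (i r *: x) c = b x (i r * c)].

(* The natural map X (x)_R F -> H, x (x) c |-> c x, is an isomorphism: with   *)
(* the map (x, c) |-> c x, H has the universal property of X (x)_R F.         *)
Definition natural_map_iso :=
  forall (V : zmodType) (b : H -> F -> V), balanced_on b ->
    exists2 g : {additive H -> V}, (forall x c, X x -> g (c *: x) = b x c)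
      & forall g' : {additive H -> V},
          (forall x c, X x -> g' (c *: x) = b x c) -> g' =1 g.

End Submodule.

(* The image of X (x)_R X in the tensor square of H *)
Definition tensor_span (H : hopf_data F) (X : H -> Prop) (z : hopf_square H) :=
  exists (n : nat) (x y : 'I_n -> H),
    (forall k, X (x k) /\ X (y k)) /\
    z = \sum_(k < n) hopf_tensor (x k) (y k).

Record hopf_order (H : hopf_data F) (X : H -> Prop) : Prop := HopfOrder {
  order_submodule : is_submodule X;
  order_fg : finitely_generated X;
  order_projective : projective X;
  order_tensor : natural_map_iso X;
  order_one : X 1;
  order_mul : forall x y, X x -> X y -> X (x * y);
  order_comul : forall x, X x -> tensor_span X (hopf_comul x);
  order_counit : forall x, X x -> exists r : R, hopf_counit x = i r;
  order_antipode : forall x, X x -> X (hopf_antipode x)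
}.

End HopfOrder.

(* i embeds R in F as the ring of algebraic integers of a number field L of F *)
Definition number_ring (F : fieldType) (R : comNzRingType)
    (i : {rmorphism R -> F}) : Prop :=
  injective i /\
  exists (L : fieldExtType rat) (j : {rmorphism L -> F}),
    forall z : F, (exists r : R, i r = z) <->
      (exists2 x : L, integralOver (intr : int -> L) x & j x = z).

(* The character group of a finite group aT, with values in F^*. *)
Definition is_char (F : fieldType) (aT : finGroupType) (phi : {ffun aT -> F}) :=
  [forall x, phi x != 0] && [forall x, forall y, phi (x * y)%g == phi x * phi y].

Record char_group (F : fieldType) (aT : finGroupType) :=
  CharGroup { char_fun :> {ffun aT -> F}; _ : is_char char_fun }.

HB.instance Definition _ (F : fieldType) (aT : finGroupType) :=
  [isSub for @char_fun F aT].
HB.instance Definition _ (F : fieldType) (aT : finGroupType) :=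
  [Choice of char_group F aT by <:].

Section CharGroupTheory.
Variables (F : fieldType) (aT : finGroupType).
Implicit Types phi psi : char_group F aT.

Lemma char_neq0 phi x : phi x != 0.
Proof. by case: phi => phi /= /andP[/forallP]. Qed.

Lemma charM phi x y : phi (x * y)%g = phi x * phi y.
Proof.
by case: phi => phi /= /andP[_ /forallP/(_ x)/forallP/(_ y)/eqP].
Qed.

Lemma is_charP (f : {ffun aT -> F}) : (forall x, f x != 0) ->
  (forall x y, f (x * y)%g = f x * f y) -> is_char f.
Proof.
move=> f0 fM; apply/andP; split; first exact/forallP.
by apply/forallP=> x; apply/forallP=> y; apply/eqP.
Qed.

Fact char_one_subproof : is_char ([ffun=> 1] : {ffun aT -> F}).
Proof. by apply: is_charP => [x|x y]; rewrite !ffunE ?oner_eq0 ?mulr1. Qed.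

Fact char_mul_subproof phi psi : is_char [ffun x : aT => phi x * psi x].
Proof.
apply: is_charP => [x|x y]; rewrite !ffunE ?mulf_neq0 ?char_neq0 //.
by rewrite !charM mulrACA.
Qed.

Fact char_inv_subproof phi : is_char [ffun x : aT => (phi x)^-1].
Proof.
apply: is_charP => [x|x y]; rewrite !ffunE ?invr_neq0 ?char_neq0 //.
by rewrite charM invfM.
Qed.

Definition char_one := CharGroup char_one_subproof.
Definition char_mul phi psi := CharGroup (char_mul_subproof phi psi).
Definition char_inv phi := CharGroup (char_inv_subproof phi).

Fact char_mulA : associative char_mul.
Proof. by move=> f g h; apply/val_inj/ffunP=> x; rewrite !ffunE mulrA. Qed.

Fact char_mul1 : left_id char_one char_mul.
Proof. by move=> f; apply/val_inj/ffunP=> x; rewrite !ffunE mul1r. Qed.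

Fact char_mulV : left_inverse char_one char_inv char_mul.
Proof.
by move=> f; apply/val_inj/ffunP=> x; rewrite !ffunE mulVf ?char_neq0.
Qed.

End CharGroupTheory.

(* Over an algebraically closed field [char_group] is a finite group, as the  *)
(* values of a character are #|aT|-th roots of unity.                         *)
Section CharGroupFinite.
Variables (F : closedFieldType) (aT : finGroupType).
Implicit Types phi : char_group F aT.

Let unity_roots : seq F :=
  sval (closed_field_poly_normal ('X^#|aT| - 1 : {poly F})).

Fact char_unity_root phi x : phi x \in unity_roots.
Proof.
have phi1 : phi 1%g = 1.
  by apply: (mulfI (char_neq0 phi 1%g)); rewrite -charM mulg1 mulr1.
have phiX n : phi (x ^+ n)%g = phi x ^+ n.
  by elim: n => [|n IHn]; rewrite ?expg0 // expgS charM IHn exprS.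
have rt : root ('X^#|aT| - 1 : {poly F}) (phi x).
  rewrite rootE !hornerE -phiX -[#|aT|]cardsT.
  by rewrite expg_cardG ?inE // phi1 subrr.
have n_gt0 : (0 < #|aT|)%N by apply/card_gt0P; exists 1%g.
move: rt; rewrite /unity_roots; case: (closed_field_poly_normal _) => s /= ->.
by rewrite (monicP (monicXnsubC 1 n_gt0)) scale1r root_prod_XsubC.
Qed.

Let char_encode phi : {ffun aT -> seq_sub unity_roots} :=
  [ffun x => SeqSub (char_unity_root phi x)].
Let char_decode (f : {ffun aT -> seq_sub unity_roots}) :
  option (char_group F aT) := insub [ffun x => val (f x)].

Fact char_encodeK : pcancel char_encode char_decode.
Proof.
move=> phi; rewrite /char_decode -[RHS](valK phi); congr insub.
by apply/ffunP=> x; rewrite !ffunE.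
Qed.

HB.instance Definition _ :
  isCountable (char_group F aT) := PCanIsCountable char_encodeK.
HB.instance Definition _ :
  isFinite (char_group F aT) := PCanIsFinite char_encodeK.
HB.instance Definition _ := Finite_isGroup.Build (char_group F aT)
  (@char_mulA F aT) (@char_mul1 F aT) (@char_mulV F aT).

End CharGroupFinite.

(* Two-cocycles D x D -> K^*, for the trivial action, and their skew pairing  *)
Section Cocycles.
Variables (D : finGroupType) (K : fieldType) (w : D -> D -> K).

Definition two_cocycle :=
  (forall x y, w x y != 0) /\
  (forall x y z, w x y * w (x * y)%g z = w y z * w x (y * z)%g).

Definition cocycle_normalized := forall x, w x 1%g = 1 /\ w 1%g x = 1.

(* As D is finite, triviality of the radical on one side implies it on the    *)
(* other by skew-symmetry.                                                    *)
Definition cocycle_nondegenerate :=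
  forall x, (forall y, w x y / w y x = 1) -> x = 1%g.

End Cocycles.

Section Twist.
Variables (F : closedFieldType) (gT : finGroupType) (M : {group gT}).
Local Notation Mhat := (char_group F (subg_of M)).
Variable w : Mhat -> Mhat -> F.

Definition char_idem (phi : Mhat) : galg F gT :=
  (#|M|%:R)^-1 *: \sum_v phi v^-1%g *: gelt F (sgval v).

Definition twist_elt : galg F (gT * gT)%type :=
  \sum_phi \sum_psi w phi psi *: gtensor (char_idem phi) (char_idem psi).

(* Q = m ((id (x) S) twist_elt), with S g = g^-1 on gT *)
Definition twist_Q : galg F gT :=
  glin (fun u : gT * gT => gelt F u.1 * gelt F u.2^-1%g) twist_elt.

Definition twisted_galg : hopf_data F :=
  @HopfData F (galg F gT) (galg F (gT * gT)%type)
    (@gtensor F gT)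
    (glin (fun g => twist_elt * gtensor (gelt F g) (gelt F g) * twist_elt^-1))
    (glin (fun _ => 1 : F^o))
    (glin (fun g => twist_Q * gelt F g^-1%g * twist_Q^-1)).

End Twist.

(* K M and K^|M| are isomorphic K-algebras. *)
Definition splits_galg (K : fieldType) (gT : finGroupType) (M : {group gT}) :=
  exists f : {linear galg K (subg_of M) -> {ffun 'I_#|M| -> K^o}},
    bijective f /\ monoid_morphism f.

Definition central_type (gT : finGroupType) (M : {group gT}) :=
  exists (eT : finGroupType) (E : {group eT}), M \isog setX E E.

Section LinearGroups.
Variables (n : nat) (F : finFieldType).

Definition SL_set := [set g : {'GL_n[F]} | \det (GLval g) == 1].

Fact SL_group_set : group_set SL_set.
Proof.
apply/group_setP; split; first by rewrite inE GL_1E det1.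
by move=> g h; rewrite !inE GL_ME det_mulmx => /eqP-> /eqP->; rewrite mulr1.
Qed.

Definition SL : {group {'GL_n[F]}} := Group SL_group_set.

End LinearGroups.

Definition PSL n (F : finFieldType) : {group coset_of 'Z(SL n F)} :=
  (SL n F / 'Z(SL n F))%G.

(* The Suzuki group over F, for #|F| = 2 ^ (2 n + 1); all the generators have *)
(* determinant 1 in characteristic 2, so it is also generated inside SL 4 F.  *)
Section Suzuki.
Variables (n : nat) (F : finFieldType).
Implicit Types a b k : F.

Definition suz_theta a : F := a ^+ (2 ^ n.+1).
Local Notation theta := suz_theta.

Definition mx_of_rows (s : seq (seq F)) : 'M[F]_4 :=
  \matrix_(i < 4, j < 4) nth 0 (nth [::] s i) j.

Definition suz_u a b := mx_of_rows
  [:: [:: 1; 0; 0; 0];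
      [:: a; 1; 0; 0];
      [:: a * theta a + b; theta a; 1; 0];
      [:: a ^+ 2 * theta a + a * b + theta b; b; a; 1]].

Definition suz_diag a1 a2 := mx_of_rows
  [:: [:: a1; 0; 0; 0];
      [:: 0; a2; 0; 0];
      [:: 0; 0; a2^-1; 0];
      [:: 0; 0; 0; a1^-1]].

Definition suz_antidiag := mx_of_rows
  [:: [:: 0; 0; 0; 1];
      [:: 0; 0; 1; 0];
      [:: 0; 1; 0; 0];
      [:: 1; 0; 0; 0]].

Definition suz_generators : {set {'GL_4[F]}} :=
  [set g : {'GL_4[F]} | [exists a, exists b, GLval g == suz_u a b]]
  :|: [set g : {'GL_4[F]} | [exists a1, exists a2, exists k,
        [&& k != 0, theta a1 == k * theta k, theta a2 == k
          & GLval g == suz_diag a1 a2]]]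
  :|: [set g : {'GL_4[F]} | GLval g == suz_antidiag].

Definition suzuki : {group {'GL_4[F]}} := <<suz_generators>>%G.

End Suzuki.

(* Main.v *)
Require Import Defs.
From HB Require Import structures.
From mathcomp Require Import all_boot all_order all_algebra all_fingroup.
From mathcomp Require Import all_solvable all_field.
From mathcomp Require Import complex reals boolp ring.

Set Implicit Arguments.
Unset Strict Implicit.
Unset Printing Implicit Defensive.

Import GRing.Theory.
Local Open Scope ring_scope.

(** A Hopf order is a lattice of algebraic integers, and it forces a divisibility
    that fails for two well-chosen elements of the group.

    Let X be an order of the twisted group algebra. As X is projective it has a
    dual basis, over which product and coproduct have algebraic integers as
    coefficients ([hopf_order_form]); only such an integral form is used. It
    defines a lattice, the elements with integral coordinates, and dually the
    functionals that are integral on it. Both contain explicit elements, for one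
    reason: if a matrix N multiplies a finite family that spans the identity by an
    integral matrix, then the trace of N is integral ([algint_mxtrace]).
    - In the regular representation this shows that the class functional of an
      element s, the multiple #|C(s)| of the indicator of its conjugacy class, is
      integral ([class_functional_dual]).
    - For t in G the elements e_phi t e_psi span a coalgebra, which after the
      twist is a comatrix coalgebra because w is non-degenerate. So the algebra of
      functionals has a representation whose trace is the evaluation at
      |M| e_1 t e_1, where 1 is the trivial character; it lies in the lattice
      ([scaled_counit_lattice]).
    Contract the coproduct of |M| e_1 t e_1 with the class functional of t. If t v
    is not conjugate to t for any v != 1 in M, the result is #|C(t)| times the
    average of a t a^-1 over a in M ([conj_average_lattice]). For two such
    elements t and u, evaluate the class functional of t u on the product of the
    two averages: the outcome is an algebraic integer, namely
    #|C(t)| #|C(u)| #|C(t u)| N / |M|, where N counts the a in M for which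
    t (a u a^-1) is conjugate to t u. When the three centralisers have orders
    prime to p, |M| divides N; but a = 1 is counted, and N < |M| is a
    contradiction ([obstruction_no_hopf_order]).

    It remains to find t and u. Each group is covered by a matrix group, in which
    M lifts to a p-group of unitriangular matrices (Sylow), and the trace tells
    conjugacy classes apart.
    - SL_2(q) and PSL_2(q): the trace of t (a u a^-1) is a quadratic polynomial in
      the entry of a, so that N <= 3 < p^2 <= |M|.
    - SL_3(p): t = u is a cyclic matrix of order prime to p. As M is commutative,
      the superdiagonals of its elements lie on a line, and the trace, a quadratic
      form on that line, shows that N <= p < p^2 <= |M|.
    - Suzuki groups: by the Bruhat decomposition the matrices u(a, b) form a Sylow
      subgroup. A group of central type in it has exponent 2 and consists of
      matrices u(0, b). For t = u of order 5 the trace gives N = 1. *)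

(** * Algebraic integers and traces *)

Section AlgebraicIntegers.
Variable F : numClosedFieldType.
Implicit Types z u v : F.

Definition algint z := integralOver (intr : int -> F) z.

Lemma algint_nat k : algint k%:R. Proof. exact: integral_nat. Qed.
Lemma algint0 : algint 0. Proof. exact: integral0. Qed.
Lemma algint1 : algint 1. Proof. exact: integral1. Qed.
Lemma algintN u : algint u -> algint (- u). Proof. exact: integral_opp. Qed.
Lemma algintD u v : algint u -> algint v -> algint (u + v).
Proof. exact: integral_add. Qed.
Lemma algintM u v : algint u -> algint v -> algint (u * v).
Proof. exact: integral_mul. Qed.

Lemma algint_sum (I : Type) (r : seq I) (P : pred I) (f : I -> F) :
  (forall i, P i -> algint (f i)) -> algint (\sum_(i <- r | P i) f i).
Proof. by move=> fO; elim/big_ind: _ => //; [exact: algint0 | exact: algintD]. Qed.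

Definition aint_pred : {pred F} := fun z => `[< algint z >].

Fact aint_subring : subring_closed aint_pred.
Proof.
split=> [|u v|u v]; rewrite ?unfold_in.
- exact/asboolP/algint1.
- by move=> /asboolP uO /asboolP vO; apply/asboolP/algintD/algintN.
- by move=> /asboolP uO /asboolP vO; apply/asboolP/algintM.
Qed.

HB.instance Definition _ := GRing.isSubringClosed.Build F aint_pred aint_subring.

Lemma aint_predP z : reflect (algint z) (z \in aint_pred).
Proof. exact: asboolP. Qed.

Lemma algint_root_monic (P : {poly F}) z :
  P \is monic -> P \is a polyOver aint_pred -> root P z -> algint z.
Proof.
move=> monP /allP PO Pz; apply: (integral_root_monic monP Pz) => u /PO.
by move/aint_predP.
Qed.

Lemma char_poly_over (S : subringClosed F) n (A : 'M[F]_n) :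
  (forall i k, A i k \in S) -> char_poly A \is a polyOver S.
Proof.
move=> AS; rewrite /char_poly /determinant rpred_sum // => s _.
rewrite rpredM // ?rpredX ?rpredN ?rpred1 // rpred_prod // => i _.
by rewrite !mxE rpredB ?rpredMn ?polyOverX ?polyOverC.
Qed.

Lemma algint_eigenvalue n (A : 'M[F]_n) z :
  (forall i k, algint (A i k)) -> eigenvalue A z -> algint z.
Proof.
move=> AO; rewrite eigenvalue_root_char; apply: algint_root_monic.
  exact: char_poly_monic.
by apply: char_poly_over => i k; apply/aint_predP.
Qed.

(** The trace is, up to sign, a coefficient of the product of the X - z. *)
Lemma algint_mxtrace_spectrum n (N : 'M[F]_n) :
  (forall z, eigenvalue N z -> algint z) -> algint (\tr N).
Proof.
case: n N => [|n] N evO; first by rewrite /mxtrace big_ord0; exact: algint0.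
have [s Ps] := closed_field_poly_normal (char_poly N).
rewrite (monicP (char_poly_monic N)) scale1r in Ps.
rewrite -[\tr N]opprK -char_poly_trace //; apply: algintN.
apply/aint_predP/polyOverP; rewrite Ps big_seq.
apply: rpred_prod => z zs; rewrite polyOverXsubC; apply/aint_predP/evO.
by rewrite eigenvalue_root_char Ps root_prod_XsubC.
Qed.

(** Let v be a row eigenvector of N for z. Some entry of some v B_i is non-zero,
    because the B_i span the identity, and the corresponding entries of all the
    v B_i form an eigenvector for z of the integral matrix A. So the eigenvalues
    of N are integral. *)
Lemma algint_mxtrace (I : finType) n (N : 'M[F]_n) (B : I -> 'M[F]_n)
    (A : I -> I -> F) (c : I -> F) :
    (forall i k, algint (A i k)) ->
    (forall i, N *m B i = \sum_k A i k *: B k) ->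
    1%:M = \sum_i c i *: B i ->
  algint (\tr N).
Proof.
move=> AO NB B1; apply: algint_mxtrace_spectrum => z /eigenvalueP[v vN v0].
have /existsP[i /existsP[j vBij]] : [exists i, exists j, (v *m B i) 0 j != 0].
  apply: contraR v0 => /existsPn vB0; rewrite -[v]mulmx1 B1 mulmx_sumr big1 //.
  move=> i _; rewrite -scalemxAr; apply/rowP=> j; rewrite !mxE.
  by have /existsPn/(_ j) := vB0 i; rewrite negbK mxE => /eqP->; rewrite mulr0.
pose w : 'rV_#|I| := \row_k (v *m B (enum_val k)) 0 j.
pose A' : 'M[F]_#|I| := \matrix_(k, l) A (enum_val l) (enum_val k).
apply: (@algint_eigenvalue _ A') => [k l|]; first by rewrite mxE.
apply/eigenvalueP; exists w; last first.
  apply: contraNneq vBij => /rowP/(_ (enum_rank i)).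
  by rewrite [w _ _]mxE enum_rankK => ->; rewrite mxE.
apply/rowP=> k; rewrite [LHS]mxE [RHS]mxE.
transitivity ((v *m (N *m B (enum_val k))) 0 j).
  rewrite NB mulmx_sumr summxE [RHS](reindex_onto enum_val enum_rank) /=; last first.
    by move=> l _; rewrite enum_rankK.
  apply: eq_big => [l|l _]; first by rewrite enum_valK eqxx.
  by rewrite -scalemxAr [w _ _]mxE [A' _ _]mxE mulrC [RHS]mxE.
by rewrite mulmxA vN -scalemxAl [LHS]mxE [w _ _]mxE.
Qed.

(** A rational algebraic integer is an integer. *)
Lemma algint_natdiv (a b : nat) :
  (0 < b)%N -> algint (a%:R / b%:R) -> (b %| a)%N.
Proof.
move=> b_gt0 [P monP Pab]; pose x : rat := a%:R / b%:R.
have Px : root (map_poly intr P) x.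
  rewrite -(fmorph_root (ratr : {rmorphism rat -> F})) -map_poly_comp.
  rewrite (eq_map_poly (g := intr)) => [|k /=]; last by rewrite ratr_int.
  by rewrite fmorph_div !rmorph_nat.
have: (ratr x : algC) \in Num.int.
  apply: Cint_rat_Aint (Crat_rat _) _.
  apply: (@root_monic_Aint (map_poly intr P)).
  - rewrite (eq_map_poly (g := ratr \o intr)) => [|k /=]; last by rewrite ratr_int.
    by rewrite map_poly_comp fmorph_root.
  - exact: monic_map.
  - by apply/polyOverP=> i; rewrite coef_map Num.Theory.intr_int.
rewrite Cint_rat => /Num.Theory.intrP[k xk]; rewrite /x in xk.
have {}xk : (a%:Z = k * b%:Z)%R.
  apply: (@intr_inj rat); rewrite intrM -xk -!pmulrn mulfVK //.
  by rewrite Num.Theory.pnatr_eq0 -lt0n.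
by rewrite -[(b %| a)%N]/(b%:Z %| a%:Z)%Z; apply/dvdzP; exists k.
Qed.

End AlgebraicIntegers.

(** * The dual basis of an order *)

(** An alias of H, on which R acts through i. *)
Definition restrict_scalars (F : fieldType) (R : comNzRingType)
  (i : {rmorphism R -> F}) (H : lmodType F) : Type := H.

Section RestrictScalars.
Variables (F : fieldType) (R : comNzRingType) (i : {rmorphism R -> F}).
Variable H : lmodType F.

HB.instance Definition _ := GRing.Zmodule.copy (restrict_scalars i H) H.

Let scale (r : R) (x : restrict_scalars i H) : restrict_scalars i H :=
  i r *: (x : H).

Fact restrict_scaleA r s x : scale r (scale s x) = scale (r * s) x.
Proof. by rewrite /scale scalerA rmorphM. Qed.
Fact restrict_scale1 : left_id 1 scale.
Proof. by move=> x; rewrite /scale rmorph1 scale1r. Qed.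
Fact restrict_scaleDr : right_distributive scale +%R.
Proof. by move=> r x y; rewrite /scale scalerDr. Qed.
Fact restrict_scaleDl x : {morph scale^~ x : r s / r + s}.
Proof. by move=> r s; rewrite /scale rmorphD scalerDl. Qed.

HB.instance Definition _ := GRing.Zmodule_isLmodule.Build R
  (restrict_scalars i H) restrict_scaleA restrict_scale1 restrict_scaleDr
  restrict_scaleDl.

Variables (X : H -> Prop) (subX : is_submodule i X).

Definition submodule_pred of is_submodule i X : {pred restrict_scalars i H} :=
  fun x => `[< X x >].

Fact submodule_predP : submod_closed (submodule_pred subX).
Proof.
case: subX => X0 XD XZ; split; first exact/asboolP.
by move=> r x y /asboolP Xx /asboolP Xy; apply/asboolP/XD => //; apply: XZ.
Qed.

HB.instance Definition _ := GRing.isSubmodClosed.Build R (restrict_scalars i H)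
  (submodule_pred subX) submodule_predP.

Record submodule := Submodule {
  submodule_val : restrict_scalars i H;
  _ : submodule_val \in submodule_pred subX
}.

HB.instance Definition _ := [isSub for submodule_val].
HB.instance Definition _ := [Choice of submodule by <:].
HB.instance Definition _ := [SubChoice_isSubLmodule of submodule by <:].

End RestrictScalars.

Section LinearCombination.
Variables (R : comNzRingType) (W : lmodType R) (n : nat) (E : 'I_n -> W).

Definition lincomb (c : {ffun 'I_n -> R^o}) := \sum_k (c k : R) *: E k.

Fact lincomb_linear : linear lincomb.
Proof.
move=> r c d; rewrite /lincomb scaler_sumr -big_split; apply: eq_bigr => k _.
by rewrite !ffunE scalerDl scalerA.
Qed.

HB.instance Definition _ := GRing.isLinear.Build R {ffun 'I_n -> R^o} W _
  lincomb lincomb_linear.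

End LinearCombination.

Section DualBasis.
Variables (F : fieldType) (R : comNzRingType) (i : {rmorphism R -> F}).
Variables (H : vectType F) (X : H -> Prop).
Hypotheses (subX : is_submodule i X) (fgX : finitely_generated i X).
Hypotheses (projX : projective i X) (isoX : natural_map_iso i X).

(** On X both the zero map and the projection parallel to the span of the e_k
    vanish. By uniqueness in the universal property of X (x) F they agree. *)
Lemma natural_map_span n (e : 'I_n -> H) :
    (forall k, X (e k)) ->
    (forall x, X x -> exists c : 'I_n -> R, x = \sum_(k < n) i (c k) *: e k) ->
  forall x, exists c : 'I_n -> F, x = \sum_k c k *: e k.
Proof.
move=> Xe gen; pose E := mktuple e; pose U := <<E>>%VS.
have [|g _ g_uniq] := @isoX H (fun _ _ => 0).
  by split=> *; rewrite ?addr0.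
have XU x : X x -> x \in U.
  move=> /gen[c ->]; apply: rpred_sum => k _; apply: rpredZ.
  by apply/memv_span/tnthP; exists k; rewrite tnth_mktuple.
have g0 := g_uniq (0 : 'End(H)).
have gp := g_uniq (\1%VF - projv U : 'End(H)).
have pE y : (\1%VF - projv U : 'End(H)) y = y - projv U y.
  by rewrite add_lfunE opp_lfunE id_lfunE.
move=> x; suffices Ux : x \in U.
  exists (fun k => coord E k x); rewrite {1}(coord_span Ux).
  by apply: eq_bigr => k _; rewrite -tnth_nth tnth_mktuple.
have /eqP: (\1%VF - projv U : 'End(H)) x = (0 : 'End(H)) x.
  rewrite gp => [|y c Xy /=]; last by rewrite pE projv_id ?subrr ?rpredZ ?XU.
  by rewrite g0 // => y c _ /=; rewrite zero_lfunE.
by rewrite pE zero_lfunE subr_eq0 => /eqP->; apply: memv_proj.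
Qed.

(** Lift the identity of X along the map from the free module on the generators. *)
Lemma dual_basis_lattice : exists (n : nat) (e : 'I_n -> H) (h : 'I_n -> H -> R),
  [/\ forall k, X (e k), forall k x y, X x -> X y -> h k (x + y) = h k x + h k y,
      forall k r x, X x -> h k (i r *: x) = r * h k x
    & forall x, X x -> x = \sum_k i (h k x) *: e k].
Proof.
have [n [e [Xe gen]]] := fgX; exists n, e.
have inX x : X x -> x \in submodule_pred subX by move=> Xx; apply/asboolP.
pose E k : submodule subX := Submodule (inX _ (Xe k)).
pose f (x : H) : submodule subX := insubd 0 (x : restrict_scalars i H).
have fE x : X x -> val (f x) = x by move=> Xx; rewrite insubdK ?inX.
have valX (w : submodule subX) : X (val w) by case: w => w /= /asboolP.
have [X0 XD XZ] := subX.
have val_lincomb c : val (lincomb E c) = \sum_k i (c k) *: e k.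
  by rewrite raddf_sum; apply: eq_bigr => k _; reflexivity.
have [||h [hD hZ] hK] := @projX _ _ (lincomb E : {linear _ -> _}) f.
- move=> w; have [c cw] := gen _ (valX w); exists [ffun k => c k].
  apply/val_inj; rewrite val_lincomb cw.
  by apply: eq_bigr => k _; rewrite ffunE.
- split=> [x y Xx Xy|r x Xx]; apply/val_inj.
    by rewrite raddfD /= !fE //; apply: XD.
  by rewrite linearZ /= !fE //; apply: XZ.
exists (fun k x => h x k); split=> //.
- by move=> k x y Xx Xy; rewrite hD // ffunE.
- by move=> k r x Xx; rewrite hZ // ffunE.
- by move=> x Xx; rewrite -{1}(fE x Xx) -hK // val_lincomb.
Qed.

(** The coordinates on X extend to F-linear functionals on H by the universal
    property of X (x) F. *)
Lemma dual_basis : exists (n : nat) (e : 'I_n -> H) (g : 'I_n -> {linear H -> F^o}),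
  [/\ forall k, X (e k), forall k x, X x -> exists r, g k x = i r
    & forall x, x = \sum_k g k x *: e k].
Proof.
have [n [e [h [Xe hD hZ hE]]]] := dual_basis_lattice.
have genX x : X x -> exists c : 'I_n -> R, x = \sum_(k < n) i (c k) *: e k.
  by move=> Xx; exists (h^~ x); exact: hE.
have span_e := natural_map_span Xe genX.
have ext k : exists g : {linear H -> F^o}, forall x, X x -> g x = i (h k x).
  have [|g gE _] := @isoX F^o (fun x c => c * i (h k x)).
    split=> [x y c Xx Xy|x c d Xx|r x c Xx].
    - by rewrite hD // rmorphD mulrDr.
    - by rewrite mulrDl.
    - by rewrite hZ // rmorphM mulrCA mulrA.
  have gZ a x : g (a *: x) = a * g x :> F.
     have [c ->] := span_e x.
    have -> : a *: (\sum_k c k *: e k) = \sum_k (a * c k) *: e k.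
      by rewrite scaler_sumr; apply: eq_bigr => l _; rewrite scalerA.
    rewrite !raddf_sum mulr_sumr; apply: eq_bigr => l _.
    by rewrite !gE ?Xe // -mulrA.
  have gL_subproof : linear (g : H -> F^o) by move=> a x y; rewrite raddfD gZ.
  pose gL : {linear H -> F^o} :=
    HB.pack (g : H -> F^o) (GRing.isLinear.Build F H F^o *:%R g gL_subproof).
  by exists gL => x Xx; rewrite -[x in LHS]scale1r [LHS]gE // mul1r.
pose g k := projT1 (cid (ext k)).
have gE k x : X x -> g k x = i (h k x) by exact: (projT2 (cid (ext k))).
exists n, e, g; split=> // [k x Xx|x]; first by exists (h k x); rewrite gE.
have [c xc] := span_e x; rewrite {1}xc.
transitivity (\sum_l c l *: \sum_k g k (e l) *: e k).
  apply: eq_bigr => l _; congr (_ *: _); rewrite {1}(hE _ (Xe l)).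
  by apply: eq_bigr => k _; rewrite gE.
transitivity (\sum_l \sum_k (c l * g k (e l)) *: e k).
  by apply: eq_bigr => l _; rewrite scaler_sumr; apply: eq_bigr => k _; rewrite scalerA.
rewrite exchange_big; apply: eq_bigr => k _; rewrite -scaler_suml xc raddf_sum.
by congr (_ *: _); apply: eq_bigr => l _; exact: esym (linearZ_LR (g k) _ _).
Qed.
End DualBasis.

(** * Integral forms of the group algebra *)

Section GroupAlgebraTheory.
Variables (F : fieldType) (gT : finGroupType).
Local Notation A := (galg F gT).
Implicit Types (x y z : A) (g h : gT).

Lemma galgME x y g : (x * y) g = \sum_h x h * y (h^-1 * g)%g.
Proof. by rewrite ffunE. Qed.

Lemma galgZE (a : F) x g : (a *: x) g = a * x g.
Proof. by rewrite ffunE. Qed.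

Lemma galg_sumE (I : Type) (r : seq I) (P : pred I) (f : I -> A) g :
  (\sum_(i <- r | P i) f i) g = \sum_(i <- r | P i) f i g.
Proof. by rewrite sum_ffunE. Qed.

Lemma geltM g h : gelt F g * gelt F h = gelt F (g * h)%g.
Proof.
apply/ffunP=> k; rewrite galgME (bigD1 g) //= big1 => [|l /negPf lg].
  by rewrite !ffunE eqxx mul1r addr0 -(inj_eq (mulgI g) (g^-1 * k)%g) mulKVg.
by rewrite ffunE lg mul0r.
Qed.

Lemma galg_gelt x : x = \sum_g x g *: gelt F g.
Proof.
apply/ffunP=> h; rewrite galg_sumE (bigD1 h) //= big1 => [|g /negPf gh].
  by rewrite galgZE ffunE eqxx mulr1 addr0.
by rewrite galgZE ffunE eq_sym gh mulr0.
Qed.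

Lemma glin_is_linear (V : lmodType F) (f : gT -> V) : linear (glin f).
Proof.
move=> a x y; rewrite /glin scaler_sumr -big_split; apply: eq_bigr => g _.
by rewrite !ffunE scalerDl scalerA.
Qed.

HB.instance Definition _ (V : lmodType F) (f : gT -> V) :=
  GRing.isLinear.Build F A V *:%R (glin f) (glin_is_linear f).

Lemma glin_gelt (V : lmodType F) (f : gT -> V) g : glin f (gelt F g) = f g.
Proof.
rewrite /glin (bigD1 g) //= big1 => [|h /negPf hg]; rewrite ffunE.
  by rewrite eqxx scale1r addr0.
by rewrite hg scale0r.
Qed.

End GroupAlgebraTheory.

Section TensorSquare.
Variables (F : fieldType) (gT : finGroupType).
Local Notation A := (galg F gT).
Local Notation A2 := (galg F (gT * gT)%type).
Implicit Types (x y z : A) (g h : gT).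

Lemma gtensorE x y g h : gtensor x y (g, h) = x g * y h.
Proof. by rewrite ffunE. Qed.

Lemma gtensorM x y z t :
  gtensor x y * gtensor z t = gtensor (x * z) (y * t).
Proof.
apply/ffunP=> -[g h]; rewrite gtensorE !ffunE big_distrlr /=.
rewrite pair_bigA; apply: eq_bigr => -[k l] _ /=; rewrite !ffunE /= mulrACA.
by [].
Qed.

Lemma gtensor_suml (I : Type) (r : seq I) (P : pred I) (f : I -> A) y :
  gtensor (\sum_(i <- r | P i) f i) y = \sum_(i <- r | P i) gtensor (f i) y.
Proof.
apply/ffunP=> -[g h]; rewrite gtensorE [RHS]sum_ffunE galg_sumE mulr_suml.
by apply: eq_bigr => i _; rewrite gtensorE.
Qed.

Lemma gtensor_sumr (I : Type) (r : seq I) (P : pred I) (f : I -> A) y :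
  gtensor y (\sum_(i <- r | P i) f i) = \sum_(i <- r | P i) gtensor y (f i).
Proof.
apply/ffunP=> -[g h]; rewrite gtensorE [RHS]sum_ffunE galg_sumE mulr_sumr.
by apply: eq_bigr => i _; rewrite gtensorE.
Qed.

Lemma gtensorZl (a : F) x y : gtensor (a *: x) y = a *: gtensor x y.
Proof. by apply/ffunP=> -[g h]; rewrite galgZE !gtensorE galgZE mulrA. Qed.

Lemma gtensorZr (a : F) x y : gtensor x (a *: y) = a *: gtensor x y.
Proof. by apply/ffunP=> -[g h]; rewrite galgZE !gtensorE galgZE mulrCA. Qed.

(** The map f (x) id. *)
Definition contract (f : {linear A -> F^o}) (z : A2) : A :=
  glin (fun u : gT * gT => (f (gelt F u.1) : F) *: gelt F u.2) z.

Lemma contract_is_linear f : linear (contract f).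
Proof. by move=> a x y; rewrite /contract linearP. Qed.

HB.instance Definition _ f :=
  GRing.isLinear.Build F A2 A *:%R (contract f) (contract_is_linear f).

Lemma functional_gelt (f : {linear A -> F^o}) x :
  f x = \sum_g x g * f (gelt F g) :> F.
Proof.
rewrite {1}(galg_gelt x) linear_sum; apply: eq_bigr => g _.
exact: (linearZ_LR f).
Qed.

Lemma contract_gtensor f x y : contract f (gtensor x y) = (f x : F) *: y.
Proof.
transitivity (\sum_g \sum_h (x g * f (gelt F g)) *: (y h *: gelt F h)).
  rewrite pair_bigA; apply: eq_bigr => -[g h] _ /=.
  by rewrite gtensorE !scalerA mulrAC.
rewrite exchange_big functional_gelt [in RHS](galg_gelt y) scaler_sumr.
by apply: eq_bigr => h _; rewrite scaler_suml.
Qed.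

End TensorSquare.

(** What is retained of a Hopf order. The e_k may be linearly dependent: together
    with the coordinate functionals c_k they form a dual basis, as for generators
    of a projective module. *)
Section IntegralForm.
Variables (F : numClosedFieldType) (gT : finGroupType).
Local Notation A := (galg F gT).
Local Notation A2 := (galg F (gT * gT)%type).
Implicit Types (x y z : A) (g h : gT) (f : {linear A -> F^o}).

Record integral_form (comul : A -> A2) (n : nat)
    (e : 'I_n -> A) (c : 'I_n -> {linear A -> F^o}) := IntegralForm {
  form_span : forall x, x = \sum_k (c k x : F) *: e k;
  form_basis : forall k l, algint (c k (e l) : F);
  form_mul : forall k l m, algint (c k (e l * e m) : F);
  form_comul : forall k, exists2 d : 'I_n -> 'I_n -> F,
    (forall l m, algint (d l m)) &
    comul (e k) = \sum_l \sum_m d l m *: gtensor (e l) (e m)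
}.

Variables (comul : {linear A -> A2}) (n : nat).
Variables (e : 'I_n -> A) (c : 'I_n -> {linear A -> F^o}).
Hypothesis form : integral_form comul e c.

Definition lattice x := forall k, algint (c k x : F).
Definition dual_lattice f := forall k, algint (f (e k) : F).

Lemma form_functional f x : f x = \sum_k c k x * f (e k) :> F.
Proof.
rewrite {1}(form_span form x) linear_sum; apply: eq_bigr => k _.
exact: (linearZ_LR f).
Qed.

Lemma lattice_basis k : lattice (e k).
Proof. by move=> l; exact: form_basis form l k. Qed.

Lemma dual_latticeP f x : dual_lattice f -> lattice x -> algint (f x : F).
Proof.
move=> fO xO; rewrite form_functional; apply: algint_sum => k _.
by apply: algintM; [exact: xO | exact: fO].
Qed.

(** The coordinate functionals themselves belong to the dual lattice. *)
Lemma lattice_bidual x :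
  (forall f, dual_lattice f -> algint (f x : F)) -> lattice x.
Proof. by move=> fxO k; apply: fxO => l; exact: form_basis form k l. Qed.

Lemma lattice_sum (I : Type) (r : seq I) (P : pred I) (u : I -> A) :
  (forall i, P i -> lattice (u i)) -> lattice (\sum_(i <- r | P i) u i).
Proof.
move=> uO k; rewrite linear_sum; apply: algint_sum => i Pi; exact: uO.
Qed.

Lemma latticeZ (a : F) x : algint a -> lattice x -> lattice (a *: x).
Proof.
by move=> aO xO k; rewrite (linearZ_LR (c k)); apply: algintM => //; exact: xO.
Qed.

Lemma latticeM x y : lattice x -> lattice y -> lattice (x * y).
Proof.
move=> xO yO; rewrite (form_span form x) (form_span form y) mulr_suml.
apply: lattice_sum => k _; rewrite mulr_sumr; apply: lattice_sum => l _.
rewrite -scalerAl -scalerAr; apply: latticeZ (xO k) _; apply: latticeZ (yO l) _.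
by move=> m; exact: form_mul form m k l.
Qed.

Lemma lattice_contract f x :
  dual_lattice f -> lattice x -> lattice (contract f (comul x)).
Proof.
move=> fO xO; rewrite (form_span form x) 2!linear_sum.
apply: lattice_sum => k _; rewrite 2!linearZ; apply: latticeZ (xO k) _.
have [d dO ->] := form_comul form k; rewrite linear_sum.
apply: lattice_sum => l _; rewrite linear_sum; apply: lattice_sum => m _.
rewrite linearZ /= contract_gtensor; apply: latticeZ (dO l m) _.
exact/latticeZ/lattice_basis.
Qed.

(** The factor #|C(s)| in front of the indicator of the conjugacy class of s makes
    this the trace of y |-> x y s^-1. *)
Definition class_functional_def s x : F^o := \sum_y x (y * s * y^-1)%g.

Fact class_functional_linear s : linear (class_functional_def s).
Proof.
move=> a x y; rewrite /class_functional_def scaler_sumr -big_split.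
by apply: eq_bigr => g _; rewrite !ffunE.
Qed.

HB.instance Definition _ s := GRing.isLinear.Build F A F^o *:%R
  (class_functional_def s) (class_functional_linear s).

Definition class_functional s : {linear A -> F^o} := class_functional_def s.

(* The matrix of y |-> x y s^-1 in the basis gT. *)
Let regmx x s : 'M[F]_#|gT| :=
  \matrix_(i, j) x (enum_val i * s * (enum_val j)^-1)%g.

Let regmxM x s y h : regmx x s *m regmx y h = regmx (x * y) (s * h)%g.
Proof.
apply/matrixP=> i j; rewrite !mxE galgME; set a := enum_val i; set b := enum_val j.
pose r (k : gT) : 'I_#|gT| := enum_rank (k^-1 * a * s)%g.
rewrite (reindex r) /=; last first.
  exists (fun i => a * s * (enum_val i)^-1)%g => [k _|i' _].
    by rewrite enum_rankK !invMg !invgK !mulgA mulgK mulgV mul1g.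
  by rewrite /r !invMg invgK -!mulgA mulKg mulVg mulg1 enum_valK.
apply: eq_bigr => k _; rewrite !mxE enum_rankK -/a -/b.
by rewrite !invMg invgK !mulgA mulgK mulgV mul1g.
Qed.

Let regmx_linear s (I : finType) (a : I -> F) (u : I -> A) :
  regmx (\sum_i a i *: u i) s = \sum_i a i *: regmx (u i) s.
Proof.
apply/matrixP=> i j; rewrite mxE galg_sumE summxE; apply: eq_bigr => k _.
by rewrite galgZE !mxE.
Qed.

(** The family of the maps y |-> e_k y h^-1 contains the identity in its span and
    is multiplied integrally by y |-> e_m y s^-1. *)
Lemma class_functional_dual s : dual_lattice (class_functional s).
Proof.
move=> m; have -> : class_functional s (e m) = \tr (regmx (e m) s).
  rewrite /mxtrace (reindex_onto enum_rank enum_val) => [|i _] /=.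
    by apply: eq_big => [g|g _]; rewrite ?enum_rankK ?eqxx // !mxE enum_rankK.
  by rewrite enum_valK.
pose B (u : 'I_n * gT) := regmx (e u.1) u.2.
pose a (u v : 'I_n * gT) : F := (c v.1 (e m * e u.1) : F) * (v.2 == s * u.2)%g%:R.
pose b (u : 'I_n * gT) : F := (c u.1 1 : F) * (u.2 == 1%g)%:R.
have pairE (f : 'I_n -> F) h (u : A) : u = \sum_k f k *: e k ->
  regmx u h = \sum_(v : 'I_n * gT) (f v.1 * (v.2 == h)%:R) *: B v.
  move=> {1}->; rewrite regmx_linear.
  rewrite -(pair_bigA _ (fun k g => (f k * (g == h)%:R) *: B (k, g))) /=.
  apply: eq_bigr => k _; rewrite (bigD1 h) //= big1 => [|g /negPf ->].
    by rewrite eqxx mulr1 addr0.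
  by rewrite mulr0 scale0r.
apply: (@algint_mxtrace _ _ _ _ B a b) => [u v|u|].
- apply: algintM; [exact: form_mul form _ _ _ | exact: algint_nat].
- by rewrite regmxM; apply: (pairE (fun k => c k (e m * e u.1) : F)); exact: form_span form _.
- rewrite -(pairE (fun k => c k 1 : F) 1%g 1); last exact: form_span form 1.
  apply/matrixP=> i j; rewrite !mxE ffunE mulg1 -eq_mulgV1.
  by rewrite (inj_eq enum_val_inj).
Qed.

End IntegralForm.

(** * From an order to an integral form *)

Lemma number_ring_algint (F : numClosedFieldType) (S : comNzRingType)
    (j : {rmorphism S -> F}) r :
  number_ring j -> algint (j r).
Proof.
case=> _ [L [h hP]]; have [x xZ <-] := (iffLR (hP (j r))) (ex_intro _ r erefl).
have [P monP Px] := integral_rmorph h xZ; exists P => //.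
by rewrite -(eq_map_poly (f := h \o intr)) // => k /=; rewrite rmorph_int.
Qed.

Section OrderForm.
Variables (F : numClosedFieldType) (gT : finGroupType) (M : {group gT}).
Variable w : char_group F (subg_of M) -> char_group F (subg_of M) -> F.

Definition twisted_comul : galg F gT -> galg F (gT * gT)%type :=
  glin (fun g => twist_elt w * gtensor (gelt F g) (gelt F g) * (twist_elt w)^-1).

HB.instance Definition _ := GRing.Linear.on twisted_comul.

(** The coordinates of an element of X lie in the image of S, and those of its
    coproduct are sums of products of such. *)
Lemma hopf_order_form (S : comNzRingType) (j : {rmorphism S -> F})
    (X : twisted_galg w -> Prop) :
    number_ring j -> hopf_order j X ->
  exists n (e : 'I_n -> galg F gT) (c : 'I_n -> {linear galg F gT -> F^o}),
    integral_form twisted_comul e c.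
Proof.
move=> Sj oX.
have [n [e [c [Xe cX eE]]]] := dual_basis (order_submodule oX) (order_fg oX)
  (order_projective oX) (order_tensor oX).
have cO k x : X x -> algint (c k x : F).
  by move=> /(cX k)[r ->]; apply: number_ring_algint.
exists n, e, c; split=> // [k l|k l m|k]; first exact: cO.
  by apply/cO/(order_mul oX).
have [q [x [y [Xxy comul_e]]]] := order_comul oX (Xe k).
exists (fun l m => \sum_(r < q) c l (x r) * c m (y r)) => [l m|].
  apply: algint_sum => r _; apply: algintM; apply: cO; by case: (Xxy r).
apply: etrans comul_e _.
transitivity (\sum_r \sum_l \sum_m (c l (x r) * c m (y r)) *: gtensor (e l) (e m)).
  apply: eq_bigr => r _ /=; rewrite {1}(eE (x r)) {1}(eE (y r)) gtensor_suml.
  apply: eq_bigr => l _; rewrite gtensor_sumr; apply: eq_bigr => m _.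
  by rewrite gtensorZl gtensorZr scalerA.
rewrite exchange_big; apply: eq_bigr => l _; rewrite exchange_big.
by apply: eq_bigr => m _; rewrite scaler_suml.
Qed.

End OrderForm.

Section CocycleTheory.
Variables (D : finGroupType) (F : fieldType) (w : D -> D -> F).
Hypotheses (wC : two_cocycle w) (Dab : forall a b : D, commute a b).
Hypothesis w_nondeg : cocycle_nondegenerate w.

Let w0 a b : w a b != 0. Proof. by case: wC. Qed.
Let wM a b c : w a b * w (a * b)%g c = w b c * w a (b * c)%g.
Proof. by case: wC. Qed.

(** The cocycle identities for (a, b, c), (b, c, a) and (b, a, c) combine, as D is
    commutative. *)
Lemma skew_pairingM a b c :
  w a (b * c)%g / w (b * c)%g a = (w a b / w b a) * (w a c / w c a).
Proof.
have h1 := wM a b c; have h2 := wM b c a; have h3 := wM b a c.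
rewrite (Dab c a) in h2; rewrite (Dab b a) in h3.
apply/eqP; rewrite mulf_div eqr_div ?mulf_neq0 //; apply/eqP.
apply: (mulfI (w0 b c)); rewrite [LHS]mulrA -h1.
transitivity (w a b * (w b a * w (a * b)%g c) * w c a).
  by rewrite -!mulrA; congr (_ * _); rewrite mulrCA.
by rewrite h3 [RHS]mulrCA h2 -!mulrA; do 2!congr (_ * _); rewrite mulrC.
Qed.

(** For a != 1 the pairing with a is a character of D, non-trivial by
    non-degeneracy. *)
Lemma skew_pairing_sum a :
  \sum_b w a b / w b a = (a == 1%g)%:R * #|D|%:R.
Proof.
have [-> | a1] := eqVneq a 1%g.
  rewrite mul1r (eq_bigr (fun=> 1)) => [|b _]; first by rewrite sumr_const.
  have := wM 1 1 b; rewrite !mul1g => /(mulIf (w0 _ _)) h1.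
  have := wM b 1 1; rewrite !mulg1 mulrC => /(mulIf (w0 _ _)) h2.
  by rewrite -h1 h2 divff.
rewrite mul0r; have /existsP[b wab] : [exists b, w a b / w b a != 1].
  apply: contraR a1 => /existsPn wa1; apply/eqP/w_nondeg => b.
  by have:= wa1 b; rewrite negbK => /eqP.
apply/eqP; have: (w a b / w b a - 1) * \sum_c w a c / w c a == 0.
  rewrite mulrBl mul1r subr_eq0; apply/eqP.
  rewrite [RHS](reindex_inj (mulgI b)) mulr_sumr; apply: eq_bigr => c _.
  by rewrite skew_pairingM.
by rewrite mulf_eq0 subr_eq0 (negPf wab).
Qed.

End CocycleTheory.

(** * Twisted comatrix coalgebras *)

(** E stands for the family of the e_phi t e_psi. By comulE the functionals on it
    multiply like the maps u |-> u_a u u_b^-1 of the twisted group algebra of D. *)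
Section TwistedComatrix.
Variables (F : numClosedFieldType) (gT : finGroupType).
Local Notation A := (galg F gT).
Variables (comul : {linear A -> galg F (gT * gT)%type}) (n : nat).
Variables (e : 'I_n -> A) (c : 'I_n -> {linear A -> F^o}).
Hypothesis form : integral_form comul e c.
Variables (D : finGroupType) (w : D -> D -> F).
Hypotheses (wC : two_cocycle w) (w1 : cocycle_normalized w).
Hypotheses (Dab : forall a b : D, commute a b) (w_nondeg : cocycle_nondegenerate w).
Variable E : D -> D -> A.
Hypothesis comulE : forall a b, comul (E a b) =
  \sum_a' \sum_b' (w a' (a'^-1 * a)%g / w b' (b'^-1 * b)%g) *:
     gtensor (E a' b') (E (a'^-1 * a)%g (b'^-1 * b)%g).
Variable eps : {linear A -> F^o}.
Hypothesis epsE : forall a b, eps (E a b) = (a == 1%g)%:R * (b == 1%g)%:R :> F.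
Implicit Types (f g : {linear A -> F^o}) (a b x y : D).

Let w0 a b : w a b != 0. Proof. by case: wC. Qed.
Let wM a b x : w a b * w (a * b)%g x = w b x * w a (b * x)%g.
Proof. by case: wC. Qed.

(* The matrix of u |-> u_a u u_b^-1 on the twisted group algebra of D. *)
Let P a b : 'M[F]_#|D| := \matrix_(i < #|D|, j < #|D|)
  let x := enum_val j : D in
  w a (x * b^-1)%g / w (x * b^-1)%g b * (enum_val i == (a * x * b^-1)%g)%:R.

Let PM_coef a b a' b' s :
  w a (a' * s)%g / w (a' * s)%g b * (w a' (s * b)%g / w (s * b)%g b') =
  w a a' / w b b' * (w (a * a')%g s / w s (b * b')%g).
Proof.
apply/eqP; rewrite !mulf_div eqr_div ?mulf_neq0 // wM -(wM s).
rewrite [w a' s * _]mulrC -[w a _ * w a' s * _]mulrA [w a' s * (_ * _)]mulrA.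
by rewrite (wM a' s b) -!mulrA; apply/eqP; congr (_ * _); rewrite mulrCA.
Qed.

Let PM a b a' b' :
  P a b *m P a' b' = (w a a' / w b b') *: P (a * a')%g (b * b')%g.
Proof.
apply/matrixP=> i j; rewrite !mxE /=; set y := enum_val i; set x := enum_val j.
rewrite (bigD1 (enum_rank (a' * x * b'^-1)%g)) //= big1 => [|k]; last first.
  rewrite -(inj_eq enum_val_inj) enum_rankK !mxE /= -/x => /negPf->.
  by rewrite !mulr0.
rewrite addr0 !mxE /= enum_rankK eqxx mulr1 -/y -/x.
pose s := (x * (b * b')^-1)%g; rewrite -/s.
have -> : (a' * x * b'^-1 * b^-1 = a' * s)%g by rewrite /s invMg !mulgA.
have -> : (x * b'^-1 = s * b)%g by rewrite /s invMg mulgA mulgKV.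
rewrite mulrAC PM_coef [RHS]mulrA; congr (_ * (_ == _)%:R).
by rewrite invMg !mulgA.
Qed.

Let P11 : P 1%g 1%g = 1%:M.
Proof.
apply/matrixP=> i j; rewrite !mxE /= invg1 !mulg1 mul1g (w1 _).1 (w1 _).2 divr1.
by rewrite mul1r (inj_eq enum_val_inj).
Qed.

(* For a = b the trace is a sum of values of the skew pairing; this is where
   non-degeneracy enters. *)
Let trP a b : \tr (P a b) = (a == 1%g)%:R * (b == 1%g)%:R * #|D|%:R.
Proof.
transitivity (\sum_x w a x / w x b * (a == b)%:R).
  rewrite [RHS](reindex_inj (mulIg b^-1%g)) /mxtrace.
  rewrite [RHS](reindex_onto enum_val enum_rank) => [|x _]; last by rewrite enum_rankK.
  apply: eq_big => [i|i _]; first by rewrite enum_valK eqxx.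
  rewrite !mxE /=; congr (_ * (_ : bool)%:R); set x := enum_val i.
  by rewrite -mulgA Dab -mulgA -{1}[x]mulg1 (inj_eq (mulgI x)) Dab eq_sym -eq_mulgV1.
rewrite -mulr_suml; have [-> | ab] := eqVneq a b.
  rewrite mulr1 skew_pairing_sum //.
  by case: (b == 1%g); rewrite ?mul1r ?mul0r.
rewrite mulr0; have [a1|] := eqVneq a 1%g; last by rewrite !mul0r.
by rewrite -a1 eq_sym (negPf ab) mulr0 mul0r.
Qed.

(* By NM below, a representation of the algebra of functionals, with the product
   dual to comul. *)
Let N f : 'M[F]_#|D| := \sum_a \sum_b (f (E a b) : F) *: P a b.

Let functional_contract f g a b : g (contract f (comul (E a b))) =
  \sum_(q : D * D) (w q.1 (q.1^-1 * a)%g / w q.2 (q.2^-1 * b)%g) *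
     (f (E q.1 q.2) * g (E (q.1^-1 * a)%g (q.2^-1 * b)%g)) :> F.
Proof.
rewrite comulE pair_bigA (linear_sum (contract f)) (linear_sum g); apply: eq_bigr => q _ /=.
rewrite (linearZ_LR (contract f)) /= contract_gtensor (linearZ_LR g) (linearZ_LR g).
by [].
Qed.

Let NM f g : N f *m N g =
  \sum_a \sum_b (g (contract f (comul (E a b))) : F) *: P a b.
Proof.
rewrite /N pair_bigA [X in _ *m X]pair_bigA [RHS]pair_bigA mulmx_suml.
transitivity (\sum_(q : D * D) \sum_(p : D * D)
  (w q.1 (q.1^-1 * p.1)%g / w q.2 (q.2^-1 * p.2)%g *
    (f (E q.1 q.2) * g (E (q.1^-1 * p.1)%g (q.2^-1 * p.2)%g))) *: P p.1 p.2).
  apply: eq_bigr => q _; rewrite mulmx_sumr.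
  pose r (p : D * D) := (q.1 * p.1, q.2 * p.2)%g.
  rewrite [RHS](reindex r); last first.
    exists (fun p : D * D => (q.1^-1 * p.1, q.2^-1 * p.2)%g) => -[x y] _;
      by rewrite /r /= ?mulKg ?mulKVg.
  apply: eq_bigr => p _; rewrite /r /= !mulKg -scalemxAl -scalemxAr PM !scalerA.
  by congr (_ *: _); rewrite mulrC.
rewrite exchange_big; apply: eq_bigr => p _.
by rewrite functional_contract scaler_suml.
Qed.

(** By biduality it suffices to see that each f in the dual lattice has an integral
    value. This value is the trace of f in the representation N, and f multiplies
    the coordinate functionals, whose span contains the counit, integrally. *)
Lemma scaled_counit_lattice : lattice c (#|D|%:R *: E 1%g 1%g).
Proof.
apply: (lattice_bidual form) => f fO; rewrite (linearZ_LR f).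
have -> : #|D|%:R *: f (E 1%g 1%g) = \tr (N f) :> F.
  rewrite raddf_sum (bigD1 1%g) //= raddf_sum (bigD1 1%g) //= !big1 ?addr0.
  - by rewrite mxtraceZ trP !eqxx !mul1r mulrC.
  - move=> a a1; rewrite raddf_sum big1 // => b _.
    by rewrite /= mxtraceZ trP (negPf a1) !mul0r mulr0.
  - by move=> b b1; rewrite /= mxtraceZ trP (negPf b1) mulr0 mul0r mulr0.
apply: (@algint_mxtrace _ _ _ _ (fun k => N (c k))
  (fun k l => c k (contract f (comul (e l)))) (fun l => eps (e l))) => [k l|k|].
- exact/(lattice_contract form fO)/(lattice_basis form).
- rewrite NM; under [RHS]eq_bigr do rewrite scaler_sumr.
  rewrite [RHS]exchange_big; apply: eq_bigr => a _.
  under [RHS]eq_bigr do rewrite scaler_sumr.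
  rewrite [RHS]exchange_big; apply: eq_bigr => b _.
  rewrite {1}(form_span form (E a b)) (linear_sum comul).
  rewrite (linear_sum (contract f)) (linear_sum (c k)) scaler_suml.
  apply: eq_bigr => l _; rewrite (linearZ_LR comul) (linearZ_LR (contract f)).
  rewrite (linearZ_LR (c k)) scalerA.
  by congr (_ *: _); rewrite mulrC.
- transitivity (\sum_a \sum_b (eps (E a b) : F) *: P a b).
    rewrite (bigD1 1%g) //= (bigD1 1%g) //= !big1 ?addr0.
    + by rewrite epsE !eqxx mul1r scale1r P11.
    + by move=> a /negPf a1; rewrite big1 // => b _; rewrite epsE a1 mul0r scale0r.
    + by move=> b /negPf b1; rewrite epsE b1 mulr0 scale0r.
  under [RHS]eq_bigr do rewrite scaler_sumr.
  rewrite [RHS]exchange_big; apply: eq_bigr => a _.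
  under [RHS]eq_bigr do rewrite scaler_sumr.
  rewrite [RHS]exchange_big; apply: eq_bigr => b _.
  rewrite (form_functional form eps) scaler_suml.
  by apply: eq_bigr => l _; rewrite scalerA mulrC.
Qed.

(** Contract with f the coproduct of the element of the previous lemma: its first
    tensor factors are the E a b, of which f keeps the diagonal ones. *)
Lemma lattice_of_diagonal f :
    dual_lattice e f -> (forall a b, a != b -> f (E a b) = 0) ->
  lattice c (#|D|%:R *: \sum_a (f (E a a) : F) *: E a^-1%g a^-1%g).
Proof.
move=> fO fE; have := lattice_contract form fO scaled_counit_lattice.
rewrite (linearZ_LR comul) (linearZ_LR (contract f)) comulE /=.
congr (lattice c (_ *: _)); rewrite (linear_sum (contract f)).
apply: eq_bigr => a _; rewrite (linear_sum (contract f)) (bigD1 a) //= big1.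
  rewrite addr0 (linearZ_LR (contract f)) /= contract_gtensor.
  by rewrite divff ?scale1r ?mulg1 //; case: wC => w0' _; exact: w0'.
move=> b /negPf ba; rewrite (linearZ_LR (contract f)) /= contract_gtensor.
by rewrite fE ?scale0r ?scaler0 // eq_sym ba.
Qed.

End TwistedComatrix.

(** * Characters of an abelian group *)

Section CharacterOrthogonality.
Variables (F : numClosedFieldType) (aT : finGroupType).
Local Notation chr := (char_group F aT).
Implicit Types (phi psi : chr) (v : aT).

Lemma char_mulE phi psi v : (phi * psi)%g v = phi v * psi v.
Proof. by rewrite [LHS]ffunE. Qed.

Lemma char_oneE v : (1%g : chr) v = 1.
Proof. by rewrite [LHS]ffunE. Qed.

Lemma char_invE phi v : (phi^-1)%g v = (phi v)^-1.
Proof. by rewrite [LHS]ffunE. Qed.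

Lemma char_id1 phi : phi 1%g = 1.
Proof. by apply: (mulfI (char_neq0 phi 1%g)); rewrite -Defs.charM mulg1 mulr1. Qed.

Lemma char_invg phi v : phi v^-1%g = (phi v)^-1.
Proof.
by apply: (mulfI (char_neq0 phi v)); rewrite -Defs.charM mulgV char_id1 divff ?char_neq0.
Qed.

Lemma char_ext phi psi : (forall v, phi v = psi v) -> phi = psi.
Proof. by move=> eq_f; apply/val_inj/ffunP. Qed.

Lemma char_commute phi psi : commute phi psi.
Proof. by apply: char_ext => v; rewrite !char_mulE mulrC. Qed.

Lemma char_sum phi : \sum_v phi v = (phi == 1%g)%:R * #|aT|%:R.
Proof.
have [-> | phi1] := eqVneq phi 1%g.
  rewrite mul1r (eq_bigr (fun=> 1)) => [|v _]; last exact: char_oneE.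
  by rewrite sumr_const.
have /existsP[v phiv] : [exists v, phi v != 1].
  apply: contraR phi1 => /existsPn phi1; apply/eqP/char_ext => v.
  by rewrite char_oneE; apply/eqP; have:= phi1 v; rewrite negbK.
apply/eqP; rewrite mul0r; have: (phi v - 1) * \sum_u phi u == 0.
  rewrite mulrBl mul1r subr_eq0 [X in _ == X](reindex_inj (mulgI v)) mulr_sumr.
  by apply/eqP/eq_bigr => u _; rewrite Defs.charM.
by rewrite mulf_eq0 subr_eq0 (negPf phiv).
Qed.

Hypothesis chr_sep : forall v, v != 1%g -> exists phi, phi v != 1.

Let char_sum_dual0 v : \sum_(phi : chr) phi v = (v == 1%g)%:R * #|{: chr}|%:R.
Proof.
have [-> | v1] := eqVneq v 1%g.
  rewrite mul1r (eq_bigr (fun=> 1)) => [|phi _]; last exact: char_id1.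
  by rewrite sumr_const.
have [phi phiv] := chr_sep v1; apply/eqP; rewrite mul0r.
have: (phi v - 1) * \sum_(psi : chr) psi v == 0.
  rewrite mulrBl mul1r subr_eq0 [X in _ == X](reindex_inj (mulgI phi)) mulr_sumr.
  by apply/eqP/eq_bigr => psi _; rewrite char_mulE.
by rewrite mulf_eq0 subr_eq0 (negPf phiv).
Qed.

(** Both orthogonality relations, counted in one double sum. *)
Lemma card_char : #|{: chr}| = #|aT|.
Proof.
apply/eqP; rewrite -(Num.Theory.eqr_nat F); apply/eqP.
have <-: \sum_v \sum_(phi : chr) phi v = #|{: chr}|%:R.
  rewrite (bigD1 1%g) //= [X in _ + X]big1 => [|v /negPf v1].
    by rewrite char_sum_dual0 eqxx mul1r addr0.
  by rewrite char_sum_dual0 v1 mul0r.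
rewrite exchange_big (eq_bigr _ (fun phi _ => char_sum phi)).
rewrite (bigD1 1%g) //= eqxx mul1r big1 ?addr0 // => phi /negPf->.
by rewrite mul0r.
Qed.

Lemma char_sum_dual v : \sum_(phi : chr) phi v = (v == 1%g)%:R * #|aT|%:R.
Proof. by rewrite char_sum_dual0 card_char. Qed.

End CharacterOrthogonality.

(** The coordinates of the isomorphism with K^|M| are characters, and they separate
    the elements of M. *)
Lemma splits_separate (F : numClosedFieldType) (K : fieldType)
    (iota : {rmorphism K -> F}) (gT : finGroupType) (M : {group gT}) :
    splits_galg K M ->
  forall v : subg_of M, v != 1%g -> exists phi : char_group F (subg_of M), phi v != 1.
Proof.
case=> f [/bij_inj f_inj [f1 fM]] v v1.
have fXM k u t : f (gelt K (u * t)%g) k = f (gelt K u) k * f (gelt K t) k.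
  by rewrite -geltM fM ffunE.
have f1E k : f (gelt K 1%g) k = 1 by have /ffunP/(_ k) := f1; rewrite ffunE.
have isch k : is_char [ffun u : subg_of M => iota (f (gelt K u) k)].
  apply: is_charP => [u|u t]; rewrite !ffunE ?fXM ?rmorphM //.
  rewrite fmorph_eq0; apply: contra_eq_neq (f1E k) => fu0.
  by rewrite -(mulgV u) fXM fu0 mul0r eq_sym oner_eq0.
have /existsP[k fvk] : [exists k, f (gelt K v) k != 1].
  apply: contraR v1 => /existsPn fv1; apply/eqP.
  have: f (gelt K v) = f (gelt K 1%g).
    by apply/ffunP=> k; rewrite f1E; apply/eqP; have:= fv1 k; rewrite negbK.
  move/f_inj/ffunP/(_ v); rewrite !ffunE eqxx.
  by case: eqP => // _ /eqP; rewrite oner_eq0.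
exists (CharGroup (isch k)); rewrite /= ffunE -(rmorph1 iota).
by rewrite (inj_eq (fmorph_inj iota)).
Qed.

(** * The idempotents e_phi and the twisted coproduct *)

Section TwistedGroupAlgebra.
Variables (F : numClosedFieldType) (gT : finGroupType) (M : {group gT}).
Local Notation A := (galg F gT).
Local Notation Mhat := (char_group F (subg_of M)).
Hypothesis chr_sep : forall v : subg_of M, v != 1%g -> exists phi : Mhat, phi v != 1.
Implicit Types (phi psi : Mhat) (v : subg_of M) (x y : A) (g h s t : gT).

Local Notation idem := (@char_idem F gT M).
Local Notation elt v := (gelt F (sgval v)).

Let card_M0 : #|M|%:R != 0 :> F.
Proof. by rewrite Num.Theory.pnatr_eq0 -lt0n cardG_gt0. Qed.

Let card_subgM : #|{: subg_of M}| = #|M|.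
Proof. by rewrite -cardsT -(card_injm (injm_sgval M)) // im_sgval. Qed.

Let card_Mhat : #|{: Mhat}| = #|M|.
Proof. by rewrite (card_char chr_sep). Qed.

Lemma elt_idem v phi : elt v * idem phi = phi v *: idem phi.
Proof.
rewrite /char_idem -scalerAr scalerA mulrC -scalerA; congr (_ *: _).
rewrite mulr_sumr scaler_sumr (reindex_inj (mulgI v^-1%g)).
apply: eq_bigr => u _; rewrite -scalerAr geltM scalerA.
by rewrite invMg invgK Defs.charM mulrC -[(_ * sgval _)%g]/(sgval (v * (v^-1 * u))%g) mulKVg.
Qed.

Lemma idemM phi psi : idem phi * idem psi = (phi == psi)%:R *: idem psi.
Proof.
rewrite {1}/char_idem -scalerAl mulr_suml.
transitivity ((#|M|%:R^-1 * \sum_v (psi * phi^-1)%g v) *: idem psi).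
  rewrite -scalerA scaler_suml; congr (_ *: _); apply: eq_bigr => v _.
  by rewrite -scalerAl elt_idem scalerA char_mulE char_invE char_invg mulrC.
rewrite char_sum card_subgM -eq_mulgV1 eq_sym; congr (_ *: _).
by case: eqP; rewrite ?mul0r ?mulr0 // mul1r mulVf.
Qed.

Lemma elt_sum_idem v : elt v = \sum_(phi : Mhat) phi v *: idem phi.
Proof.
transitivity (\sum_u (#|M|%:R^-1 * \sum_(phi : Mhat) phi (v * u^-1)%g) *: elt u).
  rewrite (bigD1 v) //= [X in _ + X]big1 ?addr0 => [|u uv].
    by rewrite mulgV char_sum_dual // eqxx mul1r card_subgM mulVf ?scale1r.
  by rewrite char_sum_dual // -eq_mulgV1 eq_sym (negPf uv) mul0r mulr0 scale0r.
rewrite /char_idem; under [RHS]eq_bigr do rewrite scalerA scaler_sumr.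
rewrite [RHS]exchange_big; apply: eq_bigr => u _.
rewrite mulr_sumr scaler_suml; apply: eq_bigr => phi _; rewrite scalerA.
by rewrite Defs.charM mulrCA mulrA.
Qed.

Lemma sum_idem : \sum_phi idem phi = 1.
Proof.
rewrite -[RHS]/(gelt F 1%g) -(morph1 (sgval_morphism M)) elt_sum_idem.
by apply: eq_bigr => phi _; rewrite char_id1 scale1r.
Qed.

Lemma idemE phi : idem phi = #|M|%:R^-1 *: \sum_v phi v^-1%g *: elt v.
Proof. by []. Qed.

Definition diag_comul : A -> galg F (gT * gT)%type :=
  glin (fun g => gtensor (gelt F g) (gelt F g)).

HB.instance Definition _ := GRing.Linear.on diag_comul.

Lemma diag_comul_gelt g : diag_comul (gelt F g) = gtensor (gelt F g) (gelt F g).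
Proof. exact: glin_gelt. Qed.

Lemma diag_comulM x y : diag_comul (x * y) = diag_comul x * diag_comul y.
Proof.
rewrite [in LHS](galg_gelt x) [in LHS](galg_gelt y) mulr_suml linear_sum.
rewrite [in RHS]/diag_comul [glin _ x]/glin mulr_suml; apply: eq_bigr => g _.
rewrite mulr_sumr linear_sum mulr_sumr; apply: eq_bigr => h _.
rewrite -!scalerAl -!scalerAr !linearZ /= geltM diag_comul_gelt gtensorM.
by rewrite !geltM !scalerA mulrC.
Qed.

Lemma diag_comul_idem phi :
  diag_comul (idem phi) = \sum_psi gtensor (idem psi) (idem (psi^-1 * phi)%g).
Proof.
transitivity (\sum_(psi : Mhat) \sum_(chi : Mhat)
    (#|M|%:R^-1 * \sum_v (psi * chi * phi^-1)%g v) *: gtensor (idem psi) (idem chi)).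
  rewrite {1}/char_idem linearZ linear_sum /=.
  transitivity (\sum_v \sum_(psi : Mhat) \sum_(chi : Mhat)
      (#|M|%:R^-1 * (psi * chi * phi^-1)%g v) *: gtensor (idem psi) (idem chi)).
    rewrite scaler_sumr; apply: eq_bigr => v _; rewrite linearZ /= diag_comul_gelt.
    rewrite elt_sum_idem gtensor_suml !scaler_sumr; apply: eq_bigr => psi _.
    rewrite gtensor_sumr !scaler_sumr; apply: eq_bigr => chi _.
    rewrite gtensorZl gtensorZr !scalerA !ffunE char_invg.
    by rewrite -!mulrA; congr (_ * _ *: _); rewrite mulrC mulrA.
  rewrite exchange_big; apply: eq_bigr => psi _; rewrite exchange_big.
  by apply: eq_bigr => chi _; rewrite mulr_sumr scaler_suml.
apply: eq_bigr => psi _; under eq_bigr do rewrite char_sum card_subgM.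
rewrite (bigD1 (psi^-1 * phi)%g) //= big1 => [|chi ne].
  by rewrite addr0 mulKVg mulgV eqxx mul1r mulVf ?scale1r.
rewrite -eq_mulgV1 -(inj_eq (mulgI psi^-1%g)) mulKg (negPf ne).
by rewrite mul0r mulr0 scale0r.
Qed.

Variable w : Mhat -> Mhat -> F.
Hypotheses (wC : two_cocycle w) (w1 : cocycle_normalized w).
Hypothesis w_nondeg : cocycle_nondegenerate w.

Let gtensor_idemM phi psi phi' psi' :
  gtensor (idem phi') (idem psi') * gtensor (idem phi) (idem psi) =
  ((phi' == phi) && (psi' == psi))%:R *: gtensor (idem phi) (idem psi).
Proof.
rewrite gtensorM !idemM gtensorZl gtensorZr scalerA.
by case: eqP; case: eqP; rewrite ?mulr1 ?mulr0.
Qed.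

Let sum_gtensor_idem (a : Mhat -> Mhat -> F) phi psi :
  \sum_phi' \sum_psi' (a phi' psi' * ((phi' == phi) && (psi' == psi))%:R) *:
    gtensor (idem phi) (idem psi) = a phi psi *: gtensor (idem phi) (idem psi).
Proof.
rewrite (bigD1 phi) //= (bigD1 psi) //= !big1 ?addr0.
- by rewrite !eqxx mulr1.
- move=> phi' /negPf ne; rewrite big1 // => psi' _.
  by rewrite ne mulr0 scale0r.
- by move=> psi' /negPf ne; rewrite ne andbF mulr0 scale0r.
Qed.

Let twist_mull (a : Mhat -> Mhat -> F) phi psi :
  (\sum_phi' \sum_psi' a phi' psi' *: gtensor (idem phi') (idem psi')) *
    gtensor (idem phi) (idem psi) = a phi psi *: gtensor (idem phi) (idem psi).
Proof.
rewrite -sum_gtensor_idem mulr_suml; apply: eq_bigr => phi' _; rewrite mulr_suml.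
by apply: eq_bigr => psi' _; rewrite -scalerAl gtensor_idemM scalerA.
Qed.

Let twist_mulr (a : Mhat -> Mhat -> F) phi psi :
  gtensor (idem phi) (idem psi) *
  (\sum_phi' \sum_psi' a phi' psi' *: gtensor (idem phi') (idem psi')) =
    a phi psi *: gtensor (idem phi) (idem psi).
Proof.
rewrite -sum_gtensor_idem mulr_sumr; apply: eq_bigr => phi' _; rewrite mulr_sumr.
apply: eq_bigr => psi' _; rewrite -scalerAr gtensor_idemM scalerA.
case: (eqVneq phi' phi) => [->|_]; last by rewrite mulr0 !scale0r.
by case: (eqVneq psi' psi) => [->|_]; last by rewrite mulr0 !scale0r.
Qed.

Let gtensor_idem1 : \sum_phi \sum_psi gtensor (idem phi) (idem psi) = 1.
Proof.
under eq_bigr do rewrite -gtensor_sumr.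
rewrite -gtensor_suml sum_idem; apply/ffunP=> -[g h].
by rewrite gtensorE !ffunE -natrM mulnb -[(g, h) == _]/((g == _) && (h == _)).
Qed.

Lemma twist_unit : twist_elt w \is a GRing.unit.
Proof.
have w0 phi psi : w phi psi != 0 by case: wC.
apply/unitrP; exists (\sum_phi \sum_psi
  (w phi psi)^-1 *: gtensor (idem phi) (idem psi)); split.
  rewrite -[RHS]gtensor_idem1 mulr_sumr; apply: eq_bigr => phi _.
  rewrite mulr_sumr; apply: eq_bigr => psi _.
  by rewrite -scalerAr twist_mull scalerA mulfV ?scale1r.
rewrite -[RHS]gtensor_idem1 mulr_sumr; apply: eq_bigr => phi _.
rewrite mulr_sumr; apply: eq_bigr => psi _.
by rewrite -scalerAr twist_mull scalerA mulVf ?scale1r.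
Qed.

Lemma twist_idem phi psi :
  twist_elt w * gtensor (idem phi) (idem psi) =
    w phi psi *: gtensor (idem phi) (idem psi).
Proof. exact: twist_mull. Qed.

Lemma idem_twistV phi psi :
  gtensor (idem phi) (idem psi) * (twist_elt w)^-1 =
    (w phi psi)^-1 *: gtensor (idem phi) (idem psi).
Proof.
have w0 : w phi psi != 0 by case: wC.
apply: (mulIr twist_unit); rewrite mulrVK ?twist_unit // -scalerAl twist_mulr.
by rewrite scalerA mulVf ?scale1r.
Qed.

Definition bi_idem t phi psi : A := idem phi * gelt F t * idem psi.

(** The twist multiplies e_psi (x) e_chi by w psi chi, and the coproduct of e_phi
    in F[gT] is the sum of the e_psi (x) e_(psi^-1 phi). *)
Lemma twisted_comul_bi_idem t phi psi :
  twisted_comul w (bi_idem t phi psi) = \sum_phi' \sum_psi'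
    (w phi' (phi'^-1 * phi)%g / w psi' (psi'^-1 * psi)%g) *:
    gtensor (bi_idem t phi' psi') (bi_idem t (phi'^-1 * phi)%g (psi'^-1 * psi)%g).
Proof.
have comulE x : twisted_comul w x = twist_elt w * diag_comul x * (twist_elt w)^-1.
  rewrite /twisted_comul /diag_comul /glin mulr_sumr mulr_suml.
  by apply: eq_bigr => g _; rewrite -scalerAr -scalerAl.
rewrite comulE !diag_comulM !diag_comul_idem diag_comul_gelt.
move: (twist_elt w) twist_idem idem_twistV => W WI IV.
rewrite !mulr_suml mulr_sumr mulr_suml; apply: eq_bigr => phi' _.
rewrite !mulr_sumr mulr_suml; apply: eq_bigr => psi' _.
rewrite -!mulrA IV !mulrA WI -!scalerAl -!scalerAr scalerA.
by rewrite !gtensorM.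
Qed.

End TwistedGroupAlgebra.

(** * The class functionals on group elements *)

Section ClassFunctional.
Variables (F : numClosedFieldType) (gT : finGroupType).
Local Notation A := (galg F gT).
Implicit Types (x y : A) (g h s : gT).

Lemma class_functionalC s x y :
  class_functional F s (x * y) = class_functional F s (y * x) :> F.
Proof.
rewrite /= /class_functional_def.
transitivity (\sum_u \sum_h x h * y (h^-1 * (u * s * u^-1))%g).
  by apply: eq_bigr => u _; rewrite galgME.
transitivity (\sum_u \sum_h y h * x (h^-1 * (u * s * u^-1))%g); last first.
  by apply: eq_bigr => u _; rewrite galgME.
rewrite exchange_big [RHS]exchange_big /=.
transitivity (\sum_h \sum_u x h * y (u * s * u^-1 * h^-1)%g).
  apply: eq_bigr => h _; rewrite (reindex_inj (mulgI h)).
  by apply: eq_bigr => u _; rewrite invMg !mulgA mulVg mul1g.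
rewrite exchange_big [RHS]exchange_big; apply: eq_bigr => u _ /=.
pose c := (u * s * u^-1)%g; rewrite -/c.
rewrite (reindex (fun k => k^-1 * c)%g) /=; last first.
  exists (fun h => c * h^-1)%g => k _; first by rewrite invMg invgK mulKVg.
  by rewrite invMg invgK mulgKV.
by apply: eq_bigr => k _; rewrite invMg invgK mulKVg mulrC.
Qed.

Lemma class_functional_gelt s g :
  class_functional F s (gelt F g) = (g \in s ^: [set: gT])%g%:R * #|'C[s]%g|%:R :> F.
Proof.
rewrite /= /class_functional_def.
transitivity (\sum_(u | (s ^ u^-1)%g == g) (1 : F)).
  rewrite [RHS]big_mkcond; apply: eq_bigr => u _; rewrite ffunE /conjg invgK mulgA.
  by case: eqP.
rewrite sumr_const.
have [/imsetP[u _ ->] | sg] := boolP (g \in _); last first.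
  rewrite mul0r (eq_card0 (A := _)) // => u; apply/negP => /eqP su.
  by case/negP: sg; rewrite -su memJ_class ?inE.
rewrite mul1r -(card_lcoset _ u^-1%g); congr _%:R; apply: eq_card => k.
rewrite mem_lcoset invgK; apply/eqP/cent1P => [su | cus].
  have suk : s = (s ^ (u * k))%g by rewrite conjgM -su conjgKV.
  by rewrite /commute [RHS]conjgC -suk.
have suk : (s ^ (u * k))%g = s.
  by apply: (mulgI (u * k)%g); rewrite -(conjgC s); exact: esym cus.
by rewrite -[in LHS]suk -conjgM mulgK.
Qed.

End ClassFunctional.

(** * The divisibility forced by an integral form *)

Section Criterion.
Variables (F : numClosedFieldType) (gT : finGroupType) (M : {group gT}).
Local Notation A := (galg F gT).
Local Notation Mhat := (char_group F (subg_of M)).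
Hypothesis chr_sep : forall v : subg_of M, v != 1%g -> exists phi : Mhat, phi v != 1.
Variable w : Mhat -> Mhat -> F.
Hypotheses (wC : two_cocycle w) (w1 : cocycle_normalized w).
Hypothesis w_nondeg : cocycle_nondegenerate w.
Implicit Types (phi psi : Mhat) (v : subg_of M) (x y : A) (g h s t : gT).

Let card_M0 : #|M|%:R != 0 :> F.
Proof. by rewrite Num.Theory.pnatr_eq0 -lt0n cardG_gt0. Qed.

Let card_subgM : #|{: subg_of M}| = #|M|.
Proof. by rewrite -cardsT -(card_injm (injm_sgval M)) // im_sgval. Qed.

Let card_Mhat : #|{: Mhat}| = #|M|.
Proof. by rewrite (card_char chr_sep). Qed.

(** This condition leaves a single term, that of v = 1, when the class functional
    of t is evaluated on e_phi t e_phi. *)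
Definition class_free t :=
  forall g, g \in M -> (t * g)%g \in (t ^: [set: gT])%g -> g = 1%g.

Definition conj_average t : A :=
  #|M|%:R^-1 *: \sum_(v : subg_of M) gelt F (sgval v * t * (sgval v)^-1)%g.

(** Expand the left idempotents over M, then collect the right ones. *)
Lemma sum_bi_idem t : \sum_(phi : Mhat) bi_idem t phi phi = conj_average t.
Proof.
have biE phi : bi_idem t phi phi =
    #|M|%:R^-1 *: \sum_v phi v^-1%g *: (gelt F (sgval v * t)%g * char_idem phi).
  rewrite /bi_idem [X in X * _ * _]idemE -!scalerAl !mulr_suml; congr (_ *: _).
  by apply: eq_bigr => v _; rewrite -!scalerAl geltM.
rewrite (eq_bigr _ (fun phi _ => biE phi)) -scaler_sumr; congr (_ *: _).
rewrite exchange_big; apply: eq_bigr => v _ /=.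
rewrite -[RHS]geltM -[gelt F (_^-1)%g]/(gelt F (sgval v^-1%g)) elt_sum_idem //.
by rewrite mulr_sumr; apply: eq_bigr => phi _; rewrite scalerAr.
Qed.

Let eps : {linear A -> F^o} := glin (fun _ => 1 : F^o).

Let epsM x y : eps (x * y) = eps x * eps y :> F.
Proof.
have epsE z : eps z = \sum_g z g :> F.
  by apply: eq_bigr => g _; exact: mulr1.
rewrite !epsE; under eq_bigr do rewrite galgME.
rewrite exchange_big mulr_suml; apply: eq_bigr => h _ /=.
rewrite -mulr_sumr (reindex_inj (mulgI h)); congr (_ * _).
by apply: eq_bigr => g _; rewrite mulKg.
Qed.

Let eps_idem phi : eps (char_idem phi) = (phi == 1%g)%:R :> F.
Proof.
rewrite idemE (linearZ_LR eps) (linear_sum eps).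
have -> : \sum_v eps (phi v^-1%g *: gelt F (sgval v)) = \sum_v (phi^-1)%g v :> F.
  apply: eq_bigr => v _; rewrite (linearZ_LR eps) /= glin_gelt char_invg char_invE.
  exact: mulr1.
rewrite char_sum card_subgM (inv_eq invgK) invg1.
by apply: (mulfI card_M0); rewrite mulVKf // mulrC.
Qed.

Let eps_bi_idem t phi psi :
  eps (bi_idem t phi psi) = (phi == 1%g)%:R * (psi == 1%g)%:R :> F.
Proof.
rewrite /bi_idem !epsM !eps_idem [eps (gelt F t)]glin_gelt.
by congr (_ * _); exact: mulr1.
Qed.

Let class_bi_idem t phi psi : phi != psi ->
  class_functional F t (bi_idem t phi psi) = 0 :> F.
Proof.
move=> ne; rewrite /bi_idem class_functionalC mulrA idemM // eq_sym (negPf ne).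
by rewrite scale0r mul0r linear0.
Qed.

Let class_bi_idem_diag t phi : class_free t ->
  class_functional F t (bi_idem t phi phi) = #|'C[t]%g|%:R / #|M|%:R :> F.
Proof.
move=> t_free; rewrite /bi_idem -mulrA class_functionalC -mulrA idemM // eqxx scale1r.
rewrite idemE -scalerAr (linearZ_LR (class_functional F t)) mulrC; congr (_ * _).
rewrite mulr_sumr (linear_sum (class_functional F t)) (bigD1 1%g) //= big1 => [|v v1].
  rewrite addr0 -scalerAr (linearZ_LR (class_functional F t)) /= geltM.
  rewrite [class_functional_def t _]class_functional_gelt.
  by rewrite invg1 char_id1 mulg1 class_refl mul1r; exact: mul1r.
rewrite -scalerAr (linearZ_LR (class_functional F t)) /= geltM.
rewrite [class_functional_def t _]class_functional_gelt.
case: (boolP (_ \in _)) => [/(t_free _ (subgP v)) vv1|_].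
  by case/eqP: v1; exact: subg_inj.
by rewrite mul0r; exact: mulr0.
Qed.

Variables (n : nat) (e : 'I_n -> A) (c : 'I_n -> {linear A -> F^o}).
Hypothesis form : integral_form (twisted_comul w) e c.

(** The class functional of t vanishes on e_phi t e_psi for phi != psi, and on the
    diagonal its value #|C(t)| / |M| does not depend on phi. *)
Lemma conj_average_lattice t :
  class_free t -> lattice c (#|'C[t]%g|%:R *: conj_average t).
Proof.
move=> t_free.
have /= := lattice_of_diagonal form wC w1 (@char_commute _ _) w_nondeg
  (twisted_comul_bi_idem chr_sep wC t) (eps_bi_idem t)
  (class_functional_dual form t) (@class_bi_idem t).
congr (lattice c _); rewrite card_Mhat -sum_bi_idem // !scaler_sumr.
rewrite [RHS](reindex_inj invg_inj); apply: eq_bigr => phi _.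
rewrite scalerA; congr (_ *: _); rewrite class_bi_idem_diag //.
by rewrite mulrC mulfVK.
Qed.

(** In the product of the two averages only the relative position of the two
    conjugating elements of M matters. *)
Lemma class_functional_average s t u :
  class_functional F s (conj_average t * conj_average u) =
    #|'C[s]%g|%:R * #|[set g in M | (t * (g * u * g^-1) \in s ^: [set: gT])%g]|%:R
      / #|M|%:R :> F.
Proof.
set cl := (s ^: _)%g; set N := #|[set _ in _ | _]|.
rewrite /conj_average -scalerAl -scalerAr !(linearZ_LR (class_functional F s)).
pose K : F := N%:R * #|'C[s]%g|%:R.
transitivity (#|M|%:R^-1 * (#|M|%:R^-1 * (#|M|%:R * K)) : F); last first.
  by rewrite mulKf // mulrC [#|'C[s]%g|%:R * _]mulrC.
congr (_ * (_ * _)); rewrite mulr_suml (linear_sum (class_functional F s)).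
transitivity (\sum_(v : subg_of M) K); last first.
  by rewrite sumr_const card_subgM mulr_natl.
apply: eq_bigr => v _; rewrite mulr_sumr (linear_sum (class_functional F s)).
rewrite /K; have -> : N = (\sum_(a : subg_of M)
    ((t * (sgval a * u * (sgval a)^-1))%g \in cl))%N.
    rewrite /N -sum1_card [RHS](eq_bigr (fun a : subg_of M =>
      if (t * (sgval a * u * (sgval a)^-1) \in cl)%g then 1 else 0)%N).
      rewrite -big_mkcond (reindex_onto sgval (subg M)) /= => [|g].
        by apply: eq_bigl => a; rewrite inE subgP sgvalK eqxx andbT.
      by rewrite inE => /andP[gM _]; rewrite subgK.
    by move=> a _; case: ifP.
  rewrite natr_sum mulr_suml (reindex_inj (mulgI v)); apply: eq_bigr => a _.
  rewrite geltM class_functional_gelt; congr (_%:R * _); congr nat_of_bool.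
  rewrite -[RHS](@class_transl _ _ (sgval v * (t * (sgval a * u * (sgval a)^-1)) * (sgval v)^-1)%g).
    by rewrite /= invMg !mulgA mulgKV.
  apply/imsetP; exists (sgval v)^-1%g; first by rewrite inE.
  by rewrite /conjg invgK !mulgA.
Qed.

(** The class functional of s has an integral value on the product of the two
    lattice elements, and the centralisers contribute factors prime to |M|. *)
Lemma form_count_dvd s t u :
    class_free t -> class_free u ->
    coprime #|M| #|'C[s]%g| -> coprime #|M| #|'C[t]%g| -> coprime #|M| #|'C[u]%g| ->
  (#|M| %| #|[set g in M | (t * (g * u * g^-1) \in s ^: [set: gT])%g]|)%N.
Proof.
move=> t_free u_free cs ct cu; set N := #|[set _ in _ | _]|.
have zO := latticeM form (conj_average_lattice t_free) (conj_average_lattice u_free).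
have := dual_latticeP form (class_functional_dual form s) zO.
rewrite -scalerAl -scalerAr !(linearZ_LR (class_functional F s)).
rewrite class_functional_average -/N.
have -> : #|'C[t]%g|%:R *: (#|'C[u]%g|%:R *: (#|'C[s]%g|%:R * N%:R / #|M|%:R : F^o))
   = (#|'C[t]%g| * (#|'C[u]%g| * (#|'C[s]%g| * N)))%:R / #|M|%:R :> F.
  by rewrite !natrM -!mulrA.
move/(algint_natdiv (cardG_gt0 M)).
by rewrite !Gauss_dvdr.
Qed.

End Criterion.

(** * Obstructions *)

Section Obstruction.
Variables (gT : finGroupType) (M : {group gT}).
Local Open Scope group_scope.

(** The group-theoretic reason for the non-existence of an order: for the scaled
    averages of t and u the class functional of t u takes the value k N / |M|,
    with k prime to |M| and N the cardinal that is counted. *)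
Definition obstruction := exists t u : gT,
  [/\ class_free M t, class_free M u,
      [/\ coprime #|M| #|'C[t]|, coprime #|M| #|'C[u]| & coprime #|M| #|'C[t * u]|]
    & (#|[set a in M | (t * (a * u * a^-1) \in (t * u) ^: [set: gT])%g]| < #|M|)%N].

(** The counted set contains 1, so its cardinal lies strictly between 0 and |M|;
    but an order makes |M| divide it. *)
Lemma obstruction_no_hopf_order (F : numClosedFieldType)
    (w : char_group F (subg_of M) -> char_group F (subg_of M) -> F) :
    (forall v : subg_of M, v != 1 -> exists phi : char_group F (subg_of M), phi v != 1%R) ->
    two_cocycle w -> cocycle_normalized w -> cocycle_nondegenerate w ->
    obstruction ->
  forall (S : comNzRingType) (j : {rmorphism S -> F}), number_ring j ->
  ~ exists X, hopf_order j (H := twisted_galg w) X.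
Proof.
move=> sepM wC w1 wN [t [u [t_free u_free [ct cu ctu]]]] + S j Sj [X oX].
have [n [e [c form]]] := hopf_order_form Sj oX; rewrite ltnNge => /negP; case.
have dvd := form_count_dvd sepM wC w1 wN form t_free u_free ctu ct cu.
apply: dvdn_leq dvd.
by apply/card_gt0P; exists 1; rewrite inE group1 mul1g invg1 mulg1 class_refl.
Qed.

Lemma coprime_centraliser p (x : gT) : prime p -> p.-group M ->
    (forall y, commute y x -> y ^+ p = 1 -> y = 1) ->
  coprime #|M| #|'C[x]|.
Proof.
move=> p_pr pM Cx; have pC : p^'.-group 'C[x].
  rewrite /pgroup p'natE //; apply/negP => /(Cauchy p_pr)[y yC oy].
  have y1 : y = 1 by apply: Cx; [exact/cent1P | rewrite -oy expg_order].
  by have := p_pr; rewrite -oy y1 order1.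
exact: pnat_coprime pM pC.
Qed.

End Obstruction.

(** * Obstructions from covers by matrix groups *)

(** The quasisimple groups are reached through a surjection f from a matrix group
    L, so that all conditions can be checked on matrices, up to the kernel of f. *)
Section Cover.
Variables (rT gT : finGroupType) (L : {group rT}) (f : rT -> gT) (M : {group gT}).
Local Open Scope group_scope.

Definition covers :=
  {in L &, {morph f : x y / x * y}} /\ (forall y, exists2 x, x \in L & f x = y).

(** No element of order p of the covered group commutes with f h. *)
Definition cover_regular p h :=
  forall x, x \in L -> f [~ x, h] = 1 -> f (x ^+ p) = 1 -> f x = 1.

(** The condition [class_free] for f h and the image of P, read in L. *)
Definition cover_free (P : {set rT}) h :=
  forall v x, v \in P -> x \in L -> f (h * v) = f (h ^ x) -> f v = 1.

Hypothesis coverf : covers.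
Let fM : {in L &, {morph f : x y / x * y}}. Proof. by case: coverf. Qed.
Let f_onto y : exists2 x, x \in L & f x = y. Proof. by case: coverf. Qed.

Lemma covers1 : f 1 = 1.
Proof. by apply: (mulgI (f 1)); rewrite -fM ?group1 // !mulg1. Qed.

Lemma coversV : {in L, {morph f : x / x^-1}}.
Proof.
by move=> x xL; apply: (mulgI (f x)); rewrite -fM ?groupV // !mulgV covers1.
Qed.

Lemma coversX m : {in L, {morph f : x / x ^+ m}}.
Proof.
move=> x xL; elim: m => [|m IHm]; first exact: covers1.
by rewrite !expgS fM ?groupX // IHm.
Qed.

Lemma coversJ : {in L &, {morph f : x y / x ^ y}}.
Proof. by move=> x y xL yL; rewrite /conjg !fM ?coversV ?groupM ?groupV. Qed.

Lemma covers_eq x y : x \in L -> y \in L -> f x = f y -> f (x * y^-1) = 1.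
Proof.
by move=> xL yL exy; rewrite fM ?groupV // exy -fM ?groupV // mulgV covers1.
Qed.

Lemma covers_inj : {in L, forall x, f x = 1 -> x = 1} -> {in L &, injective f}.
Proof.
move=> f_ker x y xL yL /(covers_eq xL yL)/f_ker e.
by apply/eqP; rewrite eq_mulgV1 e ?groupM ?groupV.
Qed.

Lemma covers_regular_inj p h : {in L, forall x, f x = 1 -> x = 1} -> h \in L ->
    (forall x, x \in L -> commute x h -> x ^+ p = 1 -> x = 1) ->
  cover_regular p h.
Proof.
move=> f_ker hL reg x xL fxh fxp; suffices -> : x = 1 by exact: covers1.
apply: reg => //; first by apply/commgP/eqP/f_ker; rewrite // groupR.
by apply: f_ker; rewrite ?groupX.
Qed.

(** A Sylow p-subgroup of the preimage of M maps onto M. *)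
Lemma pgroup_lift (p : nat) : p.-group M ->
  exists P : {group rT}, [/\ P \subset L, p.-group P & f @: P = M].
Proof.
move=> pM; pose fm := Morphism fM.
have [P sylP] := Sylow_exists p (fm @*^-1 M)%G.
have sPG := pHall_sub sylP; have sPL : P \subset L := subset_trans sPG (subsetIl _ _).
exists P; split=> //; first exact: pHall_pgroup sylP.
have sMf : M \subset fm @* L.
  apply/subsetP=> y _; have [x xL <-] := f_onto y; exact: (mem_morphim fm).
have := morphim_pHall fm sPL sylP; rewrite morphpreK // => sylfP.
by rewrite -(morphimEsub fm sPL); exact: pHall_id sylfP pM.
Qed.

(** B is a bound for the set of the a counted in an obstruction. *)
Lemma obstruction_of_cover (P : {set rT}) (B : {set gT}) (p : nat) (t u : rT) :
    prime p -> p.-group M -> P \subset L -> f @: P = M -> t \in L -> u \in L ->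
    cover_regular p t -> cover_regular p u -> cover_regular p (t * u) ->
    cover_free P t -> cover_free P u ->
    (forall a x, a \in P -> x \in L ->
       f (t * (a * u * a^-1)) = f ((t * u) ^ x) -> f a \in B) ->
    (#|B| < #|M|)%N ->
  obstruction M.
Proof.
move=> p_pr pM sPL fPM tL uL rt ru rtu free_t free_u fB ltBM.
have free h : cover_free P h -> h \in L -> class_free M (f h).
  move=> free_h hL v; rewrite -fPM => /imsetP[v' v'P ->] /imsetP[y _].
  have [x xL <-] := f_onto y; have v'L := subsetP sPL _ v'P.
  by rewrite -fM // -coversJ //; apply: free_h.
have cop h : cover_regular p h -> h \in L -> coprime #|M| #|'C[f h]|.
  move=> reg_h hL; apply: (coprime_centraliser p_pr pM) => y.
  have [x xL <-] := f_onto y => cxh; rewrite -coversX // => fxp.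
  apply: reg_h => //; rewrite fM ?groupV ?groupJ // coversV // coversJ //.
  apply/eqP; rewrite -eq_mulVg1; apply/eqP.
  by apply: (mulgI (f h)); rewrite -conjgC cxh.
exists (f t), (f u); split; rewrite -?fM //; try exact: free.
  by split; apply: cop; rewrite ?groupM.
apply: leq_ltn_trans ltBM; apply/subset_leq_card/subsetP=> a; rewrite inE -fPM.
case/andP=> /imsetP[a' a'P ->] /imsetP[y _].
have [x xL <-] := f_onto y; have a'L := subsetP sPL _ a'P.
by rewrite -coversJ ?groupM // -coversV // -!fM ?groupM ?groupV //; apply: fB.
Qed.

End Cover.

(** Composed with conjugation by an element that normalises L, f0 remains a cover
    with the same kernel up to conjugacy. This moves a lift of M into U. *)
Lemma conjugate_cover (p : nat) (rT gT : finGroupType) (L U : {group rT})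
    (f0 : rT -> gT) (M : {group gT}) :
    covers L f0 -> (p.-group M)%g ->
    (forall Q : {group rT}, Q \subset L -> (p.-group Q)%g ->
       exists2 g, g \in ('N(L))%g & Q \subset (U :^ g)%g) ->
  exists f (P : {set rT}),
  [/\ covers L f,
      forall x, x \in L -> f x = 1%g -> exists2 g, (x ^ g)%g \in L & f0 (x ^ g)%g = 1%g,
      P \subset L, P \subset U & f @: P = M].
Proof.
move=> cover0 pM conjU; have [P0 [sP0L pP0 fP0M]] := pgroup_lift cover0 pM.
have [g gN sPU] := conjU P0 sP0L pP0; have [f0M f0_onto] := cover0.
have gJL x : ((x ^ g)%g \in L) = (x \in L) by rewrite memJ_norm.
exists (fun x => f0 (x ^ g)%g), (P0 :^ g^-1)%g; split.
- split=> [x y xL yL|y]; first by rewrite conjMg f0M ?gJL.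
  have [x xL <-] := f0_onto y; exists (x ^ g^-1)%g; last by rewrite conjgKV.
  by rewrite -gJL conjgKV.
- by move=> x xL fx1; exists g; rewrite ?gJL.
- by apply/subsetP=> _ /imsetP[x xP ->]; rewrite -gJL conjgKV (subsetP sP0L).
- by rewrite sub_conjgV.
apply/setP=> y; rewrite -fP0M; apply/imsetP/imsetP=> [[_ /imsetP[x xP ->] ->] | [x xP ->]].
  by exists x; rewrite ?conjgKV.
by exists (x ^ g^-1)%g; rewrite ?memJ_conjg // conjgKV.
Qed.

Lemma isog_covers (gT rT : finGroupType) (L : {group rT}) :
    ([set: gT] \isog L)%g ->
  exists2 f : rT -> gT, covers L f & {in L, forall x, f x = 1%g -> x = 1%g}.
Proof.
rewrite isog_sym => /isogP[f injf fL]; exists f; last first.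
  move=> x xL fx1; apply/set1P; apply: (subsetP injf).
  by rewrite !inE xL; apply/eqP.
split; first exact: morphM.
move=> y; have : y \in (f @* L)%g by rewrite fL inE.
by case/morphimP=> x xL _ ->; exists x.
Qed.

(** * Linear groups in dimension two *)

Section GeneralLinear.
Variables (F : finFieldType) (n : nat).
Local Notation GLn := {'GL_n.+1[F]}.
Implicit Types (x y : GLn) (A : 'M[F]_n.+1).

(** A matrix that is not invertible is sent to 1. *)
Definition GLmx A : GLn := insubd (1%g : GLn) A.

Lemma GLmxE A : A \in unitmx -> GLval (GLmx A) = A.
Proof. by move=> uA; rewrite /GLmx [LHS]insubdK. Qed.

Lemma GLval_inj : injective (@GLval n.+1 F).
Proof. exact: val_inj. Qed.

Lemma GLval_conj x y : GLval (x ^ y)%g = invmx (GLval y) *m GLval x *m GLval y.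
Proof. by rewrite /conjg !GL_MxE GL_VxE mulmxA. Qed.

Lemma mxtrace_conjGL x y : \tr (GLval (x ^ y)%g) = \tr (GLval x).
Proof.
by rewrite GLval_conj mxtrace_mulC mulmxA mulmxV ?mul1mx //; exact: GL_unitmx.
Qed.

Lemma GLval_X x k : GLval (x ^+ k)%g = GLval x ^+ k.
Proof. by elim: k => // k IHk; rewrite expgS exprS GL_ME IHk. Qed.

Lemma GLval_commute x y :
  commute x y -> GLval x *m GLval y = GLval y *m GLval x.
Proof. by move=> xy; rewrite -!GL_MxE [(x * y)%g]xy. Qed.

Lemma Sylow_GL p m (U : {group GLn}) : prime p -> #|F| = (p ^ m)%N -> (0 < m)%N ->
  #|U| = (#|F| ^ 'C(n.+1, 2))%N -> (p.-Sylow('GL_n.+1[F]) U)%g.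
Proof.
move=> p_pr Fq m_gt0 cardU; have q_gt0 : (0 < #|F|)%N by rewrite Fq expn_gt0 prime_gt0.
have p_q : (p %| #|F|)%N by rewrite Fq dvdn_exp.
have cardU' : (p^'.-nat #|'GL_n.+1[F] : U|)%g.
  rewrite -divgS ?subsetT // cardU card_GL // mulKn ?expn_gt0 ?q_gt0 // big_add1.
  apply: (big_ind (p^'.-nat)%N) => // [a b|i _]; first by rewrite pnatM => -> ->.
  rewrite p'natE //; apply/negP => /(dvdn_sub (dvdn_exp (ltn0Sn i) p_q)).
  by rewrite subKn ?expn_gt0 ?q_gt0 // dvdn1 => /eqP p1; rewrite p1 in p_pr.
rewrite /pHall subsetT /pgroup cardU' andbT cardU Fq.
by rewrite !pnatX pnat_id // !orbT.
Qed.

End GeneralLinear.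

Section TwoByTwo.
Variable F : finFieldType.

Definition mx2 (a b c d : F) : 'M[F]_2 :=
  \matrix_(i, j) if i == 0 then if j == 0 then a else b
                 else if j == 0 then c else d.

Lemma mx2_eta (A : 'M[F]_2) : A = mx2 (A 0 0) (A 0 1) (A 1 0) (A 1 1).
Proof.
by apply/matrixP=> -[[|[|//]] ?] [[|[|//]] ?]; rewrite !mxE /=; congr (A _ _);
  apply: val_inj.
Qed.

Lemma mulmx2 a b c d a' b' c' d' : mx2 a b c d *m mx2 a' b' c' d' =
  mx2 (a * a' + b * c') (a * b' + b * d') (c * a' + d * c') (c * b' + d * d').
Proof.
by apply/matrixP=> -[[|[|//]] ?] [[|[|//]] ?]; rewrite !mxE !big_ord_recl big_ord0 !mxE /= addr0.
Qed.

Lemma det_mx2 a b c d : \det (mx2 a b c d) = a * d - b * c.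
Proof.
rewrite (expand_det_row _ 0) !big_ord_recl big_ord0 addr0 /cofactor !det_mx11 !mxE /=.
by rewrite expr0 expr1 mul1r mulN1r mulrN.
Qed.

Lemma tr_mx2 a b c d : \tr (mx2 a b c d) = a + d.
Proof. by rewrite /mxtrace !big_ord_recl big_ord0 !mxE /= addr0. Qed.

Lemma mx2_1 : 1%:M = mx2 1 0 0 1.
Proof. by apply/matrixP=> -[[|[|//]] ?] [[|[|//]] ?]; rewrite !mxE. Qed.

Lemma mx2_inj a b c d a' b' c' d' : mx2 a b c d = mx2 a' b' c' d' ->
  [/\ a = a', b = b', c = c' & d = d'].
Proof.
move=> /matrixP e; have := (e 0 0, e 0 1, e 1 0, e 1 1).
by rewrite !mxE /= => -[[[-> ->] ->] ->].
Qed.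

Lemma pchar_unipotent p n (X : 'M[F]_n.+1) :
  p \in [pchar F] -> X ^+ p = 1 -> (X - 1) ^+ p = 0.
Proof.
move=> pF Xp; have pM : p \in [pchar 'M[F]_n.+1] by rewrite pchar_lalg.
rewrite -(pFrobenius_autE pM) pFrobenius_autB_comm; last exact: commr1.
by rewrite !pFrobenius_autE Xp expr1n subrr.
Qed.

Lemma det_expmx n (A : 'M[F]_n.+1) k : \det (A ^+ k) = \det A ^+ k.
Proof.
elim: k => [|k IHk]; first by rewrite !expr0 det1.
by rewrite !exprS -IHk -det_mulmx.
Qed.

(** In characteristic p the matrix N = X - 1 is nilpotent. As it commutes with A,
    which has distinct eigenvalues, it vanishes. *)
Lemma mx2_commute_unipotent p (A X : 'M[F]_2) :
    p \in [pchar F] -> (\tr A) ^+ 2 - 4 * \det A != 0 ->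
    A *m X = X *m A -> X ^+ p = 1 ->
  X = 1.
Proof.
move=> pF discA AX Xp; have p_pr := pcharf_prime pF.
have := pchar_unipotent pF Xp; set N := X - 1 => Np.
have AN : A *m N = N *m A by rewrite mulmxBr mulmxBl AX mulmx1 mul1mx.
suffices N0 : N = 0 by apply/eqP; rewrite -subr_eq0 -/N N0.
move: discA AN Np; rewrite (mx2_eta A) (mx2_eta N).
move: (A 0 0) (A 0 1) (A 1 0) (A 1 1) (N 0 0) (N 0 1) (N 1 0) (N 1 1).
move=> {N AX Xp} a b c d x y z t; rewrite tr_mx2 det_mx2 => disc.
rewrite !mulmx2 => /mx2_inj[e1 e2 e3 e4] Np; set N := mx2 x y z t in Np *.
have detN : x * t - y * z = 0.
  have /eqP: \det (N ^+ p) = 0 by rewrite Np det0.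
  by rewrite det_expmx expf_eq0 det_mx2 => /andP[_ /eqP].
have NS : N *m N = (x + t) *: N.
  transitivity ((x + t) *: N - (x * t - y * z) *: 1%:M); last first.
    by rewrite detN scale0r subr0.
  rewrite mulmx2 mx2_1; apply/matrixP=> -[[|[|//]] ?] [[|[|//]] ?];
    rewrite !mxE /=; ring.
have NX k : N ^+ k.+1 = (x + t) ^+ k *: N.
  elim: k => [|k IHk]; first by rewrite expr0 scale1r.
  by rewrite exprSr IHk -scalerAl -[N * N]/(N *m N) NS scalerA -exprSr.
move: Np; rewrite -(prednK (prime_gt0 p_pr)) NX => /eqP.
rewrite scaler_eq0 expf_eq0 => /orP[/andP[_ /eqP xt]|/eqP //].
have tE : t = - x by apply/eqP; rewrite -addr_eq0 addrC xt.
rewrite tE in detN e1 e2 e3 e4 *.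
have y0 : y = 0.
  apply/eqP; rewrite -sqrf_eq0 -(mulIr_eq0 _ (mulIf disc)); apply/eqP.
  (* The discriminant of A times y ^ 2 lies in the ideal generated by the
     commutation relations and by the determinant of N. *)
  transitivity (((a * y + b * - x) - (x * b + y * d)) * (y * (a - d) + 2 * b * x)
    + 4 * b * y * ((x * a + y * c) - (a * x + b * z))
    - 4 * b ^+ 2 * (x * - x - y * z)); first by ring.
  by rewrite e1 e2 detN !subrr !mulr0 mul0r addr0 subr0.
have z0 : z = 0.
  apply/eqP; rewrite -sqrf_eq0 -(mulIr_eq0 _ (mulIf disc)); apply/eqP.
  transitivity (((z * a + - x * c) - (c * x + d * z)) * (z * (a - d) + 2 * c * x)
    + 4 * c * z * ((a * x + b * z) - (x * a + y * c))
    - 4 * c ^+ 2 * (x * - x - y * z)); first by ring.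
  by rewrite e1 e3 detN !subrr !mulr0 mul0r addr0 subr0.
have x0 : x = 0.
  apply/eqP; rewrite -sqrf_eq0; apply/eqP.
  transitivity (- (x * - x - y * z)); first by rewrite y0; ring.
  by rewrite detN oppr0.
rewrite /N tE y0 z0 x0 oppr0.
by apply/matrixP=> -[[|[|//]] ?] [[|[|//]] ?]; rewrite !mxE.
Qed.

End TwoByTwo.

(** * The groups SL_2(q) and PSL_2(q) *)

Section SpecialLinear.
Variables (n : nat) (F : finFieldType).
Implicit Types (x g : {'GL_n.+1[F]}).

Lemma in_SL x : (x \in SL n.+1 F) = (\det (GLval x) == 1).
Proof. by rewrite inE. Qed.

Lemma SL_conj x g : ((x ^ g)%g \in SL n.+1 F) = (x \in SL n.+1 F).
Proof.
rewrite !in_SL GLval_conj !det_mulmx mulrAC -det_mulmx mulVmx ?det1 ?mul1r //.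
exact: GL_unitmx.
Qed.

Lemma SL_norm g : g \in ('N(SL n.+1 F))%g.
Proof. by rewrite inE; apply/subsetP=> _ /imsetP[x xL ->]; rewrite SL_conj. Qed.

End SpecialLinear.

Section SL2.
Variable F : finFieldType.
Implicit Types a b c t : F.

Lemma mx2_unit a b c d : a * d - b * c = 1 -> mx2 a b c d \in unitmx.
Proof. by move=> det1; rewrite unitmxE det_mx2 det1 unitr1. Qed.

Definition uni2 b : {'GL_2[F]} := GLmx (mx2 1 b 0 1).

Lemma uni2E b : GLval (uni2 b) = mx2 1 b 0 1.
Proof. by rewrite GLmxE // mx2_unit // mulr1 mulr0 subr0. Qed.

Lemma uni2M b c : (uni2 b * uni2 c)%g = uni2 (b + c).
Proof.
apply: GLval_inj; rewrite GL_MxE !uni2E mulmx2.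
by congr mx2; ring.
Qed.

Lemma uni2_0 : uni2 0 = 1%g.
Proof. by apply: GLval_inj; rewrite uni2E -mx2_1. Qed.

Lemma uni2V b : (uni2 b)^-1%g = uni2 (- b).
Proof. by apply: (mulgI (uni2 b)); rewrite mulgV uni2M subrr uni2_0. Qed.

Fact uni2_group_set : group_set (uni2 @: F).
Proof.
apply/group_setP; split; first by rewrite -uni2_0 imset_f.
by move=> _ _ /imsetP[b _ ->] /imsetP[c _ ->]; rewrite uni2M imset_f.
Qed.

Definition uni2_group := Group uni2_group_set.

Lemma card_uni2 : #|uni2_group| = #|F|.
Proof.
rewrite card_imset // => b c /(congr1 (@GLval 2 F)); rewrite !uni2E.
by case/mx2_inj.
Qed.

Lemma card_sqrt_le2 (a k : F) : a != 0 -> (#|[set b : F | (a * b ^+ 2 == k)%R]| <= 2)%N.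
Proof.
move=> a0; have [-> | [b]] := set_0Vmem [set b : F | a * b ^+ 2 == k].
  by rewrite cards0.
rewrite inE => /eqP bk; apply: leq_trans (_ : #|[set b; - b]%R| <= 2)%N; last first.
  by rewrite cards2; case: (_ != _).
apply/subset_leq_card/subsetP=> c; rewrite !inE => /eqP ck.
by rewrite -eqf_sqr; apply/eqP/(mulfI a0); rewrite ck bk.
Qed.

(** For T and U as below and a = uni2 b, the traces of T a, U a and T (a U a^-1) are
    t + b, t + c b and k - c b^2 + b t (1 - c), where k is the trace of T U. Up to
    the sign that comes from the kernel, they depend on the conjugacy class only.
    The conditions on t and c remove the terms that are linear in b from the
    squares of the first two and from the third, and they make T, U and T U
    regular semisimple. So a is counted only for b = 0 or c b^2 = 2 k. *)
Lemma obstruction_SL2 p m (gT : finGroupType) (M : {group gT})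
    (f0 : {'GL_2[F]} -> gT) (t c : F) :
    prime p -> (0 < m)%N -> #|F| = (p ^ m)%N -> covers (SL 2 F) f0 ->
    (forall x, x \in SL 2 F -> f0 x = 1%g -> GLval x = 1 \/ GLval x = -1) ->
    (p.-group M)%g -> (p ^ 2 <= #|M|)%N ->
    c != 0 -> t + t = 0 -> t * (1 - c) = 0 -> t ^+ 2 - 4 != 0 ->
    (t ^+ 2 - c - c^-1) ^+ 2 - 4 != 0 ->
  obstruction M.
Proof.
move=> p_pr m_gt0 Fq cover0 f0_ker pM leM c0 t2 tc discT discTU.
have sylU : (p.-Sylow('GL_2[F]) uni2_group)%g.
  by apply: Sylow_GL p_pr Fq m_gt0 _; rewrite card_uni2 expn1.
have [|f [P [coverf f_ker0 sPL sPU fPM]]] := conjugate_cover cover0 pM (U := uni2_group).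
  move=> Q _ pQ; have [g _ sQU] := Sylow_subJ sylU (subsetT Q) pQ.
  by exists g; rewrite ?SL_norm.
have f_ker x : x \in SL 2 F -> f x = 1%g -> GLval x = 1 \/ GLval x = -1.
  move=> xL /(f_ker0 x xL)[g xgL /(f0_ker _ xgL) xg].
  have xE : GLval x = GLval g *m GLval (x ^ g)%g *m invmx (GLval g).
    by rewrite -GL_VxE -!GL_MxE -conjgC mulgK.
  have gu := GL_unitmx g.
  by case: xg => e; [left | right]; rewrite xE e ?mulmxN ?mulmx1 ?mulNmx mulmxV.
have PE v : v \in P -> exists b, v = uni2 b.
  by move/(subsetP sPU)/imsetP=> [b _ ->]; exists b.
(* Up to sign the conjugacy class in the image determines the trace. *)
have trE x y : x \in SL 2 F -> y \in SL 2 F -> f x = f y ->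
    (\tr (GLval x)) ^+ 2 = (\tr (GLval y)) ^+ 2.
  move=> xL yL exy; have := f_ker _ (groupM xL (groupVr yL)) (covers_eq coverf xL yL exy).
  have xE : GLval x = GLval (x * y^-1)%g *m GLval y by rewrite -GL_MxE mulgKV.
  by case=> e; rewrite xE e ?mulNmx mul1mx ?raddfN ?sqrrN.
pose T := GLmx (mx2 0 (-1) 1 t); pose U := GLmx (mx2 0 (- c^-1) c t).
have TE : GLval T = mx2 0 (-1) 1 t by rewrite GLmxE // mx2_unit //; ring.
have UE : GLval U = mx2 0 (- c^-1) c t.
  by rewrite GLmxE // mx2_unit // mul0r mulNr mulVf // sub0r opprK.
have TL : T \in SL 2 F by rewrite in_SL TE det_mx2 mul0r sub0r mulN1r opprK.
have UL : U \in SL 2 F by rewrite in_SL UE det_mx2 mul0r sub0r mulNr opprK mulVf.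
have bL b : uni2 b \in SL 2 F by rewrite in_SL uni2E det_mx2 mulr1 mulr0 subr0.
have pF : p \in [pchar F] by apply: card_finPcharP Fq p_pr.
pose k := t ^+ 2 - c - c^-1.
have TUE : GLval (T * U)%g = mx2 (- c) (- t) (t * c) (t ^+ 2 - c^-1).
  by rewrite GL_MxE TE UE mulmx2; congr mx2; ring.
have reg h : h \in SL 2 F -> (\tr (GLval h)) ^+ 2 - 4 != 0 -> cover_regular (SL 2 F) f p h.
  move=> hL disch x xL fxh fxp.
  have regh : (\tr (GLval h)) ^+ 2 - 4 * \det (GLval h) != 0.
    by move: hL; rewrite in_SL => /eqP->; rewrite mulr1.
  have xh : GLval x *m GLval h = GLval h *m GLval x \/
            GLval x *m GLval h = - (GLval h *m GLval x).
    have e := f_ker _ (groupR xL hL) fxh.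
    have -> : GLval x *m GLval h = GLval h *m GLval x *m GLval [~ x, h]%g.
      by rewrite -!GL_MxE -commgC.
    by case: e => ->; [left | right]; rewrite ?mulmxN mulmx1.
  (* x commutes with h up to sign, hence its square commutes with h. *)
  have x2h : GLval h *m GLval (x ^+ 2)%g = GLval (x ^+ 2)%g *m GLval h.
    rewrite expgS expg1 GL_MxE mulmxA -[RHS]mulmxA.
    by case: xh => e; rewrite e ?mulmxN ?mulNmx mulmxA e ?mulNmx ?opprK.
  have x2p : GLval (x ^+ 2)%g ^+ p = 1.
    have e := f_ker _ (groupX p xL) fxp.
    have -> : GLval (x ^+ 2)%g ^+ p = GLval (x ^+ p)%g * GLval (x ^+ p)%g.
      by rewrite -GLval_X expgAC expgS expg1 GL_ME.
    by case: e => ->; rewrite ?mulrNN mulr1.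
  have x2 : (x ^+ 2)%g = 1%g.
    by apply: GLval_inj; exact: mx2_commute_unipotent pF regh x2h x2p.
  have [p2 | p_odd] := even_prime p_pr; last first.
    by move: fxp; rewrite -(odd_double_half p) p_odd -mul2n expgS expgM x2 expg1n mulg1.
  have N1 : (-1 : 'M[F]_2) = 1.
    apply/eqP; rewrite eq_sym -addr_eq0 -mulr2n -p2.
    by rewrite -[_ *+ p]scaler_nat (pcharf0 pF) scale0r.
  suffices -> : x = 1%g by exact: (covers1 coverf).
  apply: GLval_inj; apply: mx2_commute_unipotent pF regh _ _.
    by case: xh => ->; rewrite // -mulN1r N1 mul1r.
  by rewrite p2 -GLval_X x2.
pose B := f @: (uni2 @: (0 |: [set b : F | c * b ^+ 2 == 2 * k])).
apply: (obstruction_of_cover coverf (B := B) p_pr pM sPL fPM TL UL).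
- by apply: reg; rewrite ?TL // TE tr_mx2 add0r.
- by apply: reg; rewrite ?UL // UE tr_mx2 add0r.
- apply: reg; rewrite ?(groupM TL UL) // TUE tr_mx2.
  by have -> : - c + (t ^+ 2 - c^-1) = t ^+ 2 - c - c^-1 by ring.
- move=> _ x /PE[b ->] xL /trE; rewrite mxtrace_conjGL GL_MxE uni2E.
  rewrite (groupM TL (bL b)) SL_conj TL => /(_ isT isT); rewrite TE mulmx2 !tr_mx2 => e.
  suffices -> : b = 0 by rewrite uni2_0; exact: covers1 coverf.
  apply/eqP; rewrite -sqrf_eq0; apply/eqP.
  transitivity ((0 * 1 + -1 * 0 + (1 * b + t * 1)) ^+ 2 - (0 + t) ^+ 2
    - (t + t) * b); first by ring.
  by rewrite e t2 mul0r subrr subr0.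
- move=> _ x /PE[b ->] xL /trE; rewrite mxtrace_conjGL GL_MxE uni2E.
  rewrite (groupM UL (bL b)) SL_conj UL => /(_ isT isT); rewrite UE mulmx2 !tr_mx2 => e.
  suffices -> : b = 0 by rewrite uni2_0; exact: covers1 coverf.
  apply/eqP; rewrite -(mulrI_eq0 _ (mulfI c0)) -sqrf_eq0; apply/eqP.
  transitivity ((0 * 1 + - c^-1 * 0 + (c * b + t * 1)) ^+ 2 - (0 + t) ^+ 2
    - (t + t) * (c * b)); first by ring.
  by rewrite e t2 mul0r subrr subr0.
- move=> _ x /PE[b ->] xL /trE; rewrite SL_conj (groupM TL UL).
  rewrite (groupM TL (groupM (groupM (bL b) UL) (groupVr (bL b)))) => /(_ isT isT).
  rewrite mxtrace_conjGL TUE uni2V !GL_MxE !uni2E TE UE !mulmx2 !tr_mx2 => e.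
  have {e} : (k - c * b ^+ 2 + b * (t * (1 - c))) ^+ 2 = k ^+ 2.
    by apply: etrans (etrans e _); congr (_ ^+ 2); rewrite /k; ring.
  rewrite tc mulr0 addr0 => e.
  have: (c * b ^+ 2) * (c * b ^+ 2 - 2 * k) = 0.
    transitivity ((k - c * b ^+ 2) ^+ 2 - k ^+ 2); first by ring.
    by rewrite e subrr.
  move/eqP; rewrite mulf_eq0 subr_eq0 mulf_eq0 (negPf c0) sqrf_eq0 => bk.
  by rewrite !imset_f // !inE.
(* B has at most three elements, and p ^ 2 >= 4. *)
apply: leq_trans leM; apply: leq_ltn_trans (leq_imset_card _ _) _.
apply: leq_ltn_trans (leq_imset_card _ _) _.
apply: leq_ltn_trans (_ : 3 < p ^ 2)%N; last first.
  by apply: (@leq_trans (2 ^ 2)); rewrite ?leq_exp2r // prime_gt1.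
apply: leq_trans (leq_card_setU _ _) _; rewrite cards1 ltnS.
exact: card_sqrt_le2.
Qed.

End SL2.

Lemma central_type_card p (gT : finGroupType) (M : {group gT}) :
  prime p -> (p.-group M)%g -> (M :!=: 1)%g -> central_type M -> (p ^ 2 <= #|M|)%N.
Proof.
move=> p_pr pM M1 [eT [E isoME]]; have cardM := card_isog isoME.
rewrite cardsX mulnn in cardM; rewrite cardM leq_exp2r //.
have [_ pdvd _] := pgroup_pdiv pM M1; rewrite cardM Euclid_dvdX // in pdvd.
by case/andP: pdvd => pE _; apply: dvdn_leq pE.
Qed.

Section SL2Groups.
Variables (F : finFieldType) (p m : nat).
Hypotheses (p_pr : prime p) (m_gt1 : (1 < m)%N) (Fq : #|F| = (p ^ m)%N).

(** It suffices to commute with two elementary matrices. *)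
Lemma center_SL2 x : x \in ('Z(SL 2 F))%g -> GLval x = 1 \/ GLval x = -1.
Proof.
case/centerP=> xL xC; pose l := GLmx (mx2 (1 : F) 0 1 1).
have lE : GLval l = mx2 1 0 1 1 by rewrite GLmxE // mx2_unit // mulr1 mul0r subr0.
have uL : uni2 1 \in SL 2 F by rewrite in_SL uni2E det_mx2 mulr1 mulr0 subr0.
have lL : l \in SL 2 F by rewrite in_SL lE det_mx2 mulr1 mul0r subr0.
have := GLval_commute (xC _ lL); have := GLval_commute (xC _ uL).
move: xL; rewrite in_SL lE uni2E (mx2_eta (GLval x)); move: (GLval x) => X.
move: (X 0 0) (X 0 1) (X 1 0) (X 1 1) => {X} a b c d.
rewrite det_mx2 !mulmx2 => /eqP adbc /mx2_inj[e1 e2 _ _] /mx2_inj[f1 _ _ _].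
have c0 : c = 0.
  by transitivity ((1 * a + 1 * c) - (a * 1 + b * 0)); [ring | rewrite e1 subrr].
have b0 : b = 0.
  by transitivity ((a * 1 + b * 1) - (1 * a + 0 * c)); [ring | rewrite f1 subrr].
have da : d = a.
  transitivity (a + ((1 * b + 1 * d) - (a * 1 + b * 1))); first by ring.
  by rewrite e2 subrr addr0.
have /eqP : a ^+ 2 = 1 by rewrite -adbc c0 da mulr0 subr0.
rewrite c0 b0 da sqrf_eq1 => /orP[]/eqP->; [left | right].
  by rewrite -mx2_1.
by apply/matrixP=> -[[|[|//]] ?] [[|[|//]] ?]; rewrite !mxE /= ?mulr0n ?oppr0.
Qed.

(** In characteristic 2 take t = c = 1, otherwise t = 0 and c distinct from 0, 1
    and -1, which exists because q > 3. *)
Lemma SL2_parameters : exists t c : F,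
  [/\ c != 0, t + t = 0, t * (1 - c) = 0, t ^+ 2 - 4 != 0
    & (t ^+ 2 - c - c^-1) ^+ 2 - 4 != 0].
Proof.
have pF : p \in [pchar F] by apply: card_finPcharP Fq p_pr.
have [p2 | p_odd] := even_prime p_pr.
  have two0 : 2 = 0 :> F by rewrite -p2 (pcharf0 pF).
  have four0 : 4 = 0 :> F by rewrite -[4%N]/(2 * 2)%N natrM two0 mulr0.
  exists 1, 1; rewrite four0 invr1 !subr0 expr1n subrr sub0r sqrrN expr1n mulr0.
  by split; rewrite ?oner_eq0.
have two_neq0 : 2 != 0 :> F.
  by rewrite -(dvdn_pcharf pF) dvdn_prime2 //; case: eqP p_odd => // ->.
have four_neq0 : 4 != 0 :> F by rewrite -[4%N]/(2 * 2)%N natrM mulf_neq0.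
have [c] : exists c : F, c \notin [set 0; 1; -1].
  apply/existsP; rewrite -negb_forall; apply/negP => /forallP inS.
  have : (#|F| <= #|([set 0; 1; -1]%R : {set F})|)%N.
    by rewrite -cardsT; apply/subset_leq_card/subsetP=> c _; exact: inS.
  apply/negP; rewrite -ltnNge; apply: (@leq_ltn_trans 3).
    rewrite setUC; apply: leq_trans (leq_card_setU _ _) _.
    by rewrite cards1 add1n ltnS cards2; case: (_ != _).
  rewrite Fq; have p3 : (2 < p)%N by rewrite odd_prime_gt2.
  apply: (@leq_trans (3 ^ 2)) => //.
  by apply: (@leq_trans (p ^ 2)); rewrite ?leq_exp2r // leq_exp2l // ltnW.
rewrite !inE !negb_or => /andP[/andP[c0 c1] cN1].
exists 0, c; split; rewrite ?mul0r ?addr0 ?expr0n ?sub0r ?oppr_eq0 //.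
have -> : (- c - c^-1) ^+ 2 - 4 = ((c - 1) * (c + 1) / c) ^+ 2 by field.
by rewrite expf_neq0 // !mulf_neq0 ?invr_eq0 // ?subr_eq0 // addr_eq0.
Qed.

Lemma obstruction_SL2_PSL2 (gT : finGroupType) (M : {group gT}) :
    ([set: gT] \isog SL 2 F)%g \/ ([set: gT] \isog PSL 2 F)%g ->
    (p.-group M)%g -> (p ^ 2 <= #|M|)%N ->
  obstruction M.
Proof.
move=> isoG pM leM; have [t [c [c0 t2 tc discT discTU]]] := SL2_parameters.
have m_gt0 := ltnW m_gt1.
case: isoG => /isog_covers[f coverf f_ker].
  apply: (obstruction_SL2 p_pr m_gt0 Fq coverf _ pM leM c0 t2 tc discT discTU).
  by move=> x xL /(f_ker x xL)->; left.
set Z := ('Z(SL 2 F))%G in f coverf f_ker *; have [fM f_onto] := coverf.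
have nZ : SL 2 F \subset ('N(Z))%g := gFnorm _ _.
pose f' x := f (coset Z x).
have coverf' : covers (SL 2 F) f'.
  split=> [x y xL yL|y].
    by rewrite /f' morphM ?(subsetP nZ) // fM //; exact: mem_quotient.
  by have [_ /morphimP[x _ xL ->] <-] := f_onto y; exists x.
apply: (obstruction_SL2 p_pr m_gt0 Fq coverf' _ pM leM c0 t2 tc discT discTU).
move=> x xL /f_ker; rewrite mem_quotient // => /(_ isT) /coset_idr.
by move/(_ (subsetP nZ _ xL)); apply: center_SL2.
Qed.

End SL2Groups.

(** * Cyclic matrices and unitriangular matrices of size three *)

Section CyclicVector.
Variables (F : finFieldType) (n : nat) (A : 'M[F]_n.+1).

(** w lies in the cyclic F[A]-module generated by v. *)
Definition in_cyclic (v w : 'rV[F]_n.+1) := exists q, w = v *m horner_mx A q.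

Lemma in_cyclic_id v : in_cyclic v v.
Proof. by exists 1; rewrite rmorph1 mulmx1. Qed.

Lemma in_cyclicD v w w' : in_cyclic v w -> in_cyclic v w' -> in_cyclic v (w + w').
Proof. by move=> [q ->] [q' ->]; exists (q + q'); rewrite rmorphD mulmxDr. Qed.

Lemma in_cyclicZ v w a : in_cyclic v w -> in_cyclic v (a *: w).
Proof. by move=> [q ->]; exists (a *: q); rewrite linearZ scalemxAr. Qed.

Lemma in_cyclic_mul v w : in_cyclic v w -> in_cyclic v (w *m A).
Proof.
by move=> [q ->]; exists (q * 'X); rewrite rmorphM /= horner_mx_X mulmxA.
Qed.

(** As A has a cyclic vector, X is a polynomial q(A). For Q = #|F| ^ k, whose power
    map fixes the coefficients, X^Q = q(A^Q) = q(A) = X; but X^p = 1 gives X^Q = 1. *)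
Lemma cyclic_commute_unipotent p m k v (X : 'M[F]_n.+1) :
    prime p -> #|F| = (p ^ m)%N -> (0 < m)%N -> (0 < k)%N ->
    A ^+ (#|F| ^ k) = A -> (forall i, in_cyclic v (delta_mx 0 i)) ->
    A *m X = X *m A -> X ^+ p = 1 ->
  X = 1.
Proof.
move=> p_pr Fq m_gt0 k_gt0 AQ cyc_v AX Xp.
have pF : p \in [pchar F] by apply: card_finPcharP Fq p_pr.
have commX q : horner_mx A q *m X = X *m horner_mx A q.
  exact: (comm_horner_mx q AX).
have cyc w : in_cyclic v w.
  rewrite [w]row_sum_delta; elim/big_ind: _ => [||i _].
  - by rewrite -(scale0r v); apply/in_cyclicZ/in_cyclic_id.
  - exact: in_cyclicD.
  - exact/in_cyclicZ/cyc_v.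
have [q vX] := cyc (v *m X).
have XE : X = horner_mx A q.
  apply/row_matrixP=> i; rewrite !rowE; have [g ->] := cyc (delta_mx 0 i).
  rewrite -!mulmxA commX !mulmxA vX -!mulmxA; congr (_ *m _).
  by rewrite -[LHS]rmorphM mulrC rmorphM.
have hQ g : horner_mx A (g ^+ (#|F| ^ k)) = horner_mx A g.
  have pP : p \in [pchar {poly F}] by rewrite pchar_poly.
  have QF : ([pchar {poly F}].-nat (#|F| ^ k))%N by rewrite Fq -expnM pnatX pnatE // pP.
  elim/poly_ind: g => [|g a IHg]; first by rewrite expr0n Fq -expnM expn_eq0 eqn0Ngt prime_gt0.
  rewrite (exprDn_pchar _ _ QF) exprMn !rmorphD !rmorphM /= IHg -polyC_exp.
  rewrite rmorphXn /= !horner_mx_X AQ; congr (_ + horner_mx A _%:P).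
  elim: (k) => [|j IHj]; first by rewrite expn0 expr1.
  by rewrite expnS exprM expf_card.
rewrite XE -hQ rmorphXn /= -XE Fq -expnM.
rewrite -(prednK (_ : 0 < m * k)%N) ?muln_gt0 ?m_gt0 // expnS exprM Xp.
by rewrite expr1n.
Qed.

End CyclicVector.

Section ThreeByThree.
Variable F : finFieldType.

Definition mx3 (a b c d e f g h i : F) : 'M[F]_3 :=
  \matrix_(k, l) nth 0 (nth [::]
    [:: [:: a; b; c]; [:: d; e; f]; [:: g; h; i]] k) l.

Lemma mulmx3 a b c d e f g h i a' b' c' d' e' f' g' h' i' :
  mx3 a b c d e f g h i *m mx3 a' b' c' d' e' f' g' h' i' =
  mx3 (a * a' + b * d' + c * g') (a * b' + b * e' + c * h') (a * c' + b * f' + c * i')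
      (d * a' + e * d' + f * g') (d * b' + e * e' + f * h') (d * c' + e * f' + f * i')
      (g * a' + h * d' + i * g') (g * b' + h * e' + i * h') (g * c' + h * f' + i * i').
Proof.
by apply/matrixP=> -[[|[|[|//]]] ?] [[|[|[|//]]] ?];
  rewrite !mxE !big_ord_recl big_ord0 !mxE /= addr0 addrA.
Qed.

Lemma tr_mx3 a b c d e f g h i : \tr (mx3 a b c d e f g h i) = a + e + i.
Proof. by rewrite /mxtrace !big_ord_recl big_ord0 !mxE /= addr0 addrA. Qed.

Lemma det_mx3 a b c d e f g h i : \det (mx3 a b c d e f g h i) =
  a * (e * i - f * h) - b * (d * i - f * g) + c * (d * h - e * g).
Proof.
rewrite (expand_det_row _ 0) !big_ord_recl big_ord0 addr0 /cofactor.
rewrite !(expand_det_row _ 0) !big_ord_recl !big_ord0 /cofactor !det_mx11 !mxE /=.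
rewrite ?expr0 ?expr1 ?addr0. ring.
Qed.

Lemma mx3_1 : 1%:M = mx3 1 0 0 0 1 0 0 0 1.
Proof. by apply/matrixP=> -[[|[|[|//]]] ?] [[|[|[|//]]] ?]; rewrite !mxE. Qed.

Lemma mx3_inj a b c d e f g h i a' b' c' d' e' f' g' h' i' :
    mx3 a b c d e f g h i = mx3 a' b' c' d' e' f' g' h' i' ->
  [/\ [/\ a = a', b = b' & c = c'], [/\ d = d', e = e' & f = f']
    & [/\ g = g', h = h' & i = i']].
Proof.
move=> /matrixP eqM; have e00 := eqM 0 0; have e01 := eqM 0 1.
have e02 := eqM 0 (inord 2); have e10 := eqM 1 0; have e11 := eqM 1 1.
have e12 := eqM 1 (inord 2); have e20 := eqM (inord 2) 0.
have e21 := eqM (inord 2) 1; have e22 := eqM (inord 2) (inord 2).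
by move: e00 e01 e02 e10 e11 e12 e20 e21 e22; rewrite !mxE !inordK //= => *; split.
Qed.

Definition uni3 x y z : {'GL_3[F]} := GLmx (mx3 1 x z 0 1 y 0 0 1).

Lemma uni3E x y z : GLval (uni3 x y z) = mx3 1 x z 0 1 y 0 0 1.
Proof.
rewrite GLmxE // unitmxE det_mx3 -[X in X \is a _]/(_ - _ + _).
have -> : 1 * (1 * 1 - y * 0) - x * (0 * 1 - y * 0) + z * (0 * 0 - 1 * 0) = 1 :> F by ring.
exact: unitr1.
Qed.

Lemma uni3M x y z x' y' z' :
  (uni3 x y z * uni3 x' y' z')%g = uni3 (x + x') (y + y') (z + z' + x * y').
Proof. by apply: GLval_inj; rewrite GL_MxE !uni3E mulmx3; congr mx3; ring. Qed.

Lemma uni3_0 : uni3 0 0 0 = 1%g.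
Proof. by apply: GLval_inj; rewrite uni3E -mx3_1. Qed.

Lemma uni3V x y z : (uni3 x y z)^-1%g = uni3 (- x) (- y) (x * y - z).
Proof.
apply: (mulgI (uni3 x y z)); rewrite mulgV uni3M -uni3_0.
by congr uni3; ring.
Qed.

Lemma uni3_inj x y z x' y' z' :
  uni3 x y z = uni3 x' y' z' -> [/\ x = x', y = y' & z = z'].
Proof.
by move/(congr1 (@GLval 3 F)); rewrite !uni3E => /mx3_inj[[_ -> ->] [_ _ ->] _].
Qed.

Let uni3t (u : F * F * F) := uni3 u.1.1 u.1.2 u.2.

Fact uni3_group_set : group_set [set uni3t u | u : F * F * F].
Proof.
apply/group_setP; split; first by rewrite -uni3_0; apply/imsetP; exists (0, 0, 0).
move=> _ _ /imsetP[[[x y] z] _ ->] /imsetP[[[x' y'] z'] _ ->]; rewrite uni3M.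
by apply/imsetP; exists (x + x', y + y', z + z' + x * y').
Qed.

Definition uni3_group := Group uni3_group_set.

Lemma card_uni3 : #|uni3_group| = (#|F| ^ 3)%N.
Proof.
rewrite card_imset /= => [|[[x y] z] [[x' y'] z'] /uni3_inj[/= -> -> ->] //].
by rewrite !card_prod !expnS expn0 muln1 mulnA.
Qed.

Lemma uni3_groupP v : v \in uni3_group -> exists x y z, v = uni3 x y z.
Proof. by case/imsetP=> -[[x y] z] _ ->; exists x, y, z. Qed.

End ThreeByThree.

(** * The group SL_3(p) *)

Lemma central_type_exponent p (gT : finGroupType) (M : {group gT}) :
  central_type M -> #|M| = (p ^ 2)%N -> {in M, forall x, (x ^+ p)%g = 1%g}.
Proof.
move=> [eT [E isoME]] cardM; have := card_isog isoME.
rewrite cardM cardsX mulnn => /eqP; rewrite eqn_exp2r // => /eqP cardE.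
have [f injf fM] := isogP isoME => x xM; apply: (injmP injf); rewrite ?groupX ?group1 //.
rewrite morphX // morph1; have: f x \in setX E E by rewrite -fM mem_morphim.
case: (f x) => y z; rewrite inE => /andP[yE zE].
have pairX k : ((y, z) ^+ k)%g = (y ^+ k, z ^+ k)%g.
  by elim: k => // k IHk; rewrite !expgS IHk.
by rewrite pairX cardE !expg_cardG.
Qed.

Section SL3.
Variables (F : finFieldType) (p : nat).
Hypotheses (p_pr : prime p) (Fp : #|F| = p).
Variables (r s : F).
Hypotheses (r2 : r ^+ 2 = 1).

(* The characteristic polynomial of tau is X^3 - r s X - 1. For s = 0 the order
   of tau is 3; in characteristic 3 with r s = 1 it is 13. *)
Let tau_mx : 'M[F]_3 := mx3 0 0 r 1 0 s 0 r 0.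
Let tau : {'GL_3[F]} := GLmx tau_mx.

Let det_tau : \det tau_mx = 1.
Proof.
by rewrite det_mx3 -[RHS]r2; ring.
Qed.

Let tauE : GLval tau = tau_mx.
Proof. by rewrite GLmxE // unitmxE det_tau unitr1. Qed.

Let tau_cyclic i : in_cyclic tau_mx (delta_mx 0 (inord 2)) (delta_mx 0 i).
Proof.
have r0 : r != 0 by apply: contra_eq_neq r2 => ->; rewrite expr0n eq_sym oner_eq0.
have c2 := in_cyclic_id tau_mx (delta_mx 0 (inord 2)).
have c1 : in_cyclic tau_mx (delta_mx 0 (inord 2)) (delta_mx 0 1).
  have -> : delta_mx 0 1 = r *: (delta_mx 0 (inord 2) *m tau_mx) :> 'rV_3.
    rewrite -rowE; apply/rowP=> -[[|[|[|//]]] ?]; rewrite !mxE inordK //= ?mulr0 //.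
  exact/in_cyclicZ/in_cyclic_mul.
have c0 : in_cyclic tau_mx (delta_mx 0 (inord 2)) (delta_mx 0 0).
  have -> : delta_mx 0 0 = delta_mx 0 1 *m tau_mx + - s *: delta_mx 0 (inord 2) :> 'rV_3.
    rewrite -rowE; apply/rowP=> -[[|[|[|//]]] ?]; rewrite !mxE /= -val_eqE /= inordK //=;
    by rewrite ?mulr0 ?addr0 ?mulr1 ?subrr.
  exact/in_cyclicD/in_cyclicZ/c2/in_cyclic_mul.
case: i => [[|[|[|//]]] lti].
- by rewrite (_ : Ordinal lti = 0) //; apply: val_inj.
- by rewrite (_ : Ordinal lti = 1) //; apply: val_inj.
- by rewrite (_ : Ordinal lti = inord 2) //; apply: val_inj; rewrite /= inordK.
Qed.

Let tau_sqr : tau_mx *m tau_mx = mx3 0 1 0 0 (r * s) r r 0 (r * s).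
Proof.
by rewrite mulmx3; congr mx3; first [ring | rewrite -r2; ring].
Qed.

Let tau_cube : tau_mx *m tau_mx *m tau_mx = (r * s) *: tau_mx + 1%:M.
Proof.
rewrite tau_sqr mulmx3 mx3_1; apply/matrixP=> -[[|[|[|//]]] ?] [[|[|[|//]]] ?];
  rewrite !mxE /=;
  first [ring | rewrite -r2; ring | rewrite -[s in LHS]mulr1 -r2; ring].
Qed.

Let tauV : GLval tau^-1%g = mx3 (- (r * s)) 1 0 0 0 r r 0 0.
Proof.
have -> : tau^-1%g = GLmx (mx3 (- (r * s)) 1 0 0 0 r r 0 0).
  apply: (mulgI tau); rewrite mulgV; apply: GLval_inj.
  have e : tau_mx *m mx3 (- (r * s)) 1 0 0 0 r r 0 0 = 1%:M.
    by rewrite mulmx3 mx3_1; congr mx3; first [ring | rewrite -r2; ring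
      | rewrite -[s in LHS]mulr1 -r2; ring].
  by rewrite GL_MxE tauE GLmxE ?e //; case/mulmx1_unit: e.
rewrite GLmxE // unitmxE det_mx3.
have -> : - (r * s) * (0 * 0 - r * 0) - 1 * (0 * 0 - r * r) + 0 * (0 * 0 - 0 * r) = r ^+ 2 by ring.
by rewrite r2 unitr1.
Qed.

Hypothesis rs : if p == 3 then r * s = 1 else s = 0.

Let tau_order : exists2 k, (0 < k)%N & odd k /\ (tau ^+ k = 1)%g /\
  exists2 l, (0 < l)%N & tau_mx ^+ (#|F| ^ l) = tau_mx.
Proof.
have cubeE : tau_mx ^+ 3 = (r * s) *: tau_mx + 1 by rewrite -tau_cube !exprS expr0 mulr1 -mulmxA.
have [p3 | p3] := eqVneq p 3; move: rs; rewrite ?p3 ?eqxx ?(negPf p3) => rs'.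
  have F3 : 3 \in [pchar 'M[F]_3].
    rewrite pchar_lalg; apply: (@card_finPcharP _ _ 1); by rewrite ?Fp ?p3.
  have e3 : tau_mx ^+ 3 = tau_mx + 1 by rewrite cubeE rs' scale1r.
  have e9 : tau_mx ^+ 9 = tau_mx + 1 + 1.
    rewrite (exprM _ 3 3) -[X in X ^+ 3]/(tau_mx ^+ 3) e3.
    rewrite -(pFrobenius_autE F3) pFrobenius_autD_comm; last exact: commr1.
    by rewrite !pFrobenius_autE expr1n e3.
  (* tau^3 = tau + 1 and tau^9 = tau + 2, because cubing is additive. *)
  have e13 : tau_mx ^+ 13 = 1.
    rewrite (exprD _ 9 4) e9 exprS e3.
    have m3 (B : 'M[F]_3) : B + B + B = 0.
      by rewrite -[RHS](mulrn_pchar F3 B) !mulrS mulr0n addr0 addrA.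
    have e3' : tau_mx * (tau_mx * (tau_mx + 1)) = tau_mx + 1 + tau_mx ^+ 2.
      by rewrite 2!mulrDr !mulr1 -e3 -expr2 -exprS.
    rewrite 2!mulrDl mul1r e3' mulrDr mulr1 -expr2.
    transitivity (1 + (tau_mx + tau_mx + tau_mx) +
      (tau_mx ^+ 2 + tau_mx ^+ 2 + tau_mx ^+ 2)).
      move: tau_mx (tau_mx ^+ 2) (1 : 'M[F]_3) => a b c.
      by apply/matrixP=> i j; rewrite !mxE; ring.
    by rewrite !m3 !addr0.
  exists 13 => //; split=> //; split.
    by apply: GLval_inj; rewrite GLval_X tauE e13.
  by exists 3 => //; rewrite Fp p3 -[(3 ^ 3)%N]/(13 * 2 + 1)%N exprD exprM e13 expr1n mul1r.
have e3 : tau_mx ^+ 3 = 1 by rewrite cubeE rs' mulr0 scale0r add0r.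
exists 3 => //; split=> //; split.
  by apply: GLval_inj; rewrite GLval_X tauE e3.
exists 2 => //; rewrite Fp.
have p2 : (p ^ 2 = 1 %[mod 3])%N.
  have : (p %% 3 != 0)%N by rewrite -/(_ %| _)%N dvdn_prime2 // eq_sym.
  rewrite -modnXm; have := ltn_pmod p (isT : 0 < 3)%N.
  by case: (p %% 3)%N => [|[|[|]]].
by rewrite (divn_eq (p ^ 2) 3) p2 exprD mulnC exprM e3 expr1n mul1r.
Qed.

(** Here t = u = tau, and v = uni3 (l al) (l be) z. The trace of tau v is
    l (al + r be), and for l = 0 the trace of (tau v)^-1 detects z. The trace of
    tau (v tau v^-1) differs from that of tau^2 by the quadratic term
    l^2 (al^2 - r al be + be^2), up to sign, whatever z is. *)
Lemma obstruction_line (gT : finGroupType) (M : {group gT}) (f : {'GL_3[F]} -> gT)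
    (P : {set {'GL_3[F]}}) (al be : F) :
    covers (SL 3 F) f -> {in SL 3 F, forall x, f x = 1%g -> x = 1%g} ->
    (p.-group M)%g -> (p ^ 2 <= #|M|)%N -> P \subset SL 3 F -> f @: P = M ->
    (forall v, v \in P -> exists l z, v = uni3 (l * al) (l * be) z) ->
    al + r * be != 0 -> al ^+ 2 - r * al * be + be ^+ 2 != 0 ->
  obstruction M.
Proof.
move=> coverf f_ker pM leM sPL fPM PE lin0 quad0.
have pF : p \in [pchar F] by apply: (@card_finPcharP _ _ 1); rewrite ?Fp.
have f_inj := covers_inj coverf f_ker.
have tL : tau \in SL 3 F by rewrite in_SL tauE det_tau.
have uL x y z : uni3 x y z \in SL 3 F.
  by rewrite in_SL uni3E det_mx3; apply/eqP; ring.
have [k k_gt0 [k_odd [tk [j j_gt0 tauQ]]]] := tau_order.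
have reg h i : h \in SL 3 F -> tau = (h ^+ i)%g -> cover_regular (SL 3 F) f p h.
  move=> hL tauh; apply: (covers_regular_inj coverf f_ker hL) => x xL xh xp.
  apply: GLval_inj.
  apply: (@cyclic_commute_unipotent _ _ tau_mx p 1 j (delta_mx 0 (inord 2))) => //.
  + have xtau : commute x tau by rewrite tauh; apply: commuteX.
    by have:= GLval_commute xtau; rewrite tauE.
  + by rewrite -GLval_X xp.
have reg1 : cover_regular (SL 3 F) f p tau by apply: (reg _ 1%N); rewrite ?expg1.
(* tau has odd order, hence is a power of its square. *)
have reg2 : cover_regular (SL 3 F) f p (tau * tau)%g.
  apply: (reg _ k./2.+1); first by rewrite groupM.
  have kE : (k./2.*2).+1 = k by rewrite -[RHS]odd_double_half k_odd.
  by rewrite -[(tau * tau)%g]/(tau ^+ 2)%g -expgM mul2n doubleS kE expgS tk mulg1.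
have free : cover_free (SL 3 F) f P tau.
  move=> _ x /PE[l [z ->]] xL.
  move=> /f_inj; rewrite groupM // SL_conj => /(_ isT tL) e.
  have l0 : l = 0.
    have := congr1 (fun g => \tr (GLval g)) e.
    rewrite mxtrace_conjGL GL_MxE uni3E tauE mulmx3 !tr_mx3 => e1.
    apply: (mulIf lin0); rewrite mul0r; move/eqP: e1; rewrite -subr_eq0 => /eqP e1.
    by rewrite -[RHS]e1; ring.
  have z0 : z = 0.
    have r0 : r != 0 by apply: contra_eq_neq r2 => ->; rewrite expr0n eq_sym oner_eq0.
    have := congr1 (fun g => \tr (GLval g^-1%g)) e.
    rewrite l0 -conjVg mxtrace_conjGL invMg GL_MxE uni3V uni3E tauV mulmx3 !tr_mx3.
    move/esym/eqP; rewrite -subr_eq0 => /eqP e2.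
    by apply: (mulIf r0); rewrite mul0r -[RHS]e2; ring.
  by rewrite l0 z0 !mul0r uni3_0 (covers1 coverf).
pose B := f @: [set uni3 0 0 z | z : F].
apply: (obstruction_of_cover coverf (B := B) p_pr pM sPL fPM tL tL) => //.
  move=> _ x /PE[l [z ->]] xL /f_inj; rewrite SL_conj !groupM ?groupV //.
  move=> /(_ isT isT) /(congr1 (fun g => \tr (GLval g))).
  rewrite mxtrace_conjGL !GL_MxE uni3V !uni3E tauE tau_sqr !mulmx3 !tr_mx3 => e.
  suffices -> : l = 0 by rewrite !mul0r; apply/imset_f/imset_f.
  move/esym/eqP: e; rewrite -subr_eq0 => /eqP e.
  have /eqP : l ^+ 2 * (al ^+ 2 - r * al * be + be ^+ 2) = 0.
    have r0 : l ^+ 2 * be ^+ 2 * (1 - r ^+ 2) = 0 by rewrite r2 subrr mulr0.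
    by rewrite -[RHS]addr0 -[X in _ = X + _]e -[X in _ = _ + X]r0; ring.
  by rewrite mulf_eq0 (negPf quad0) orbF sqrf_eq0 => /eqP.
apply: leq_trans leM; apply: leq_ltn_trans (leq_imset_card _ _) _.
apply: leq_ltn_trans (leq_imset_card _ _) _.
by rewrite Fp -{1}(expn1 p) ltn_exp2l // prime_gt1.
Qed.

End SL3.

(** When r^2 = 1 the two expressions have product al^3 + r be^3, and the values of
    this for r = 1 and r = -1 have the sum 2 al^3. *)
Lemma sign_choice (F : finFieldType) (p : nat) (al be : F) : prime p -> p \in [pchar F] ->
    (al != 0) || (be != 0) -> (p = 2%N -> al * be = 0) ->
  exists r, [/\ r ^+ 2 = 1, al + r * be != 0 & al ^+ 2 - r * al * be + be ^+ 2 != 0].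
Proof.
move=> p_pr pF ab0 ab2.
have [r r2 abr] : exists2 r : F, r ^+ 2 = 1 & al ^+ 3 + r * be ^+ 3 != 0.
  have [e1 | ?] := eqVneq (al ^+ 3 + 1 * be ^+ 3) 0; last by exists 1; rewrite ?expr1n.
  have [e2 | ?] := eqVneq (al ^+ 3 + -1 * be ^+ 3) 0; last by exists (-1); rewrite ?sqrrN ?expr1n.
  have e3 : 2 * al ^+ 3 = 0 by rewrite -[RHS]addr0 -{1}e1 -e2; ring.
  have [p2 | p_odd] := even_prime p_pr.
    have /eqP := ab2 p2; rewrite mulf_eq0; move: ab0 e1.
    case: (eqVneq al 0) => [->|al0] /= be0 e1.
      by move: e1 be0 => /eqP; rewrite expr0n add0r mul1r expf_eq0 => /= ->.
    by move=> /eqP be00; move/eqP: e1; rewrite be00 expr0n mulr0 addr0 expf_eq0 (negPf al0).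
  have two_neq0 : 2 != 0 :> F.
    by rewrite -(dvdn_pcharf pF) dvdn_prime2 //; case: eqP p_odd => // ->.
  move/eqP: e3; rewrite mulf_eq0 (negPf two_neq0) expf_eq0 /= => /eqP al0.
  move/eqP: e1 ab0; rewrite al0 expr0n add0r mul1r expf_eq0 eqxx /= => -> //.
exists r; split=> //; apply: contraNneq abr => e; apply/eqP.
  transitivity ((al + r * be) * (al ^+ 2 - r * al * be + be ^+ 2)
    + al * be ^+ 2 * (r ^+ 2 - 1)); first by ring.
  by rewrite e r2 subrr mul0r mulr0 addr0.
transitivity ((al + r * be) * (al ^+ 2 - r * al * be + be ^+ 2)
  + al * be ^+ 2 * (r ^+ 2 - 1)); first by ring.
by rewrite e r2 subrr !mulr0 addr0.
Qed.

(** Two elements uni3 x y z commute only if their pairs (x, y) are proportional, so P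
    lies over a line. If p = 2 and the line is spanned by the pair of an element
    uni3 al be ga of P, then M has order 4, hence exponent 2, and so the square
    uni3 0 0 (al be) of that element is trivial. *)
Lemma obstruction_SL3 (F : finFieldType) p (gT : finGroupType) (M : {group gT}) :
    prime p -> #|F| = p -> ([set: gT] \isog SL 3 F)%g ->
    (M :!=: 1)%g -> abelian M -> (p.-group M)%g -> central_type M ->
  obstruction M.
Proof.
move=> p_pr Fp /isog_covers[f0 cover0 f0_ker] M1 abM pM ctM.
have leM := central_type_card p_pr pM M1 ctM.
have pF : p \in [pchar F] by apply: (@card_finPcharP _ _ 1); rewrite ?Fp.
have sylU : (p.-Sylow('GL_3[F]) (uni3_group F))%g.
  by apply: (@Sylow_GL _ _ p 1); rewrite ?Fp // card_uni3 Fp.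
have [|f [P [coverf f_ker0 sPL sPU fPM]]] := conjugate_cover cover0 pM (U := uni3_group F).
  move=> Q _ pQ; have [g _ sQU] := Sylow_subJ sylU (subsetT Q) pQ.
  by exists g; rewrite ?SL_norm.
have f_ker : {in SL 3 F, forall x, f x = 1%g -> x = 1%g}.
  move=> x xL /(f_ker0 x xL)[g xgL /(f0_ker _ xgL) xg1].
  by apply: (conjg_inj g); rewrite xg1 conj1g.
have f_inj := covers_inj coverf f_ker; have [fM _] := coverf.
have memM v : v \in P -> f v \in M by move=> vP; rewrite -fPM imset_f.
have sPU' v : v \in P -> exists x y z, v = uni3 x y z.
  by move/(subsetP sPU); apply: uni3_groupP.
have Pcomm u v : u \in P -> v \in P -> commute u v.
  move=> uP vP; have [uL vL] := (subsetP sPL _ uP, subsetP sPL _ vP).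
  apply: f_inj; rewrite ?groupM // !fM //.
  by apply: (centsP abM); apply: memM.
have [al [be [ab0 ab2 PE]]] : exists al be, [/\ (al != 0) || (be != 0),
    (p = 2%N -> al * be = 0) &
    forall v, v \in P -> exists l z, v = uni3 (l * al) (l * be) z].
  have [/exists_inP[v0 v0P /existsP[al /existsP[be /existsP[ga /andP[/eqP v0E ab0]]]]] | all0] :=
    boolP [exists v0 in P, exists al, exists be, exists ga,
      (v0 == uni3 al be ga) && ((al != 0) || (be != 0))].
    have PE : forall v, v \in P -> exists l z, v = uni3 (l * al) (l * be) z.
      move=> v vP; have := Pcomm _ _ v0P vP; have [x [y [z vE]]] := sPU' v vP.
      rewrite vE v0E /commute !uni3M => /uni3_inj[_ _ e].
      have {}e : al * y = x * be.
        by apply: (addrI (ga + z)); rewrite e; ring.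
      have [al0 | al0] := eqVneq al 0.
        move: ab0 e; rewrite al0 eqxx mul0r => /= be0 /esym/eqP.
        rewrite mulf_eq0 (negPf be0) orbF => /eqP ->.
        by exists (y / be), z; rewrite mulr0 mulfVK.
      by exists (x / al), z; rewrite mulfVK // mulrAC -e mulrAC mulfV // mul1r.
    exists al, be; split=> // p2.
    have leP : (#|M| <= p ^ 2)%N.
      rewrite -fPM; apply: leq_trans (leq_imset_card _ _) _.
      apply: (@leq_trans #|[set uni3 (u.1 * al) (u.1 * be) u.2 | u : F * F]|).
        apply/subset_leq_card/subsetP=> v /PE[l [z ->]].
        by apply/imsetP; exists (l, z).
      by apply: leq_trans (leq_imset_card _ _) _; rewrite card_prod Fp mulnn.
    have cardM : #|M| = (p ^ 2)%N by apply/eqP; rewrite eqn_leq leP.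
    have v0L := subsetP sPL _ v0P.
    have: (v0 * v0)%g = 1%g.
      apply: f_ker; rewrite ?groupM // fM //.
      have := central_type_exponent ctM cardM (memM _ v0P).
      by rewrite p2 expgS expg1.
    rewrite v0E uni3M -uni3_0 => /uni3_inj[_ _ e].
    rewrite -[RHS]e; have -> : ga + ga = 2 * ga by ring.
    have : 2 = 0 :> F by rewrite -p2 (pcharf0 pF).
    by move=> ->; rewrite mul0r add0r.
  exists 1, 0; split=> [|_|v vP]; rewrite ?oner_eq0 ?mulr0 //.
  have [x [y [z vE]]] := sPU' v vP; exists 0, z; rewrite vE mul0r mulr0.
  move: all0; rewrite negb_exists_in => /forall_inP/(_ v vP).
  rewrite negb_exists => /forallP/(_ x); rewrite negb_exists => /forallP/(_ y).
  rewrite negb_exists => /forallP/(_ z); rewrite vE eqxx negb_or !negbK.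
  by case/andP=> /eqP-> /eqP->.
have [r [r2 lin0 quad0]] := sign_choice p_pr pF ab0 ab2.
pose s : F := if p == 3 then r else 0.
have rsE : if p == 3 then r * s = 1 else s = 0.
  by rewrite /s; case: (p == 3).
exact: (obstruction_line p_pr Fp r2 rsE coverf f_ker pM leM sPL fPM PE lin0 quad0).
Qed.

(** * Matrix identities for the Suzuki groups *)

Section FourByFour.
Variable F : finFieldType.

Definition mx4 a00 a01 a02 a03 a10 a11 a12 a13 a20 a21 a22 a23 a30 a31 a32 a33 : 'M[F]_4 :=
  mx_of_rows [:: [:: a00; a01; a02; a03]; [:: a10; a11; a12; a13];
                 [:: a20; a21; a22; a23]; [:: a30; a31; a32; a33]].

Lemma mulmx4 a00 a01 a02 a03 a10 a11 a12 a13
    a20 a21 a22 a23 a30 a31 a32 a33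
    b00 b01 b02 b03 b10 b11 b12 b13
    b20 b21 b22 b23 b30 b31 b32 b33 :
  mx4 a00 a01 a02 a03 a10 a11 a12 a13 a20 a21 a22 a23 a30 a31 a32 a33 *m
  mx4 b00 b01 b02 b03 b10 b11 b12 b13 b20 b21 b22 b23 b30 b31 b32 b33 =
  mx4
    (a00 * b00 + a01 * b10 + a02 * b20 + a03 * b30) (a00 * b01 + a01 * b11 + a02 * b21 + a03 * b31)
    (a00 * b02 + a01 * b12 + a02 * b22 + a03 * b32) (a00 * b03 + a01 * b13 + a02 * b23 + a03 * b33)
    (a10 * b00 + a11 * b10 + a12 * b20 + a13 * b30) (a10 * b01 + a11 * b11 + a12 * b21 + a13 * b31)
    (a10 * b02 + a11 * b12 + a12 * b22 + a13 * b32) (a10 * b03 + a11 * b13 + a12 * b23 + a13 * b33)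
    (a20 * b00 + a21 * b10 + a22 * b20 + a23 * b30) (a20 * b01 + a21 * b11 + a22 * b21 + a23 * b31)
    (a20 * b02 + a21 * b12 + a22 * b22 + a23 * b32) (a20 * b03 + a21 * b13 + a22 * b23 + a23 * b33)
    (a30 * b00 + a31 * b10 + a32 * b20 + a33 * b30) (a30 * b01 + a31 * b11 + a32 * b21 + a33 * b31)
    (a30 * b02 + a31 * b12 + a32 * b22 + a33 * b32) (a30 * b03 + a31 * b13 + a32 * b23 + a33 * b33).
Proof.
by apply/matrixP=> -[[|[|[|[|//]]]] ?] [[|[|[|[|//]]]] ?];
  rewrite !mxE !big_ord_recl big_ord0 !mxE /= addr0 !addrA.
Qed.

Lemma mx4_1 : 1%:M = mx4 1 0 0 0 0 1 0 0 0 0 1 0 0 0 0 1.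
Proof.
by apply/matrixP=> -[[|[|[|[|//]]]] ?] [[|[|[|[|//]]]] ?]; rewrite !mxE.
Qed.

(** In the Suzuki group A = theta a and B = theta b. As independent parameters they
    turn the relations of the group into identities of rational functions, valid
    in characteristic 2. *)
Definition szu (a A b B : F) : 'M[F]_4 :=
  mx4 1 0 0 0 a 1 0 0 (a * A + b) A 1 0 (a ^+ 2 * A + a * b + B) b a 1.
Definition szt (x y z t : F) : 'M[F]_4 := mx4 x 0 0 0 0 y 0 0 0 0 z 0 0 0 0 t.
Definition szw : 'M[F]_4 := mx4 0 0 0 1 0 0 1 0 0 1 0 0 1 0 0 0.

Hypothesis two0 : 2 = 0 :> F.

Lemma two_eq (z x y : F) : x - y = 2 * z -> x = y.
Proof. by rewrite two0 mul0r => /eqP; rewrite subr_eq0 => /eqP. Qed.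

(** The upper unitriangular matrix on the left lies in the big Bruhat cell, since its
    minors N and T in the upper right corner do not vanish. *)
Lemma szw_szu_szw (a A b B : F) :
    let N := a ^+ 2 * A + a * b + B in
    let T := a ^+ 2 * A ^+ 2 + A * B + b ^+ 2 in
    let a' := (a * A + b) / N in let A' := (A * a ^+ 2 + B) / T in
    N != 0 -> T != 0 ->
  szw *m szu a A b B *m szw =
    szu a' A' (a / N + a' * A') (A / T + A' * a' ^+ 2)
      *m szt N (T / N) (N / T) N^-1 *m szw *m szu (b / N) (B / T) (a / N) (A / T).
Proof.
move=> N T a' A' N0 T0; rewrite !mulmx4 /a' /A' {a' A'}.
(* Over the rational numbers the two sides differ: z is half their difference. *)
congr mx4; [
    apply: (two_eq (z := - (a * A * b * B ^+ 2 + a ^+ 2 * A * b ^+ 2 * B + 2 * a ^+ 3 * A ^+ 2 *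
      b * B + a ^+ 4 * A ^+ 2 * b ^+ 2 + a ^+ 5 * A ^+ 3 * b) / (N ^+ 2 * T)))
  | idtac
  | idtac
  | idtac
  | apply: (two_eq (z := - (b ^+ 3 * B ^+ 2 + A * b * B ^+ 3 + 2 * a * b ^+ 4 * B + 4 * a * A *
      b ^+ 2 * B ^+ 2 + a * A ^+ 2 * B ^+ 3 + a ^+ 2 * b ^+ 5 + 5 * a ^+ 2 * A * b ^+ 3 * B + 5 *
      a ^+ 2 * A ^+ 2 * b * B ^+ 2 + 2 * a ^+ 3 * A * b ^+ 4 + 9 * a ^+ 3 * A ^+ 2 * b ^+ 2 * B +
      3 * a ^+ 3 * A ^+ 3 * B ^+ 2 + 4 * a ^+ 4 * A ^+ 2 * b ^+ 3 + 7 * a ^+ 4 * A ^+ 3 * b * B +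
      5 * a ^+ 5 * A ^+ 3 * b ^+ 2 + 3 * a ^+ 5 * A ^+ 4 * B + 3 * a ^+ 6 * A ^+ 4 * b + a ^+ 7 *
      A ^+ 5) / (N ^+ 3 * T)))
  | idtac
  | apply: (two_eq (z := - (b ^+ 2 * B + a * b ^+ 3 + a ^+ 2 * A * b ^+ 2) / N ^+ 2))
  | idtac
  | apply: (two_eq (z := - (2 * b ^+ 3 * B ^+ 3 + 2 * A * b * B ^+ 4 + 5 * a * b ^+ 4 * B ^+ 2 +
      9 * a * A * b ^+ 2 * B ^+ 3 + 2 * a * A ^+ 2 * B ^+ 4 + 4 * a ^+ 2 * b ^+ 5 * B + 16 * a ^+
      2 * A * b ^+ 3 * B ^+ 2 + 14 * a ^+ 2 * A ^+ 2 * b * B ^+ 3 + a ^+ 3 * b ^+ 6 + 13 * a ^+ 3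
      * A * b ^+ 4 * B + 31 * a ^+ 3 * A ^+ 2 * b ^+ 2 * B ^+ 2 + 8 * a ^+ 3 * A ^+ 3 * B ^+ 3 + 4
      * a ^+ 4 * A * b ^+ 5 + 26 * a ^+ 4 * A ^+ 2 * b ^+ 3 * B + 30 * a ^+ 4 * A ^+ 3 * b * B ^+
      2 + 8 * a ^+ 5 * A ^+ 2 * b ^+ 4 + 35 * a ^+ 5 * A ^+ 3 * b ^+ 2 * B + 12 * a ^+ 5 * A ^+ 4
      * B ^+ 2 + 12 * a ^+ 6 * A ^+ 3 * b ^+ 3 + 26 * a ^+ 6 * A ^+ 4 * b * B + 13 * a ^+ 7 * A ^+
      4 * b ^+ 2 + 8 * a ^+ 7 * A ^+ 5 * B + 8 * a ^+ 8 * A ^+ 5 * b + 2 * a ^+ 9 * A ^+ 6) / (N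
      ^+ 3 * T ^+ 2)))
  | apply: (two_eq (z := - (b ^+ 2 * B ^+ 3 + A * B ^+ 4 + 3 * a * b ^+ 3 * B ^+ 2 + 3 * a * A *
      b * B ^+ 3 + 3 * a ^+ 2 * b ^+ 4 * B + 7 * a ^+ 2 * A * b ^+ 2 * B ^+ 2 + 5 * a ^+ 2 * A ^+
      2 * B ^+ 3 + a ^+ 3 * b ^+ 5 + 8 * a ^+ 3 * A * b ^+ 3 * B + 10 * a ^+ 3 * A ^+ 2 * b * B ^+
      2 + 3 * a ^+ 4 * A * b ^+ 4 + 11 * a ^+ 4 * A ^+ 2 * b ^+ 2 * B + 9 * a ^+ 4 * A ^+ 3 * B ^+
      2 + 5 * a ^+ 5 * A ^+ 2 * b ^+ 3 + 11 * a ^+ 5 * A ^+ 3 * b * B + 5 * a ^+ 6 * A ^+ 3 * b ^+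
      2 + 7 * a ^+ 6 * A ^+ 4 * B + 4 * a ^+ 7 * A ^+ 4 * b + 2 * a ^+ 8 * A ^+ 5) / (N ^+ 2 * T
      ^+ 2)))
  | apply: (two_eq (z := - (b ^+ 2 * B ^+ 2 + a * b ^+ 3 * B + a * A * b * B ^+ 2 + 3 * a ^+ 2 *
      A * b ^+ 2 * B + a ^+ 3 * A * b ^+ 3 + 2 * a ^+ 3 * A ^+ 2 * b * B + 2 * a ^+ 4 * A ^+ 2 * b
      ^+ 2 + a ^+ 5 * A ^+ 3 * b) / (N ^+ 2 * T)))
  | apply: (two_eq (z := - (b * B ^+ 2 + a * b ^+ 2 * B + a * A * B ^+ 2 + 3 * a ^+ 2 * A * b *
      B + a ^+ 3 * A * b ^+ 2 + 2 * a ^+ 3 * A ^+ 2 * B + 2 * a ^+ 4 * A ^+ 2 * b + a ^+ 5 * A ^+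
      3) / (N * T)))
  | apply: (two_eq (z := - (3 * b ^+ 4 * B ^+ 3 + 4 * A * b ^+ 2 * B ^+ 4 + A ^+ 2 * B ^+ 5 + 8
      * a * b ^+ 5 * B ^+ 2 + 20 * a * A * b ^+ 3 * B ^+ 3 + 10 * a * A ^+ 2 * b * B ^+ 4 + 7 * a
      ^+ 2 * b ^+ 6 * B + 36 * a ^+ 2 * A * b ^+ 4 * B ^+ 2 + 45 * a ^+ 2 * A ^+ 2 * b ^+ 2 * B ^+
      3 + 8 * a ^+ 2 * A ^+ 3 * B ^+ 4 + 2 * a ^+ 3 * b ^+ 7 + 28 * a ^+ 3 * A * b ^+ 5 * B + 84 *
      a ^+ 3 * A ^+ 2 * b ^+ 3 * B ^+ 2 + 48 * a ^+ 3 * A ^+ 3 * b * B ^+ 3 + 8 * a ^+ 4 * A * b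
      ^+ 6 + 67 * a ^+ 4 * A ^+ 2 * b ^+ 4 * B + 116 * a ^+ 4 * A ^+ 3 * b ^+ 2 * B ^+ 2 + 22 * a
      ^+ 4 * A ^+ 4 * B ^+ 3 + 20 * a ^+ 5 * A ^+ 2 * b ^+ 5 + 108 * a ^+ 5 * A ^+ 3 * b ^+ 3 * B
      + 84 * a ^+ 5 * A ^+ 4 * b * B ^+ 2 + 34 * a ^+ 6 * A ^+ 3 * b ^+ 4 + 113 * a ^+ 6 * A ^+ 4
      * b ^+ 2 * B + 28 * a ^+ 6 * A ^+ 5 * B ^+ 2 + 44 * a ^+ 7 * A ^+ 4 * b ^+ 3 + 64 * a ^+ 7 *
      A ^+ 5 * b * B + 38 * a ^+ 8 * A ^+ 5 * b ^+ 2 + 17 * a ^+ 8 * A ^+ 6 * B + 18 * a ^+ 9 * A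
      ^+ 6 * b + 4 * a ^+ 10 * A ^+ 7) / (N ^+ 4 * T ^+ 2)))
  | apply: (two_eq (z := - (b ^+ 3 * B ^+ 3 + A * b * B ^+ 4 + 4 * a * b ^+ 4 * B ^+ 2 + 6 * a *
      A * b ^+ 2 * B ^+ 3 + 2 * a * A ^+ 2 * B ^+ 4 + 4 * a ^+ 2 * b ^+ 5 * B + 14 * a ^+ 2 * A *
      b ^+ 3 * B ^+ 2 + 11 * a ^+ 2 * A ^+ 2 * b * B ^+ 3 + a ^+ 3 * b ^+ 6 + 15 * a ^+ 3 * A * b
      ^+ 4 * B + 25 * a ^+ 3 * A ^+ 2 * b ^+ 2 * B ^+ 2 + 9 * a ^+ 3 * A ^+ 3 * B ^+ 3 + 5 * a ^+
      4 * A * b ^+ 5 + 27 * a ^+ 4 * A ^+ 2 * b ^+ 3 * B + 28 * a ^+ 4 * A ^+ 3 * b * B ^+ 2 + 11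
      * a ^+ 5 * A ^+ 2 * b ^+ 4 + 32 * a ^+ 5 * A ^+ 3 * b ^+ 2 * B + 15 * a ^+ 5 * A ^+ 4 * B ^+
      2 + 14 * a ^+ 6 * A ^+ 3 * b ^+ 3 + 27 * a ^+ 6 * A ^+ 4 * b * B + 13 * a ^+ 7 * A ^+ 4 * b
      ^+ 2 + 11 * a ^+ 7 * A ^+ 5 * B + 9 * a ^+ 8 * A ^+ 5 * b + 3 * a ^+ 9 * A ^+ 6) / (N ^+ 3 *
      T ^+ 2)))
  | apply: (two_eq (z := - (2 * b ^+ 3 * B ^+ 2 + A * b * B ^+ 3 + 3 * a * b ^+ 4 * B + 7 * a *
      A * b ^+ 2 * B ^+ 2 + a * A ^+ 2 * B ^+ 3 + a ^+ 2 * b ^+ 5 + 11 * a ^+ 2 * A * b ^+ 3 * B +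
      6 * a ^+ 2 * A ^+ 2 * b * B ^+ 2 + 4 * a ^+ 3 * A * b ^+ 4 + 16 * a ^+ 3 * A ^+ 2 * b ^+ 2 *
      B + 3 * a ^+ 3 * A ^+ 3 * B ^+ 2 + 9 * a ^+ 4 * A ^+ 2 * b ^+ 3 + 9 * a ^+ 4 * A ^+ 3 * b *
      B + 9 * a ^+ 5 * A ^+ 3 * b ^+ 2 + 3 * a ^+ 5 * A ^+ 4 * B + 4 * a ^+ 6 * A ^+ 4 * b + a ^+
      7 * A ^+ 5) / (N ^+ 3 * T)))
  | apply: (two_eq (z := - (b ^+ 2 * B ^+ 2 + a * b ^+ 3 * B + 4 * a * A * b * B ^+ 2 + 7 * a ^+
      2 * A * b ^+ 2 * B + 2 * a ^+ 2 * A ^+ 2 * B ^+ 2 + 2 * a ^+ 3 * A * b ^+ 3 + 10 * a ^+ 3 *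
      A ^+ 2 * b * B + 6 * a ^+ 4 * A ^+ 2 * b ^+ 2 + 4 * a ^+ 4 * A ^+ 3 * B + 6 * a ^+ 5 * A ^+
      3 * b + 2 * a ^+ 6 * A ^+ 4) / (N ^+ 2 * T))) ];
  by rewrite /N /T; field; rewrite ?exprMn -/N -/T ?N0 ?T0.
Qed.

End FourByFour.

(** * The Suzuki groups *)

(** In E x E any non-trivial square x^2 gives two, (x^2, 1) and (1, x^2). *)
Lemma central_type_sqr (gT : finGroupType) (M : {group gT}) :
  central_type M ->
  {in M &, forall x y, (x ^+ 2)%g != 1%g -> (y ^+ 2)%g != 1%g -> (x ^+ 2 = y ^+ 2)%g} ->
  {in M, forall x, (x ^+ 2)%g = 1%g}.
Proof.
move=> [eT [E isoME]] sqrM.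
have /isogP[f injf fE] : (setX E E \isog M)%g by rewrite isog_sym.
have pairX (y z : eT) k : ((y, z) ^+ k)%g = (y ^+ k, z ^+ k)%g.
  by elim: k => // k IHk; rewrite !expgS IHk.
have sqrE y : y \in E -> (y ^+ 2)%g = 1%g.
  move=> yE; apply/eqP/negPn/negP => y2.
  have y1 : (y, 1%g) \in setX E E by rewrite inE yE group1.
  have z1 : (1%g, y) \in setX E E by rewrite inE yE group1.
  have fM x : x \in setX E E -> f x \in M by move=> xE; rewrite -fE mem_morphim.
  have ne x : x \in setX E E -> (x ^+ 2)%g != 1%g -> (f x ^+ 2)%g != 1%g.
    move=> xE; apply: contraNneq; rewrite -morphX // -(morph1 f).
    by move/(injmP injf); rewrite groupX ?group1 // => ->.
  have := sqrM _ _ (fM _ y1) (fM _ z1).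
  rewrite !ne ?pairX ?expg1n //; try by rewrite xpair_eqE negb_and y2 ?orbT.
  move=> /(_ isT isT); rewrite -!morphX // => /(injmP injf); rewrite !groupX // => /(_ isT isT).
  rewrite !pairX !expg1n => -[y21 _].
  by rewrite y21 eqxx in y2.
move=> x; rewrite -fE => /morphimP[[y z] _]; rewrite inE => /andP[yE zE] ->.
by rewrite -morphX ?inE ?yE // pairX !sqrE // morph1.
Qed.

Section Suzuki.
Variables (F : finFieldType) (m : nat).
Hypotheses (m_gt1 : (1 < m)%N) (m_odd : odd m) (Fq : #|F| = (2 ^ m)%N).
Local Notation n := m./2.
Local Notation theta := (@suz_theta n F).
Implicit Types a b c d : F.

Let pF : 2 \in [pchar F]. Proof. exact: card_finPcharP Fq _. Qed.
Let two0 : 2 = 0 :> F. Proof. exact: pcharf0 pF. Qed.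

Lemma addff (x : F) : x + x = 0.
Proof. by rewrite -mulr2n -mulr_natl two0 mul0r. Qed.

Lemma oppff (x : F) : - x = x.
Proof. by apply/eqP; rewrite eq_sym -addr_eq0 addff. Qed.

Lemma thetaD : {morph theta : a b / a + b}.
Proof.
move=> a b; rewrite /suz_theta; apply: exprDn_pchar.
by rewrite pnatX pnatE // pF.
Qed.

Lemma thetaM : {morph theta : a b / a * b}.
Proof. by move=> a b; rewrite /suz_theta exprMn. Qed.

Lemma thetaV : {morph theta : a / a^-1}.
Proof. by move=> a; rewrite /suz_theta exprVn. Qed.

Lemma theta0 : theta 0 = 0.
Proof. by rewrite /suz_theta expr0n expn_eq0. Qed.

Lemma theta1 : theta 1 = 1. Proof. exact: expr1n. Qed.

Lemma theta_eq0 a : (theta a == 0) = (a == 0).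
Proof. by rewrite /suz_theta expf_eq0 expn_gt0. Qed.

Lemma theta_inj : injective theta.
Proof.
move=> a b ab; apply/eqP; rewrite -subr_eq0 -theta_eq0 thetaD oppff ab addff.
by rewrite eqxx.
Qed.

(** The square of theta raises to the power 2 ^ m.+1 = 2 q. *)
Lemma theta_theta a : theta (theta a) = a ^+ 2.
Proof.
have mE : (n.*2).+1 = m by rewrite -[RHS]odd_double_half m_odd.
by rewrite /suz_theta -exprM -expnD addnS addSn addnn mE expnSr exprM -Fq expf_card.
Qed.

Lemma theta_fixed a : theta a = a -> a = 0 \/ a = 1.
Proof.
move=> ta; have /eqP : a * (a - 1) = 0.
  by rewrite mulrBr mulr1 -expr2 -theta_theta !ta subrr.
by rewrite mulf_eq0 subr_eq0 => /orP[]/eqP->; [left | right].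
Qed.

(** If it vanished for a != 0, then c = b / (a theta a) would satisfy
    theta c = 1 + c, hence c^2 = theta (theta c) = c, and c would be 0 or 1, which
    theta fixes. *)
Lemma suz_norm_neq0 a b : (a != 0) || (b != 0) ->
  a ^+ 2 * theta a + a * b + theta b != 0.
Proof.
have [-> /= b0 | a0 _] := eqVneq a 0.
  by rewrite expr0n !mul0r !add0r theta_eq0.
have A0 : theta a != 0 by rewrite theta_eq0.
apply/negP => /eqP N0; pose c := b / (a * theta a).
have cE : theta c = 1 + c.
  have : (a ^+ 2 * theta a + a * b + theta b) / (a ^+ 2 * theta a) = 1 + c + theta c.
    rewrite /c thetaM thetaV thetaM theta_theta; field.
    by rewrite A0 a0.
  by rewrite N0 mul0r => /esym/eqP; rewrite addr_eq0 oppff => /eqP.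
have c2 : theta c = c.
  have : theta (theta c) = c by rewrite cE thetaD theta1 cE addrA addff add0r.
  rewrite theta_theta => c2; have /eqP : c * (c - 1) = 0 by rewrite mulrBr mulr1 -expr2 c2 subrr.
  by rewrite mulf_eq0 subr_eq0 => /orP[]/eqP->; rewrite ?theta0 ?theta1.
by move/eqP: cE; rewrite c2 -{1}[c]add0r (inj_eq (addIr c)) eq_sym oner_eq0.
Qed.

Lemma suz_uM a b c d : suz_u n a b *m suz_u n c d =
  suz_u n (a + c) (b + d + a * theta c).
Proof.
rewrite -[suz_u n a b]/(szu a (theta a) b (theta b)).
rewrite -[suz_u n c d]/(szu c (theta c) d (theta d)).
rewrite -[RHS]/(szu _ (theta _) _ (theta _)) !thetaD thetaM theta_theta mulmx4.
move: (theta a) (theta b) (theta c) (theta d) => A B C D.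
congr mx4; first [ring | apply: (@two_eq _ two0 (- (a * C)) _ _); ring
  | apply: (@two_eq _ two0 (- (a ^+ 2 * C + a * c * A + a * c * C + c ^+ 2 * A)) _ _); ring].
Qed.

Lemma suz_u0 : suz_u n (0 : F) 0 = 1%:M.
Proof.
rewrite -[LHS]/(szu 0 (theta 0) 0 (theta 0)) theta0 mx4_1.
by congr mx4; ring.
Qed.

Lemma suz_u_unit a b : suz_u n a b \in unitmx.
Proof.
have /mulmx1_unit[//] : suz_u n a b *m suz_u n a (b + a * theta a) = 1%:M.
by rewrite suz_uM addff addrA addff add0r addff suz_u0.
Qed.

Definition su a b : {'GL_4[F]} := GLmx (suz_u n a b).
Definition sw : {'GL_4[F]} := GLmx (suz_antidiag F).
Definition st d : {'GL_4[F]} := GLmx (suz_diag (d * theta d) d).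

Arguments su (a b)%_R.
Arguments st d%_R.

Lemma suE a b : GLval (su a b) = szu a (theta a) b (theta b).
Proof. by rewrite GLmxE // suz_u_unit. Qed.

Lemma swE : GLval sw = szw F.
Proof.
rewrite GLmxE //; have /mulmx1_unit[//] : szw F *m szw F = 1%:M.
by rewrite mulmx4 mx4_1; congr mx4; ring.
Qed.

Lemma stE d : d != 0 ->
  GLval (st d) = szt (d * theta d) d d^-1 (d * theta d)^-1.
Proof.
move=> d0; have D0 : theta d != 0 by rewrite theta_eq0.
rewrite GLmxE //; have /mulmx1_unit[//] : suz_diag (d * theta d) d *m
    suz_diag (d^-1 * theta d^-1) d^-1 = 1%:M.
rewrite -[X in X *m _]/(szt _ _ _ _) -[X in _ *m X]/(szt _ _ _ _) mulmx4 mx4_1 thetaV.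
by move: (theta d) D0 => D D0; congr mx4; field; rewrite ?D0 ?d0 ?oner_eq0.
Qed.

Lemma suM a b c d : (su a b * su c d)%g = su (a + c) (b + d + a * theta c).
Proof. by apply: GLval_inj; rewrite GL_MxE !GLmxE ?suz_u_unit // suz_uM. Qed.

Lemma su0 : su 0 0 = 1%g.
Proof. by apply: GLval_inj; rewrite GLmxE ?suz_u_unit // suz_u0. Qed.

Lemma suV a b : (su a b)^-1%g = su a (b + a * theta a).
Proof.
apply: (mulgI (su a b)); rewrite mulgV suM addff addrA addff add0r addff.
by rewrite su0.
Qed.

Lemma su_inj a b c d : su a b = su c d -> a = c /\ b = d.
Proof.
move/(congr1 (@GLval 4 F)); rewrite !suE => /matrixP e.
have := e (inord 1) (inord 0); have := e (inord 3) (inord 1).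
by rewrite !mxE !inordK //= => -> ->.
Qed.

Lemma sw2 : (sw * sw = 1)%g.
Proof.
apply: GLval_inj; rewrite GL_MxE swE GL_1E -[1]/(1%:M) mulmx4 mx4_1.
by congr mx4; ring.
Qed.

Lemma stM d e : d != 0 -> e != 0 -> (st d * st e)%g = st (d * e).
Proof.
move=> d0 e0; apply: GLval_inj; rewrite GL_MxE !stE ?mulf_neq0 // thetaM mulmx4.
have [D0 E0] : theta d != 0 /\ theta e != 0 by rewrite !theta_eq0.
by congr mx4; field; rewrite ?D0 ?E0 ?d0 ?e0 ?oner_eq0.
Qed.

Lemma st1 : st 1 = 1%g.
Proof.
apply: GLval_inj; rewrite stE ?oner_eq0 // theta1 GL_1E -[RHS]/(1%:M) mx4_1.
by congr mx4; field; rewrite ?oner_eq0.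
Qed.

Lemma st_su d a b : d != 0 ->
  (st d * su a b)%g = (su (a / theta d) (b / (d ^+ 2 * theta d)) * st d)%g.
Proof.
move=> d0; apply: GLval_inj; rewrite !GL_MxE stE // !suE.
have D0 : theta d != 0 by rewrite theta_eq0.
rewrite !thetaM !thetaV thetaM !theta_theta -[theta (d ^+ 2)]/(theta (d * d)) thetaM.
move: (theta a) (theta b) => A B.
by rewrite !mulmx4; congr mx4; field; rewrite ?D0 ?d0 ?oner_eq0.
Qed.

Lemma sw_st d : d != 0 -> (sw * st d)%g = (st d^-1 * sw)%g.
Proof.
move=> d0; apply: GLval_inj; rewrite !GL_MxE !stE ?invr_eq0 // swE thetaV.
have D0 : theta d != 0 by rewrite theta_eq0.
by rewrite !mulmx4; congr mx4; field; rewrite ?D0 ?d0 ?oner_eq0.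
Qed.

(** With theta N = T, the parameters A', A / T, B / T are values of theta. *)
Lemma sw_su_sw a b : (a != 0) || (b != 0) -> exists x y k z t,
  k != 0 /\ (sw * su a b * sw)%g = (su x y * st k * sw * su z t)%g.
Proof.
move=> ab0; pose N := a ^+ 2 * theta a + a * b + theta b.
have N0 : N != 0 by apply: suz_norm_neq0.
pose T := a ^+ 2 * theta a ^+ 2 + theta a * theta b + b ^+ 2.
have TE : theta N = T.
  rewrite /N !thetaD !thetaM !theta_theta /T.
  by move: (theta a) (theta b) => A B; ring.
have T0 : T != 0 by rewrite -TE theta_eq0.
pose x := (a * theta a + b) / N.
have xE : theta x = (theta a * a ^+ 2 + theta b) / T.
  by rewrite /x thetaM thetaV TE thetaD thetaM theta_theta.
exists x, (a / N + x * theta x), (T / N), (b / N), (a / N).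
have k0 : T / N != 0 by rewrite mulf_neq0 ?invr_eq0.
have kE : T / N * theta (T / N) = N.
  by rewrite thetaM thetaV -{2}TE theta_theta TE; field; rewrite N0 T0.
split=> //; apply: GLval_inj; rewrite !GL_MxE swE !suE stE // kE invf_div.
rewrite szw_szu_szw // -/N -/T -xE -/x.
congr (szu _ _ _ _ *m _ *m _ *m szu _ _ _ _).
- by rewrite [RHS]thetaD (thetaM a) thetaV TE (thetaM x) theta_theta.
- by rewrite thetaM thetaV TE.
- by rewrite thetaM thetaV TE.
Qed.

Local Notation L := (suzuki n F).

Lemma suz_generatorsP g : g \in suz_generators n F ->
  [\/ exists a b, g = su a b, exists2 d, d != 0 & g = st d | g = sw].
Proof.
rewrite !inE => /orP[/orP[/existsP[a /existsP[b /eqP ge]]|]|/eqP ge].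
- by constructor 1; exists a, b; apply: GLval_inj; rewrite ge GLmxE ?suz_u_unit.
- case/existsP=> x /existsP[d /existsP[k /and4P[k0 /eqP xk /eqP dk /eqP ge]]].
  constructor 2; exists d; first by rewrite -theta_eq0 dk.
  have xE : x = d * theta d by apply: theta_inj; rewrite xk thetaM dk.
  apply: GLval_inj; rewrite ge xE GLmxE // -xE -ge. exact: (GL_unitmx g).
- by constructor 3; apply: GLval_inj; rewrite ge GLmxE // -ge; exact: (GL_unitmx g).
Qed.

Lemma su_in_L a b : su a b \in L.
Proof.
apply: mem_gen; rewrite !inE -orbA; apply/orP; left.
by apply/existsP; exists a; apply/existsP; exists b; rewrite GLmxE ?suz_u_unit.
Qed.

Lemma sw_in_L : sw \in L.
Proof. by apply: mem_gen; rewrite !inE swE eqxx orbT. Qed.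

(** The cells B and B sw U, where U consists of the su a b and B of the su a b st d. *)
Definition bruhat g :=
  (exists a b d, d != 0 /\ g = su a b * st d)%g \/
  (exists a b d c e, d != 0 /\ g = su a b * st d * sw * su c e)%g.

Lemma bruhat_mull a b d g : d != 0 -> bruhat g -> bruhat (su a b * st d * g)%g.
Proof.
move=> d0 [[a' [b' [d' [d'0 ->]]]] | [a' [b' [d' [c [e [d'0 ->]]]]]]]; [left | right].
  rewrite -!mulgA [(st d * _)%g]mulgA st_su // -!mulgA stM // mulgA suM.
  by do 3!eexists; split; last reflexivity; rewrite mulf_neq0.
rewrite -!mulgA [(st d * _)%g]mulgA st_su // -!mulgA [(st d * _)%g]mulgA stM // !mulgA suM.
by do 5!eexists; split; last reflexivity; rewrite mulf_neq0.
Qed.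

Lemma bruhat_sw g : bruhat g -> bruhat (g * sw)%g.
Proof.
case=> [[a [b [d [d0 ->]]]] | [a [b [d [c [e [d0 ->]]]]]]].
  by right; exists a, b, d, 0, 0; rewrite su0 mulg1.
rewrite -!mulgA mulgA; apply: bruhat_mull => //.
have [ce0 | ] := boolP ((c != 0) || (e != 0)).
  have [x [y [k [z [t [k0 e']]]]]] := sw_su_sw ce0.
  by right; exists x, y, k, z, t; rewrite mulgA e'.
rewrite negb_or !negbK => /andP[/eqP-> /eqP->]; rewrite su0 mul1g sw2.
by left; exists 0, 0, 1; rewrite su0 st1 mulg1 oner_eq0.
Qed.

Lemma bruhat_gen g h : bruhat g -> h \in suz_generators n F -> bruhat (g * h)%g.
Proof.
move=> gB /suz_generatorsP[[a' [b' ->]] | [d' d'0 ->] | ->]; last exact: bruhat_sw.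
  case: gB => [[a [b [d [d0 ->]]]] | [a [b [d [c [e [d0 ->]]]]]]].
    by left; rewrite -mulgA st_su // mulgA suM; do 3!eexists; split; last reflexivity.
  by right; rewrite -!mulgA suM !mulgA; do 5!eexists; split; last reflexivity.
case: gB => [[a [b [d [d0 ->]]]] | [a [b [d [c [e [d0 ->]]]]]]].
  by left; exists a, b, (d * d'); rewrite mulf_neq0 // -mulgA stM.
right; have D0 : theta d' != 0 by rewrite theta_eq0.
rewrite -!mulgA.
have -> : (su c e * st d')%g = (st d' * su (c * theta d') (e * (d' ^+ 2 * theta d')))%g.
  by rewrite st_su // !mulfK // mulf_neq0 // expf_neq0.
rewrite [(sw * _)%g]mulgA sw_st // -!mulgA [(st d * _)%g]mulgA stM ?invr_eq0 //.
by rewrite !mulgA; do 5!eexists; split; last reflexivity; rewrite mulf_neq0 ?invr_eq0.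
Qed.

Lemma bruhatL g : g \in L -> bruhat g.
Proof.
case/gen_prodgP=> k [c cA ->]; elim: k c cA => [|k IHk] c cA.
  rewrite big_ord0; left; exists 0, 0, 1.
  by rewrite su0 st1 mulg1 oner_eq0.
by rewrite big_ord_recr /=; apply: bruhat_gen; [apply: IHk => i; exact: cA | exact: cA].
Qed.

Let sup (u : F * F) := su u.1 u.2.

Fact su_group_set : group_set [set sup u | u : F * F].
Proof.
apply/group_setP; split; first by rewrite -su0; apply/imsetP; exists (0, 0).
move=> _ _ /imsetP[[a b] _ ->] /imsetP[[c d] _ ->]; rewrite suM.
by apply/imsetP; exists (a + c, b + d + a * theta c).
Qed.

Definition su_group := Group su_group_set.

Lemma su_groupP v : reflect (exists a b, v = su a b) (v \in su_group).
Proof.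
apply: (iffP imsetP) => [[[a b] _ ->] | [a [b ->]]]; first by exists a, b.
by exists (a, b).
Qed.

Lemma su_pgroup : (2.-group su_group)%g.
Proof.
rewrite /pgroup card_imset /= => [|[a b] [c d] /su_inj[/= -> ->] //].
by rewrite card_prod Fq pnatM !pnatX pnat_id.
Qed.

(** A strictly larger 2-subgroup would contain an element outside U normalising
    U; its Bruhat decomposition leaves no room for it. *)
Lemma Sylow_su : (2.-Sylow(L) su_group)%g.
Proof.
have sUL : su_group \subset L by apply/subsetP=> _ /su_groupP[a [b ->]]; exact: su_in_L.
have [P sylP sUP] := Sylow_superset sUL su_pgroup.
have [-> // | UP] := eqVneq su_group P.
have pP := pHall_pgroup sylP.
have : su_group \proper 'N_P(su_group)%g.
  apply: nilpotent_proper_norm (pgroup_nil pP) _.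
  by rewrite properEneq UP.
case/properP=> _ [x /setIP[xP nUx] xU].
have suP a b : su a b \in P by apply: (subsetP sUP); apply/su_groupP; exists a, b.
have [[a [b [d [d0 xE]]]] | [a [b [d [c [e [d0 xE]]]]]]] := bruhatL (subsetP (pHall_sub sylP) _ xP).
  case/negP: xU; rewrite xE; apply/su_groupP; exists a, b.
  have stP : st d \in P by rewrite -(groupMl _ (suP a b)) -xE.
  suffices -> : d = 1 by rewrite st1 mulg1.
  have /p_natP[j oj] := mem_p_elt pP stP.
  have stX k : (st d ^+ k)%g = st (d ^+ k) /\ d ^+ k != 0.
    elim: k => [|k [IHk k0]]; first by rewrite st1 oner_eq0.
    by rewrite expgS IHk stM ?exprS ?mulf_neq0.
  have [stj dj] := stX (2 ^ j)%N.
  have : d ^+ (2 ^ j) = 1.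
    have : GLval (st (d ^+ (2 ^ j))) = 1%:M by rewrite -stj -oj expg_order.
    by rewrite stE // => /matrixP/(_ 1 1); rewrite !mxE.
  move/eqP; rewrite -subr_eq0 oppff => /eqP dj1; apply/eqP.
  have : (d + 1) ^+ (2 ^ j) == 0.
    by rewrite exprDn_pchar ?expr1n ?dj1 // pnatX pnatE // pF.
  by rewrite expf_eq0 => /andP[_]; rewrite addr_eq0 oppff.
have nU : (st d * sw)%g \in ('N(su_group))%g.
  have suN z t : su z t \in ('N(su_group))%g.
    by apply: (subsetP (normG _)); apply/su_groupP; exists z, t.
  by move: nUx; rewrite xE groupMr ?suN // -mulgA groupMl ?suN.
pose b1 := d ^+ 2 * theta d.
have b1_neq0 : b1 != 0 by rewrite mulf_neq0 ?expf_neq0 ?theta_eq0.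
have : (su 0 1 ^ (st d * sw))%g \in su_group.
  by rewrite (memJ_norm _ nU); apply/su_groupP; exists 0, 1.
case/su_groupP=> [x' [y' e1]].
have : (su 0 b1 * sw = sw * su x' y')%g.
  have : (st d * su 0 b1 = su 0 1 * st d)%g by rewrite st_su // mul0r divff.
  rewrite -e1 conjgM /conjg !mulgA mulgV mul1g => e2; congr (_ * _)%g.
  by rewrite -mulgA -e2 mulKg.
move/(congr1 (@GLval 4 F)); rewrite !GL_MxE swE !suE !mulmx4.
move/matrixP/(_ (inord 2) (inord 3)); rewrite !mxE !inordK //=.
rewrite !(mulr0, mulr1, mul0r, mul1r, addr0, add0r) => /eqP.
by rewrite (negPf b1_neq0).
Qed.

Lemma tr_mx4 a00 a01 a02 a03 a10 a11 a12 a13 a20 a21 a22 a23 a30 a31 a32 a33 :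
  \tr (mx4 a00 a01 a02 a03 a10 a11 a12 a13 a20 a21 a22 a23 a30 a31 a32 a33)
    = a00 + a11 + a22 + a33 :> F.
Proof. by rewrite /mxtrace !big_ord_recl big_ord0 !mxE /= addr0 !addrA. Qed.

Lemma sw_suE b : GLval (sw * su 0 b)%g =
  mx4 (theta b) b 0 1  b 0 1 0  0 1 0 0  1 0 0 0.
Proof.
rewrite GL_MxE swE suE theta0 mulmx4.
by congr mx4; ring.
Qed.

Lemma tr_sw_su b : \tr (GLval (sw * su 0 b)%g) = theta b.
Proof. by rewrite sw_suE tr_mx4 !addr0. Qed.

Lemma tr_sw_su_sqr b : \tr (GLval (sw * su 0 b * (sw * su 0 b))%g) = theta b ^+ 2.
Proof.
rewrite GL_MxE sw_suE mulmx4 tr_mx4.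
by apply: (@two_eq _ two0 (2 + b ^+ 2 - 0) _ _); move: (theta b) => B; ring.
Qed.

(** The traces of sw su 0 b and of its square determine b; for b = 1 the order is
    5, prime to that of the Sylow subgroup. *)
Let tau : {'GL_4[F]} := (sw * su 0 1)%g.

Let tauE : GLval tau = mx4 1 1 0 1  1 0 1 0  0 1 0 0  1 0 0 0.
Proof. by rewrite sw_suE theta1. Qed.

Let tau5 : (tau ^+ 5 = 1)%g.
Proof.
have e2 : GLval tau *m GLval tau = mx4 1 1 1 1  1 0 0 1  1 0 1 0  1 1 0 1.
  by rewrite tauE mulmx4; congr mx4; first [ring | apply: (@two_eq _ two0 1 _ _); ring].
have e4 : (GLval tau *m GLval tau) *m (GLval tau *m GLval tau) =
    mx4 0 0 0 1  0 0 1 0  0 1 0 1  1 0 1 1.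
  rewrite e2 mulmx4; congr mx4; first [ring | apply: (@two_eq _ two0 1 _ _); ring
    | apply: (@two_eq _ two0 2 _ _); ring].
have -> : (tau ^+ 5 = tau * tau * (tau * tau) * tau)%g.
  by rewrite !expgS expg0 mulg1 !mulgA.
apply: GLval_inj; rewrite 3!GL_MxE e4 tauE mulmx4 GL_1E -[RHS]/(1%:M) mx4_1.
congr mx4; first [ring | apply: (@two_eq _ two0 1 _ _); ring].
Qed.

Let tau_cyclic i : in_cyclic (GLval tau) (delta_mx 0 (inord 3)) (delta_mx 0 i).
Proof.
rewrite tauE; set T := mx4 _ _ _ _ _ _ _ _ _ _ _ _ _ _ _ _.
set v := delta_mx 0 (inord 3).
have c3 := in_cyclic_id T v.
have c0 : in_cyclic T v (delta_mx 0 0).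
  have -> : delta_mx 0 0 = v *m T :> 'rV_4.
    by rewrite -rowE; apply/rowP=> -[[|[|[|[|//]]]] ?]; rewrite !mxE inordK.
  exact: in_cyclic_mul.
have c1 : in_cyclic T v (delta_mx 0 1).
  have -> : delta_mx 0 1 = delta_mx 0 0 *m T + -1 *: delta_mx 0 0 + -1 *: v :> 'rV_4.
    rewrite -rowE; apply/rowP=> -[[|[|[|[|//]]]] ?]; rewrite !mxE -?val_eqE /= ?inordK //=; ring.
  by apply: in_cyclicD (in_cyclicZ _ c3); apply: in_cyclicD (in_cyclic_mul c0) (in_cyclicZ _ c0).
have c2 : in_cyclic T v (delta_mx 0 (inord 2)).
  have -> : delta_mx 0 (inord 2) = delta_mx 0 1 *m T + -1 *: delta_mx 0 0 :> 'rV_4.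
    rewrite -rowE; apply/rowP=> -[[|[|[|[|//]]]] ?]; rewrite !mxE -?val_eqE /= ?inordK //=; ring.
  exact: in_cyclicD (in_cyclic_mul c1) (in_cyclicZ _ c0).
case: i => [[|[|[|[|//]]]] lti].
- by rewrite (_ : Ordinal lti = 0) //; apply: val_inj.
- by rewrite (_ : Ordinal lti = 1) //; apply: val_inj.
- by rewrite (_ : Ordinal lti = inord 2) //; apply: val_inj; rewrite /= inordK.
- by rewrite (_ : Ordinal lti = inord 3) //; apply: val_inj; rewrite /= inordK.
Qed.

Lemma su_sqr a b : (su a b ^+ 2)%g = su 0 (a * theta a).
Proof. by rewrite expgS expg1 suM !addff add0r. Qed.

(** If su a b and su c d commute and their squares are non-trivial, then c / a is
    fixed by theta, so a = c and the squares agree. By [central_type_sqr] M has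
    exponent 2, that is, P consists of the su 0 b. For t = u = tau and v = su 0 b the
    elements tau v and sw su 0 (1 + b) agree, and tau (v tau v^-1) is the square of
    the latter. So the traces are theta (1 + b) and its square, which determine b. *)
Lemma obstruction_suzuki (gT : finGroupType) (M : {group gT}) :
    ([set: gT] \isog L)%g -> (M :!=: 1)%g -> abelian M -> (2.-group M)%g ->
    central_type M ->
  obstruction M.
Proof.
move=> /isog_covers[f0 cover0 f0_ker] M1 abM pM ctM.
have leM := central_type_card (isT : prime 2) pM M1 ctM.
have [|f [P [coverf f_ker0 sPL sPU fPM]]] := conjugate_cover cover0 pM (U := su_group).
  move=> Q sQL pQ; have [g gL sQU] := Sylow_subJ Sylow_su sQL pQ.
  by exists g; rewrite ?(subsetP (normG _)).
have f_ker : {in L, forall x, f x = 1%g -> x = 1%g}.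
  move=> x xL /(f_ker0 x xL)[g xgL /(f0_ker _ xgL) xg1].
  by apply: (conjg_inj g); rewrite xg1 conj1g.
have f_inj := covers_inj coverf f_ker; have [fM _] := coverf.
have f1 := covers1 coverf; have fX := coversX coverf.
have memM v : v \in P -> f v \in M by move=> vP; rewrite -fPM imset_f.
have sPU' v : v \in P -> exists a b, v = su a b.
  by move/(subsetP sPU)/su_groupP.
have sqrM : {in M, forall x, (x ^+ 2)%g = 1%g}.
  apply: central_type_sqr ctM _ => x y xM yM.
  move: (xM) (yM); rewrite -{1 2}fPM => /imsetP[u uP xE] /imsetP[v vP yE].
  have [uL vL] := (subsetP sPL u uP, subsetP sPL v vP).
  have uv : (u * v = v * u)%g.
    apply: f_inj; rewrite ?groupM // !fM // -xE -yE; exact: (centsP abM).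
  have [a [b uE]] := sPU' u uP; have [c [d vE]] := sPU' v vP.
  rewrite xE yE -!fX // uE vE !su_sqr => ne1 ne2; congr (f (su _ _)).
  have c0 : c != 0 by apply: contraNneq ne2 => ->; rewrite mul0r su0 f1.
  have a0 : a != 0 by apply: contraNneq ne1 => ->; rewrite mul0r su0 f1.
  have e : a * theta c = c * theta a.
    by move: uv; rewrite uE vE !suM => /su_inj[_]; rewrite [d + b]addrC => /addrI.
  have A0 : theta a != 0 by rewrite theta_eq0.
  have [ca | ca] : c / a = 0 \/ c / a = 1.
    apply: theta_fixed; rewrite thetaM thetaV; apply: (mulfI a0).
    by rewrite mulrA e mulfK // mulrC mulfVK.
  - by move/eqP: ca; rewrite mulf_eq0 invr_eq0 (negPf c0) (negPf a0).
  - by rewrite -[c](mulfVK a0) ca mul1r.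
have PE v : v \in P -> exists b, v = su 0 b.
  move=> vP; have [a [b vE]] := sPU' v vP; exists b; rewrite vE.
  have := sqrM _ (memM v vP); rewrite -fX ?(subsetP sPL) // => /f_ker.
  rewrite groupX ?(subsetP sPL) // => /(_ isT); rewrite vE su_sqr -su0 => /su_inj[_ /eqP].
  by rewrite mulf_eq0 theta_eq0 orbb => /eqP->.
have tL : tau \in L by rewrite groupM ?sw_in_L ?su_in_L.
have tauM b : (tau * su 0 b)%g = (sw * su 0 (1 + b))%g.
  by rewrite -mulgA suM mul0r !addr0.
have suVE b : (su 0 b)^-1%g = su 0 b by rewrite suV mul0r addr0.
have reg h i : h \in L -> tau = (h ^+ i)%g -> cover_regular L f 2 h.
  move=> hL tauh; apply: (covers_regular_inj coverf f_ker hL) => x xL xh xp.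
  apply: GLval_inj; have m_gt0 := ltnW m_gt1.
  apply: (cyclic_commute_unipotent (A := GLval tau) (isT : prime 2) Fq m_gt0
    (isT : 0 < 4)%N _ tau_cyclic).
  + have q1 : (#|F| ^ 4 = 1 %[mod 5])%N.
      by rewrite Fq -expnM mulnC expnM -modnXm exp1n.
    by rewrite -GLval_X (divn_eq (#|F| ^ 4) 5) q1 expgD mulnC expgM tau5 expg1n mul1g expg1.
  + have xtau : commute x tau by rewrite tauh; apply: commuteX.
    by have:= GLval_commute xtau.
  + by rewrite -GLval_X xp.
have reg1 : cover_regular L f 2 tau by apply: (reg _ 1%N); rewrite ?expg1.
have reg2 : cover_regular L f 2 (tau * tau)%g.
  apply: (reg _ 3); rewrite ?(groupM tL tL) //.
  by rewrite -[(tau * tau)%g]/(tau ^+ 2)%g -expgM expgS tau5 mulg1.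
have free : cover_free L f P tau.
  move=> _ x /PE[b ->] xL.
  move=> /f_inj; rewrite groupM ?su_in_L // groupJr // => /(_ isT tL) e.
  have := congr1 (fun g => \tr (GLval g)) e.
  rewrite mxtrace_conjGL tauM !tr_sw_su thetaD => /(canRL (addKr _)).
  by rewrite addNr => /eqP; rewrite theta_eq0 => /eqP->; rewrite su0.
apply: (obstruction_of_cover coverf (B := [set 1%g]) (isT : prime 2) pM sPL fPM tL tL) => //.
  move=> _ x /PE[b ->] xL /f_inj; have bL := su_in_L 0 b.
  rewrite groupJr // (groupM tL tL) (groupM tL (groupM (groupM bL tL) (groupVr bL))).
  rewrite suVE -[(su 0 b * tau * _)%g]mulgA [(tau * (su 0 b * _))%g]mulgA tauM.
  move=> /(_ isT isT) /(congr1 (fun g => \tr (GLval g))).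
  rewrite mxtrace_conjGL tr_sw_su_sqr (tr_sw_su_sqr 1) theta1 expr1n => /eqP.
  rewrite thetaD theta1 sqrf_eq1 oppff orbb -{2}[1]addr0 (inj_eq (addrI 1)) theta_eq0.
  by move/eqP->; rewrite su0 f1 inE.
by rewrite cards1; apply: leq_trans leM.
Qed.

End Suzuki.

(** * Non-existence of Hopf orders *)

Theorem corollary4p2 (R : realType) (p m : nat) (Fq : finFieldType)
    (gT : finGroupType) (M : {group gT})
    (K : fieldExtType rat) (iota : {rmorphism K -> R[i]})
    (omega : char_group R[i] (subg_of M) -> char_group R[i] (subg_of M) -> K) :
  prime p -> (1 < m)%N -> #|Fq| = (p ^ m)%N ->
  [\/ [set: gT] \isog SL 2 Fq,
      [set: gT] \isog PSL 2 Fq,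
      [set: gT] \isog SL 3 'F_p
    | [/\ p = 2%N, odd m & [set: gT] \isog suzuki m./2 Fq]] ->
  (M :!=: 1)%g -> abelian M -> (p.-group M)%g -> central_type M ->
  splits_galg K M ->
  two_cocycle omega -> cocycle_normalized omega -> cocycle_nondegenerate omega ->
  forall (S : comNzRingType) (j : {rmorphism S -> R[i]}), number_ring j ->
  ~ exists X, hopf_order j
                (H := twisted_galg (fun phi psi => iota (omega phi psi))) X.
Proof.
move=> p_pr m_gt1 cardFq isoG M1 abM pM ctM splM [w0 wM] w1 w_nondeg.
apply: obstruction_no_hopf_order (splits_separate iota splM) _ _ _ _.
- split=> [x y|x y z]; first by rewrite fmorph_eq0.
  by rewrite -!rmorphM wM.
- by move=> x; rewrite !(w1 x).1 !(w1 x).2 rmorph1.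
- move=> x wx; apply: w_nondeg => y; apply: (fmorph_inj iota).
  by rewrite fmorph_div rmorph1.
have leM := central_type_card p_pr pM M1 ctM.
case: isoG => [isoG | isoG | isoG | [p2 m_odd isoG]].
- by apply: (obstruction_SL2_PSL2 p_pr m_gt1 cardFq) => //; left.
- by apply: (obstruction_SL2_PSL2 p_pr m_gt1 cardFq) => //; right.
- exact: (obstruction_SL3 p_pr (card_Fp p_pr)).
- by rewrite p2 in cardFq pM; apply: (obstruction_suzuki m_gt1 m_odd cardFq).
Qed.
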